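(* Let $G$ be a countable locally finite abelian group (written additively) such that $2G=\{2g:g\in G\}$ is infinite, and let $G_\bullet=(G_i)_{i\ge1}$ be a fixed filtration of $G$ by finite subgroups. For all real $0\le\alpha\le\beta\le1$ with $\beta>0$, there exist $A\subseteq G$ and an infinite set $B\subseteq\mathcal P(A)$ such that $$\mathcal L_{G_\bullet}(A)=[\alpha,\beta]\qquad\text{and}\qquad B+B\subseteq\mathcal P(A).$$
   Context: An abelian group is locally finite if every finitely generated subgroup is finite. A filtration of $G$ by finite subgroups is a chain $G_1\le G_2\le\cdots$ of finite subgroups with $\bigcup_{i\ge1}G_i=G$. For $A\subseteq G$, $\mathcal P(A):=\{\sum_{a\in F}a : F\subseteq A,\ |F|<\infty\}$ is the set of finite subset sums, including the empty sum $0$. Put $d_i^{G_\bullet}(S):=|S\cap G_i|/|G_i|$ for $S\subseteq G$; $\mathcal L_{G_\bullet}(A)$ is the set of all $\gamma\in[0,1]$ such that $\lim_{\ell\to\infty}d_{i_\ell}^{G_\bullet}(\mathcal P(A))=\gamma$ for some $i_1<i_2<\cdots$. For $B\subseteq G$, $B+B:=\{b+b':b,b'\in B\}$ (with $b=b'$ allowed). *)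

(* Defs.v *)
From mathcomp Require Export all_boot all_order all_algebra finmap.
From mathcomp Require Export all_classical all_reals all_analysis.

Set Implicit Arguments.
Unset Strict Implicit.
Unset Printing Implicit Defensive.

Import Order.TTheory GRing.Theory Num.Theory.
Import numFieldNormedType.Exports.

Local Open Scope classical_set_scope.
Local Open Scope ring_scope.

Definition is_subgroup (G : zmodType) (H : set G) : Prop := zmod_closed (mem H).

Definition generated_subgroup (G : zmodType) (X : set G) : set G :=
  smallest (@is_subgroup G) X.

Definition locally_finite (G : zmodType) : Prop :=
  forall X : set G, finite_set X -> finite_set (generated_subgroup X).

(* The chain G_1 <= G_2 <= ... is indexed from 0: [Gs i] is G_(i+1). *)
Definition finite_filtration (G : zmodType) (Gs : nat -> set G) : Prop :=
  [/\ forall i, is_subgroup (Gs i),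
      forall i, finite_set (Gs i),
      forall i, Gs i `<=` Gs i.+1
    & \bigcup_i Gs i = [set: G]].

Definition subset_sums (G : zmodType) (A : set G) : set G :=
  [set \sum_(a <- F) a | F in [set F : {fset G} | [set` F] `<=` A]].

(* [fset_set] is the true finite set only on finite arguments; the density is
   meaningful when every [Gs i] is finite and nonempty. *)
Definition density (R : realType) (G : zmodType) (Gs : nat -> set G)
    (i : nat) (S : set G) : R :=
  #|` fset_set (S `&` Gs i)|%:R / #|` fset_set (Gs i)|%:R.

Definition density_limits (R : realType) (G : zmodType) (Gs : nat -> set G)
    (A : set G) : set R :=
  [set gamma : R | 0 <= gamma <= 1 /\
    exists i : nat -> nat, {homo i : m n / (m < n)%N} /\
      (fun l => density R Gs (i l) (subset_sums A)) @ \oo --> gamma].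

Definition sumset (G : zmodType) (B C : set G) : set G :=
  [set b + c | b in B & c in C].

(* Main.v *)
(* Let P(s) be the set of subset sums of a finite subset s of a layer G_i.  New
   elements F are always added so that P(F) meets G_i only in 0; then the part
   of P(s) in G_i never changes again, and the density at G_i is final.  Adding
   to s some multiples of an element x whose subset sums represent each coset of
   G_i in G_i + <x> exactly once keeps the density.  It therefore suffices to
   move the density up and down between alpha and beta in steps tending to 0.

   Since 2G is infinite, one of two cases occurs.  Either there are elements of
   arbitrarily large order modulo each G_i: with x of large order n, leave out a
   few of the n cosets to go down, or cover a few of them by two translates S and
   S + h to go up, a good h existing on average.  Or, for some q that is an odd
   prime or 4, every G_i has an independent element of order q: then the density
   goes down by a direct factor U \ {p} with U finite, and goes up again when U
   is replaced by U + <x>, which divides the missing proportion 1/|U| by q.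
   Infinitely often an x is used for which x and 2x are both new subset sums;
   these x form B. *)
Require Import Defs.
From mathcomp Require Import zify ring lra.

Set Implicit Arguments.
Unset Strict Implicit.
Unset Printing Implicit Defensive.

Import Order.TTheory GRing.Theory Num.Theory.
Import numFieldNormedType.Exports.

Local Open Scope classical_set_scope.
Local Open Scope ring_scope.

(** * Subset sums and finite subgroups *)

(** The filtration is prescribed, so a block from [Gf i] to [Gf k] has to be controlled at every
    layer in between: a suitable [x] may appear only in a much later layer, and its multiples may
    enter one after the other. Each block is therefore designed inside a subgroup [V] containing
    [Gf i], and the rest of [Gf k] is tiled so that every intermediate layer splits along the
    tiling; all densities then become counts in [V]. Since A is a set, the added elements must be
    distinct, which is the reason for the care about digits.

    With large orders the density can climb arbitrarily close to 1. With bounded orders it climbs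
    only by filling holes left on purpose, so there is a ceiling [b]: it starts at 1 and is lowered
    towards beta from above by making some holes permanent. Filling a hole needs two different sums
    in every nontrivial coset of the layer in its extension by [x], while no nonzero sum may fall
    into the layer. For [x] of order 2 these demands exclude each other, and 2x would not be new
    either; hence 4 in place of 2, and the role of 2G. *)

Section SubsetSums.
Variable G : zmodType.
Implicit Types (s : seq G) (x y : G) (H K L T : seq G).

Fixpoint psums s : seq G :=
  if s is a :: s' then psums s' ++ [seq a + y | y <- psums s'] else [:: 0].

Lemma psumsP s y :
  reflect (exists2 t, subseq t s & y = \sum_(a <- t) a) (y \in psums s).
Proof.
apply: (iffP idP).
- elim: s y => [|a s IH] y /=.
    by rewrite inE => /eqP ->; exists [::]; rewrite ?big_nil.
  rewrite mem_cat => /orP[/IH[t ts ->]|/mapP[z /IH[t ts ->] ->]].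
    by exists t => //; apply: subseq_trans ts (subseq_cons _ _).
  by exists (a :: t); rewrite ?big_cons //= eqxx.
- case=> t; elim: s t y => [|a s IH] t y /=.
    by move=> /eqP -> ->; rewrite big_nil mem_head.
  case: t => [_ ->|b t].
    by rewrite mem_cat (IH [::]) ?sub0seq.
  case: eqVneq => [->|_] ts ->; rewrite mem_cat.
    by rewrite big_cons map_f ?orbT ?(IH t).
  by rewrite (IH (b :: t)).
Qed.

Lemma psums0 s : 0 \in psums s.
Proof. by apply/psumsP; exists [::]; rewrite ?big_nil ?sub0seq. Qed.

Lemma mem_psums s a : a \in s -> a \in psums s.
Proof.
by move=> sa; apply/psumsP; exists [:: a]; rewrite ?big_seq1 ?sub1seq.
Qed.

Lemma psums_catP s (t : seq G) y :
  reflect (exists a b, [/\ a \in psums s, b \in psums t & y = a + b])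
  (y \in psums (s ++ t)).
Proof.
apply: (iffP idP).
- elim: s y => [|a s IH] y /=.
    by move=> yt; exists 0, y; rewrite mem_head add0r.
  rewrite mem_cat => /orP[/IH[u [v [us vt ->]]]|/mapP[z /IH[u [v [us vt ->]]] ->]].
    by exists u, v; rewrite mem_cat us.
  by exists (a + u), v; rewrite mem_cat map_f ?orbT ?addrA.
- case=> a [b [/psumsP[u us ->] /psumsP[v vt ->] ->]].
  by apply/psumsP; exists (u ++ v); rewrite ?cat_subseq ?big_cat.
Qed.

Lemma psums_closed (H : {pred G}) s : 0 \in H -> {in H &, forall x y, x + y \in H} ->
  {subset s <= H} -> {subset psums s <= H}.
Proof.
move=> H0 Hadd sH y /psumsP[t ts ->].
have {sH} : {subset t <= H} by move=> a /(mem_subseq ts) /sH.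
elim: t {ts} => [|a t IH] tH; first by rewrite big_nil.
rewrite big_cons; apply: Hadd; first by rewrite tH ?mem_head.
by apply: IH => b bt; rewrite tH // inE bt orbT.
Qed.

Lemma psums_subset s (t : seq G) : uniq s -> {subset s <= t} -> {subset psums s <= psums t}.
Proof.
move=> us st y /psumsP[r rs ->]; have ur := subseq_uniq rs us.
have rt : {subset r <= t} by move=> a /(mem_subseq rs) /st.
apply/psumsP; exists [seq a <- undup t | a \in r].
  exact: subseq_trans (filter_subseq _ _) (undup_subseq _).
apply: perm_big; apply: uniq_perm => //.
  by rewrite filter_uniq ?undup_uniq.
by move=> a; rewrite mem_filter mem_undup; case: (boolP (a \in r)) => //= /rt ->.
Qed.

Lemma eq_mem_psums s (t : seq G) : uniq s -> uniq t -> s =i t -> psums s =i psums t.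
Proof.
by move=> us ut st y; apply/idP/idP; apply: psums_subset => // a; rewrite st.
Qed.

(** Finite subgroups are duplicate-free lists, so that [size] is the order and a density is a
    quotient of [count] by [size]. *)
Definition fsubgroup H := [/\ uniq H, 0 \in H & {in H &, forall x y, x - y \in H}].

Lemma fsubgroup_uniq H : fsubgroup H -> uniq H. Proof. by case. Qed.
Lemma fsubgroup0 H : fsubgroup H -> 0 \in H. Proof. by case. Qed.
Lemma fsubgroupB H : fsubgroup H -> {in H &, forall x y, x - y \in H}.
Proof. by case. Qed.

Lemma fsubgroupN H x : fsubgroup H -> (- x \in H) = (x \in H).
Proof.
move=> sH; have N y : y \in H -> - y \in H.
  by move=> Hy; rewrite -sub0r fsubgroupB ?fsubgroup0.
by apply/idP/idP => /N //; rewrite opprK.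
Qed.

Lemma fsubgroupD H : fsubgroup H -> {in H &, forall x y, x + y \in H}.
Proof.
by move=> sH x y Hx Hy; rewrite -[y]opprK fsubgroupB // fsubgroupN.
Qed.

Lemma fsubgroupDl H x y : fsubgroup H -> x \in H -> (x + y \in H) = (y \in H).
Proof.
move=> sH Hx; apply/idP/idP => [Hxy|Hy]; last exact: fsubgroupD.
by rewrite -(addKr x y) fsubgroupD ?fsubgroupN.
Qed.

Lemma fsubgroupDr H x y : fsubgroup H -> y \in H -> (x + y \in H) = (x \in H).
Proof. by move=> sH Hy; rewrite addrC fsubgroupDl. Qed.

Lemma fsubgroupMn H x n : fsubgroup H -> x \in H -> x *+ n \in H.
Proof.
move=> sH Hx; elim: n => [|n IH]; first by rewrite mulr0n fsubgroup0.
by rewrite mulrS fsubgroupD.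
Qed.

Lemma fsubgroupMz H x c : fsubgroup H -> x \in H -> x *~ c \in H.
Proof.
move=> sH Hx; case: c => n; first by rewrite -pmulrn fsubgroupMn.
by rewrite NegzE -nmulrn fsubgroupN // fsubgroupMn.
Qed.

Lemma psums_fsubgroup H s : fsubgroup H -> {subset s <= H} -> {subset psums s <= H}.
Proof.
by move=> sH; apply: psums_closed; [exact: fsubgroup0|exact: fsubgroupD].
Qed.

Lemma fsubgroup_filter H K :
  fsubgroup H -> fsubgroup K -> fsubgroup [seq x <- H | x \in K].
Proof.
move=> sH sK; split; first by rewrite filter_uniq ?fsubgroup_uniq.
  by rewrite mem_filter !fsubgroup0.
move=> x y; rewrite !mem_filter => /andP[Kx Hx] /andP[Ky Hy].
by rewrite !fsubgroupB.
Qed.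

Definition setsum H K := undup [seq x + y | x <- H, y <- K].

Lemma setsumP H K g :
  reflect (exists x y, [/\ x \in H, y \in K & g = x + y]) (g \in setsum H K).
Proof.
rewrite mem_undup; apply: (iffP allpairsP) => [[[x y] /= [Hx Ky ->]]|[x [y [Hx Ky ->]]]].
  by exists x, y.
by exists (x, y).
Qed.

Lemma mem_setsum H K x y : x \in H -> y \in K -> x + y \in setsum H K.
Proof. by move=> Hx Ky; apply/setsumP; exists x, y. Qed.

Lemma fsubgroup_setsum H K : fsubgroup H -> fsubgroup K -> fsubgroup (setsum H K).
Proof.
move=> sH sK; split; first exact: undup_uniq.
  by rewrite -[0]addr0 mem_setsum ?fsubgroup0.
move=> _ _ /setsumP[x [y [Hx Ky ->]]] /setsumP[x' [y' [Hx' Ky' ->]]].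
by rewrite opprD addrACA mem_setsum ?fsubgroupB.
Qed.

(* [L] is the set of sums [h + t], each [g \in L] having one such
   representation; repetitions in the lists are irrelevant. *)
Definition dsum L H T :=
  (forall g, g \in L <-> exists h t, [/\ h \in H, t \in T & g = h + t]) /\
  (forall h t h' t', h \in H -> t \in T -> h' \in H -> t' \in T ->
     h + t = h' + t' -> h = h' /\ t = t').

Lemma dsum_perm L H T : uniq L -> uniq H -> dsum L H T ->
  perm_eq L [seq h + t | h <- H, t <- undup T].
Proof.
move=> uL uH [LP inj]; apply: uniq_perm => //.
  rewrite allpairs_uniq ?undup_uniq // => -[h t] [h' t'] /=.
  move=> /allpairsP[[a b] /= [Ha]]; rewrite mem_undup => Tb [-> ->].
  move=> /allpairsP[[a' b'] /= [Ha']]; rewrite mem_undup => Tb' [-> ->].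
  by move=> /inj[] // -> ->.
move=> g; apply/idP/idP.
  by move=> /LP[h [t [Hh Ht ->]]]; rewrite allpairs_f ?mem_undup.
by case/allpairsP => -[h t] /= [Hh]; rewrite mem_undup => Ht ->; apply/LP; exists h, t.
Qed.

Lemma dsum_size L H T : uniq L -> uniq H -> dsum L H T ->
  size L = (size H * size (undup T))%N.
Proof. by move=> uL uH /(dsum_perm uL uH)/perm_size ->; rewrite size_allpairs. Qed.

Lemma count_allpairs (A B : Type) (f : A -> B -> G) (p : pred G) (s : seq A) (t : seq B) :
  count p [seq f i j | i <- s, j <- t] = \sum_(i <- s) count (fun j => p (f i j)) t.
Proof.
rewrite count_flatten sumnE !big_map; apply: eq_bigr => x _.
by rewrite count_map; apply: eq_count.
Qed.

(** Each [h] contributes its whole column [h + T] or nothing, so the proportion of [X] in [L] equals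
    that of [Y] in [H]. *)
Lemma dsum_count L H T (X Y : {pred G}) : uniq L -> uniq H -> dsum L H T ->
  (forall h t, h \in H -> t \in T -> (h + t \in X) = (h \in Y)) ->
  count [in X] L = (count [in Y] H * size (undup T))%N.
Proof.
move=> uL uH dL XY; have /permP -> := dsum_perm uL uH dL.
rewrite count_allpairs -sum1_count big_distrl /= [RHS]big_mkcond /=.
apply: eq_big_seq => h Hh; case: ifPn => Yh.
  rewrite mul1n; apply/eqP; rewrite -all_count; apply/allP => t /=.
  by rewrite mem_undup => Tt; rewrite XY.
apply/eqP; rewrite -leqn0 leqNgt -has_count; apply/hasPn => t /=.
by rewrite mem_undup => Tt; rewrite XY.
Qed.

Lemma dsum_sub L H T : H =i L -> (forall t, t \in T <-> t = 0) -> dsum L H T.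
Proof.
move=> HL T0; split=> [g|h t h' t' _ /T0 -> _ /T0 ->]; last by rewrite !addr0.
split=> [Lg|[h [t [Hh /T0 -> ->]]]]; last by rewrite addr0 -HL.
by exists g, 0; rewrite HL addr0; split=> //; apply/T0.
Qed.

(** Transversals of two successive quotients add up to a transversal of the composite one; on subset
    sums this addition is concatenation of lists. *)
Lemma dsum_psums_cat L H1 H s (t : seq G) : dsum L H1 (psums t) -> dsum H1 H (psums s) ->
  dsum L H (psums (t ++ s)).
Proof.
move=> [LP Linj] [HP Hinj]; split.
  move=> g; split.
    case/LP=> h1 [b [/HP[h [a [Hh sa ->]]] tb ->]].
    exists h, (b + a); split=> //; last by rewrite -addrA [b + a]addrC.
    by apply/psums_catP; exists b, a.
  case=> h [c [Hh /psums_catP[b [a [tb sa ->]]] ->]]; apply/LP.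
  exists (h + a), b; split=> //; last by rewrite -addrA [b + a]addrC.
  by apply/HP; exists h, a.
move=> h _ h' _ Hh /psums_catP[b [a [tb sa ->]]] Hh' /psums_catP[b' [a' [tb' sa' ->]]].
rewrite [b + a]addrC [b' + a']addrC !addrA => /Linj[] //.
- by apply/HP; exists h, a.
- by apply/HP; exists h', a'.
by move=> /Hinj[] // -> -> ->.
Qed.

(** The order of [x] in the quotient by [H]; the value 0 stands for infinite order, since 0 divides
    only 0. *)
Definition order_mod x H (n : nat) := forall c : int, (x *~ c \in H) = (n %| c)%Z.

Lemma order_mod_exists x H N : fsubgroup H -> (0 < N)%N -> x *+ N \in H ->
  exists2 n, (0 < n)%N & order_mod x H n.
Proof.
move=> sH N0 HN; pose P n := (0 < n)%N && (x *+ n \in H).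
have exP : exists n, P n by exists N; rewrite /P N0.
case: (ex_minnP exP) => n /andP[n0 Hn] nmin; exists n => // c.
rewrite {1}(divz_eq c n) mulrzDr fsubgroupDl //; last first.
  by rewrite mulrC mulrzA -pmulrn fsubgroupMz.
have n0' : n%:Z != 0 by lia.
have := modz_ge0 c n0'; have := ltz_pmod c (d := n%:Z).
have -> : (n %| c)%Z = ((c %% n)%Z == 0) by apply/dvdz_mod0P/eqP.
case: (c %% n)%Z => // m mn _; rewrite -pmulrn.
have {}mn : (m < n)%N by lia.
case: m mn => [|m] mn; first by rewrite mulr0n fsubgroup0 ?eqxx.
apply/negbTE/negP => Hm; have := nmin m.+1; rewrite /P Hm; lia.
Qed.

End SubsetSums.

Lemma psums_map (G G' : zmodType) (f : {additive G -> G'}) s :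
  psums (map f s) = map f (psums s).
Proof.
elim: s => [|a s IH] /=; first by rewrite raddf0.
rewrite IH map_cat -!map_comp; congr (_ ++ _).
by apply: eq_map => y /=; rewrite raddfD.
Qed.

Lemma psums_mulrz (G : zmodType) (x : G) (cs : seq int) :
  psums [seq x *~ c | c <- cs] = [seq x *~ c | c <- psums cs].
Proof.
elim: cs => [|a s IH] /=; first by rewrite mulr0z.
rewrite IH map_cat -!map_comp; congr (_ ++ _).
by apply: eq_map => y /=; rewrite mulrzDr.
Qed.

(** * Integer digits *)

Section Digits.
Implicit Types (cs : seq int) (c d : int).

Lemma psums_cons_pos cs (a b : int) d : (forall c, (c \in psums cs) = (a <= c < b)) ->
  0 < d <= b - a -> forall c, (c \in psums (d :: cs)) = (a <= c < b + d).
Proof.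
move=> cP hd c; rewrite /= mem_cat cP.
have -> : (c \in [seq d + y | y <- psums cs]) = (c - d \in psums cs).
  apply/mapP/idP => [[y yP ->]|cd]; first by rewrite addrC addKr.
  by exists (c - d); rewrite ?subrKC.
by rewrite cP; lia.
Qed.

Lemma psums_cons_neg cs (a b : int) d : (forall c, (c \in psums cs) = (a <= c < b)) ->
  0 < d <= b - a -> forall c, (c \in psums (- d :: cs)) = (a - d <= c < b).
Proof.
move=> cP hd c; rewrite /= mem_cat cP.
have -> : (c \in [seq - d + y | y <- psums cs]) = (c + d \in psums cs).
  apply/mapP/idP => [[y yP ->]|cd]; first by rewrite addrC addNKr.
  by exists (c + d); rewrite // addrC addrK.
by rewrite cP; lia.
Qed.

(** Halving: digits for the rounded-up half of [n], together with the digit [n./2], give an interval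
    of length [n]. The bound on the absolute values shows that the new digit is not yet present, and
    that the digits stay distinct and nonzero modulo [n]. *)
Lemma digits_exist (n : nat) : (0 < n)%N -> exists cs (r : nat),
  [/\ uniq cs, forall c, c \in cs -> 0 < `|c| *+ 2 <= n%:Z &
      forall c, (c \in psums cs) = (- r%:Z <= c < n%:Z - r%:Z)].
Proof.
elim/ltn_ind: n => n IH n0.
have [->|n1] := eqVneq n 1%N.
  by exists [::], 0%N; split=> // c; rewrite inE; lia.
(* Halving would use the digit 1 twice here; distinct positive digits cannot give exactly 0, 1, 2,
   so a negative one is used. *)
have [->|n3] := eqVneq n 3%N.
  exists [:: -1; 1], 1%N; split=> //.
    by move=> c; rewrite !inE => /orP[]/eqP ->.
  move=> c; rewrite (@psums_cons_neg _ 0 2) // {}/c => c.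
  by rewrite (@psums_cons_pos _ 0 1) // {}/c => c; rewrite inE; lia.
have [||cs [r [ucs csn csP]]] := IH (uphalf n); try lia.
have nu : n%:Z = (uphalf n)%:Z + n./2%:Z by lia.
exists (n./2%:Z :: cs), r; split.
- rewrite /= ucs andbT; apply/negP => /csn; lia.
- move=> c; rewrite inE => /orP[/eqP ->|/csn]; lia.
- move=> c; rewrite (@psums_cons_pos _ (- r%:Z) ((uphalf n)%:Z - r%:Z)) //; lia.
Qed.

(** The classical condition for a complete sequence, read from the tail: a part exceeds the sum of
    those behind it by at most 1, so the subset sums have no gap. *)
Fixpoint greedy (s : seq nat) : bool :=
  if s is a :: s' then [&& (0 < a)%N, (a <= (sumn s').+1)%N & greedy s'] else true.

Lemma psums_greedy s : greedy s ->
  forall c, (c \in psums (map Posz s)) = (0 <= c <= (sumn s)%:Z).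
Proof.
elim: s => [|a s IH] /=; first by move=> _ c; rewrite inE; lia.
case/and3P => a0 sa /IH {}IH c.
rewrite (@psums_cons_pos _ 0 ((sumn s)%:Z + 1)); [lia| |lia].
by move=> d; rewrite IH; lia.
Qed.

Lemma greedy_gt0 s a : greedy s -> a \in s -> (0 < a)%N.
Proof.
elim: s => //= b s IH /and3P[b0 _ /IH {}IH]; rewrite inE.
by case/predU1P => [->|/IH].
Qed.

(** The bound 10 is sharp: 8 and 9 are not sums of such lists. In contrast to [digits_exist] all
    parts are positive, so a sign can be chosen for the whole list and the interval starts or ends
    at 0. *)
Lemma complete_exists (T : nat) : (10 <= T)%N -> exists s,
  [/\ uniq s, greedy s & sumn s = T].
Proof.
move=> T10.
(* The size condition keeps the part [uphalf T], added to a list of sum [T./2], out of that list;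
   the values from 10 to 19 are given by hand. *)
suff [s [us gs ST _]] : exists s, [/\ uniq s, greedy s, sumn s = T &
  all (fun a => (a < 10)%N || (a.*2 <= T.+1)%N) s] by exists s.
elim/ltn_ind: T T10 => T IH T10.
have [T20|T20] := leqP 20 T.
  have [||s [us gs ST /allP sT]] := IH (T./2); try lia.
  exists (uphalf T :: s); split.
  - rewrite /= us andbT; apply/negP => /sT; lia.
  - rewrite /= gs; lia.
  - rewrite /= ST; lia.
  - rewrite /=; apply/andP; split; first lia.
    by apply/allP => a /sT; lia.
have : T \in iota 10 10 by rewrite mem_iota; lia.
case/predU1P => [->|]; first by exists [:: 4; 3; 2; 1]%N.
case/predU1P => [->|]; first by exists [:: 5; 3; 2; 1]%N.
case/predU1P => [->|]; first by exists [:: 6; 3; 2; 1]%N.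
case/predU1P => [->|]; first by exists [:: 7; 3; 2; 1]%N.
case/predU1P => [->|]; first by exists [:: 7; 4; 2; 1]%N.
case/predU1P => [->|]; first by exists [:: 8; 4; 2; 1]%N.
case/predU1P => [->|]; first by exists [:: 6; 4; 3; 2; 1]%N.
case/predU1P => [->|]; first by exists [:: 7; 4; 3; 2; 1]%N.
case/predU1P => [->|]; first by exists [:: 8; 4; 3; 2; 1]%N.
by case/predU1P => [->|//]; exists [:: 9; 4; 3; 2; 1]%N.
Qed.

End Digits.

(** * Cyclic extensions *)

Section CyclicExtension.
Variable G : zmodType.
Implicit Types (s : seq G) (x y g : G) (H K L T V : seq G).

Definition itv (a : int) (n : nat) : seq int := [seq a + k%:Z | k <- iota 0 n].

Lemma mem_itv a n c : (c \in itv a n) = (a <= c < a + n%:Z).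
Proof.
apply/mapP/idP => [[k]|ac]; first by rewrite mem_iota => kn ->; lia.
by exists `|c - a|%N; [rewrite mem_iota; lia | lia].
Qed.

Lemma itv_uniq a n : uniq (itv a n).
Proof. by rewrite map_inj_uniq ?iota_uniq // => i j /addrI[]. Qed.

Definition adjoin H x n := setsum H [seq x *~ c | c <- itv 0 n].

Lemma adjoinP H x n g : fsubgroup H -> (0 < n)%N -> order_mod x H n ->
  g \in adjoin H x n <-> exists h c, h \in H /\ g = h + x *~ c.
Proof.
move=> sH n0 ox; split.
  by case/setsumP => h [_ [Hh /mapP[c _ ->] ->]]; exists h, c.
case=> h [c [Hh ->]]; apply/setsumP.
exists (h + x *~ ((c %/ n)%Z * n)), (x *~ (c %% n)%Z); split.
- by rewrite fsubgroupD // ox dvdz_mull ?dvdzz.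
- by apply: map_f; rewrite mem_itv add0r modz_ge0 ?ltz_pmod //; lia.
- by rewrite -addrA -mulrzDr -divz_eq.
Qed.

Lemma adjoin_fsubgroup H x n : fsubgroup H -> (0 < n)%N -> order_mod x H n ->
  fsubgroup (adjoin H x n).
Proof.
move=> sH n0 ox; have P g := adjoinP g sH n0 ox; split; first exact: undup_uniq.
  by apply/P; exists 0, 0; rewrite fsubgroup0 ?mulr0z ?addr0.
move=> _ _ /P[h [c [Hh ->]]] /P[h' [c' [Hh' ->]]]; apply/P.
by exists (h - h'), (c - c'); rewrite fsubgroupB // mulrzBr opprD addrACA.
Qed.

Lemma adjoin_sub H x n : fsubgroup H -> (0 < n)%N -> order_mod x H n ->
  {subset H <= adjoin H x n}.
Proof.
move=> sH n0 ox h Hh; apply/(adjoinP _ sH n0 ox).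
by exists h, 0; rewrite mulr0z addr0.
Qed.

Lemma mem_adjoin H x n c : fsubgroup H -> (0 < n)%N -> order_mod x H n ->
  x *~ c \in adjoin H x n.
Proof.
move=> sH n0 ox; apply/(adjoinP _ sH n0 ox).
by exists 0, c; rewrite add0r fsubgroup0.
Qed.

Lemma order_mod_inj H x n c d h h' : fsubgroup H -> order_mod x H n ->
  h \in H -> h' \in H -> `|c - d| < n%:Z -> h + x *~ c = h' + x *~ d ->
  c = d /\ h = h'.
Proof.
move=> sH ox Hh Hh' cd e.
have : x *~ (c - d) \in H.
  have -> : x *~ (c - d) = h' - h.
    by rewrite mulrzBr; apply: (addrI h); rewrite addrA e addrK subrKC.
  by rewrite fsubgroupB.
rewrite ox => /dvdzP[q qE].
have q0 : q = 0 by nia.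
have {}cd : c = d by move: qE; rewrite q0 mul0r => /eqP; rewrite subr_eq0 => /eqP.
by split=> //; move: e; rewrite cd => /addIr.
Qed.

(** The free starting point [a] matters later: windows are placed so that the exceptional cosets
    come right after 0. *)
Lemma dsum_adjoin H x n a : fsubgroup H -> (0 < n)%N -> order_mod x H n ->
  dsum (adjoin H x n) H [seq x *~ c | c <- itv a n].
Proof.
move=> sH n0 ox; split.
  move=> g; split; last first.
    by case=> h [_ [Hh /mapP[c _ ->] ->]]; apply/adjoinP => //; exists h, c.
  case/(adjoinP _ sH n0 ox) => h [c [Hh ->]].
  pose d := ((c - a) %% n)%Z + a.
  exists (h + x *~ (c - d)), (x *~ d); split.
  - rewrite fsubgroupD // ox /d.
    have -> : c - (((c - a) %% n)%Z + a) = ((c - a) %/ n)%Z * n.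
      by have := divz_eq (c - a) n; lia.
    by rewrite dvdz_mull ?dvdzz.
  - apply: map_f; rewrite mem_itv /d.
    have := modz_ge0 (c - a) (d := n); have := ltz_pmod (c - a) (d := n); lia.
  - by rewrite -addrA -mulrzDr subrK.
move=> h _ h' _ Hh /mapP[c cI ->] Hh' /mapP[d dI ->] e.
have cd : `|c - d| < n%:Z by move: cI dI; rewrite !mem_itv; lia.
by have [-> ->] := order_mod_inj sH ox Hh Hh' cd e.
Qed.

Lemma eq_dsum L H T T' : T =i T' -> dsum L H T -> dsum L H T'.
Proof.
move=> TT [LP inj]; split=> [g|h t h' t' Hh]; last by rewrite -!TT; apply: inj.
split=> [/LP|] [h [t [Hh Tt ->]]]; first by exists h, t; rewrite -TT.
by apply/LP; exists h, t; rewrite TT.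
Qed.

Lemma psums_window x (cs : seq int) a n :
  (forall c, (c \in psums cs) = (a <= c < a + n%:Z)) ->
  psums [seq x *~ c | c <- cs] =i [seq x *~ c | c <- itv a n].
Proof.
move=> csP y; rewrite psums_mulrz; apply: eq_mem_map => c.
by rewrite csP mem_itv.
Qed.

Lemma dsum_digits H x n (cs : seq int) a : fsubgroup H -> (0 < n)%N -> order_mod x H n ->
  (forall c, (c \in psums cs) = (a <= c < a + n%:Z)) ->
  dsum (adjoin H x n) H (psums [seq x *~ c | c <- cs]).
Proof.
move=> sH n0 ox csP; apply: eq_dsum (dsum_adjoin a sH n0 ox) => y.
by rewrite (psums_window x csP).
Qed.

Lemma window_uniq H x n (cs : seq int) a : fsubgroup H -> order_mod x H n ->
  uniq cs -> (forall c, c \in cs -> a <= c < a + n%:Z) ->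
  uniq [seq x *~ c | c <- cs].
Proof.
move=> sH ox ucs csP; rewrite map_inj_in_uniq // => c d /csP cI /csP dI e.
have cd : `|c - d| < n%:Z by lia.
have H0 := fsubgroup0 sH.
have e' : 0 + x *~ c = 0 + x *~ d by rewrite e.
by have [] := order_mod_inj sH ox H0 H0 cd e'.
Qed.

Lemma dsum_cap L H T t : 0 \in H -> 0 \in T -> dsum L H T ->
  t \in T -> t \in H -> t = 0.
Proof.
move=> H0 T0 [_ inj] Tt Ht.
by have [|? ->] := inj t 0 0 t Ht T0 H0 Tt; rewrite ?addr0 ?add0r.
Qed.

Lemma fsubgroup_torsion L x : fsubgroup L -> x \in L -> exists2 N, (0 < N)%N & x *+ N = 0.
Proof.
move=> sL Lx; pose s := [seq x *+ k | k <- iota 0 (size L).+1].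
have : ~~ uniq s.
  apply/negP => us; have : (size s <= size L)%N.
    by apply: uniq_leq_size => // _ /mapP[k _ ->]; rewrite fsubgroupMn.
  by rewrite size_map size_iota ltnn.
case/(uniqPn 0) => i [j [ij]]; rewrite size_map size_iota => js.
rewrite !(nth_map 0%N) ?size_iota ?(ltn_trans ij) // !nth_iota ?(ltn_trans ij) //.
rewrite !add0n => e; exists (j - i)%N; first by rewrite subn_gt0.
by rewrite mulrnBr ?(ltnW ij) // e subrr.
Qed.

(** Climb from [H] to [L] by cyclic extensions and use one digit system for each of them. *)
Lemma tile_exists H L : fsubgroup H -> fsubgroup L -> {subset H <= L} ->
  exists s, [/\ uniq s, {subset s <= L}, 0 \notin s & dsum L H (psums s)].
Proof.
move=> + sL; have [m] := ubnP (size L - size H)%N.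
elim: m H => // m IH H Hm sH HL.
have [/allP LH|] := boolP (all (mem H) L).
  exists [::]; split=> //; apply: dsum_sub => [g|t /=].
    by apply/idP/idP => [/HL|/LH].
  by rewrite inE; split=> [/eqP|->].
case/allPn => x Lx /= Hx.
have [N N0 xN] := fsubgroup_torsion sL Lx.
have [|n n0 ox] := order_mod_exists sH N0 (x := x).
  by rewrite xN fsubgroup0.
have sV := adjoin_fsubgroup sH n0 ox; set V := adjoin H x n in sV.
have VL : {subset V <= L}.
  move=> g /(adjoinP _ sH n0 ox)[h [c [Hh ->]]].
  by apply: fsubgroupD => //; [exact: HL | exact: fsubgroupMz].
have HV := adjoin_sub sH n0 ox.
have [|//|//|t [ut tL t0 dt]] := IH V.
  have : (size (x :: H) <= size V)%N.
    apply: uniq_leq_size; first by rewrite /= Hx fsubgroup_uniq.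
    move=> y; rewrite inE => /predU1P[->|/HV //].
    by rewrite -[x]mulr1z mem_adjoin.
  have : (size V <= size L)%N by apply: uniq_leq_size VL; apply: fsubgroup_uniq.
  by rewrite /=; move: Hm; lia.
have [cs [r [ucs csn csP]]] := digits_exist n0.
have csP' c : (c \in psums cs) = (- r%:Z <= c < - r%:Z + n%:Z) by rewrite csP; lia.
have dV := dsum_digits sH n0 ox csP'.
exists (t ++ [seq x *~ c | c <- cs]); split.
- rewrite cat_uniq ut /=; apply/andP; split; last first.
    by apply: (window_uniq (a := - r%:Z) sH ox ucs) => c /mem_psums; rewrite csP'.
  apply/hasPn => _ /mapP[c cc ->] /=; apply: contra t0 => tc.
  have := dsum_cap (fsubgroup0 sV) (psums0 t) dt (mem_psums tc).
  by rewrite mem_adjoin // => /(_ isT) <-.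
- move=> y; rewrite mem_cat => /orP[/tL //|/mapP[c _ ->]].
  by apply: VL; apply: mem_adjoin.
- rewrite mem_cat negb_or t0; apply/mapP => -[c /csn cn e].
  by have := ox c; rewrite -e fsubgroup0 // => /esym; rewrite dvdzE => /dvdn_leq; lia.
- exact: dsum_psums_cat dt dV.
Qed.

End CyclicExtension.

(** * Extension blocks *)

Section Blocks.
Variables (R : realFieldType) (G : zmodType) (Gf : nat -> seq G).
Hypothesis Gsub : forall i, fsubgroup (Gf i).
Hypothesis Gmono : forall i j, (i <= j)%N -> {subset Gf i <= Gf j}.
Implicit Types (s D E F V : seq G) (x y g v w : G) (i j k : nat).

Definition cap V j := [seq x <- V | x \in Gf j].

Lemma mem_cap V j x : (x \in cap V j) = (x \in V) && (x \in Gf j).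
Proof. by rewrite mem_filter andbC. Qed.

Lemma cap_fsubgroup V j : fsubgroup V -> fsubgroup (cap V j).
Proof. by move=> sV; apply: fsubgroup_filter. Qed.

Lemma cap_full V j : fsubgroup V -> {subset V <= Gf j} -> cap V j = V.
Proof. by move=> sV VG; apply/all_filterP/allP => x /VG. Qed.

Definition dens j s : R :=
  (count [in psums s] (Gf j))%:R / (size (Gf j))%:R.

(* Sums of the new elements [F] never return to [Gf i], so that the sums
   lying in [Gf i] are not changed later on. *)
Definition ext i s k F := [/\ (i <= k)%N, uniq (F ++ s), {subset F ++ s <= Gf k} &
  forall y, y \in psums F -> y \in Gf i -> y = 0].

(** In a sum that lies in [Gf j], the part coming from [s] lies in [Gf i], hence so does the part
    coming from [F], which must vanish. *)
Lemma ext_psums i s k F j : {subset s <= Gf i} -> ext i s k F -> (j <= i)%N ->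
  {in Gf j, psums (F ++ s) =i psums s}.
Proof.
move=> sG [_ _ _ F0] ji y Gy; apply/psums_catP/idP => [[a [b [aF bs e]]]|ys].
  rewrite e (F0 a) ?add0r //.
  have Gb := psums_fsubgroup (Gsub i) sG bs.
  by rewrite -(fsubgroupDr a (Gsub i) Gb) -e (Gmono ji).
by exists 0, y; rewrite psums0 add0r.
Qed.

Lemma ext_dens i s k F j : {subset s <= Gf i} -> ext i s k F -> (j <= i)%N ->
  dens j (F ++ s) = dens j s.
Proof.
move=> sG sF ji; rewrite /dens; congr (_%:R / _).
by apply: eq_in_count => y Gy; rewrite /= (ext_psums sG sF ji).
Qed.

Lemma ext_trans i s k F k' F' : ext i s k F -> ext k (F ++ s) k' F' ->
  ext i s k' (F' ++ F).
Proof.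
move=> [ik uF FG F0] [kk uF' FG' F0']; split.
- exact: leq_trans kk.
- by rewrite -catA.
- by rewrite -catA.
move=> y /psums_catP[b [a [bF aF ->]]] Gba.
have Ga : a \in Gf k.
  by apply: psums_fsubgroup aF => // z Fz; rewrite FG // mem_cat Fz.
have b0 : b = 0.
  by apply: F0' => //; rewrite -(fsubgroupDr b (Gsub k) Ga) (Gmono ik).
by move: Gba; rewrite b0 add0r => /(F0 _ aF).
Qed.

Lemma ext_refl i s : uniq s -> {subset s <= Gf i} -> ext i s i [::].
Proof. by move=> us sG; split=> // y; rewrite inE => /eqP. Qed.

(** The last clause makes the tiling compatible with the filtration: a sum [v + w] enters an
    intermediate layer only together with both summands. Tiling [V] in the last layer at one stroke
    would not give this, so the tile grows layer by layer. *)
Lemma block_tile i V j : fsubgroup V -> {subset Gf i <= V} -> (i <= j)%N ->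
  exists E, [/\ uniq E, {subset E <= Gf j}, 0 \notin E,
    dsum (Gf j) (cap V j) (psums E) &
    forall j' v w, (i <= j' <= j)%N -> v \in cap V j -> w \in psums E ->
      v + w \in Gf j' -> v \in Gf j'].
Proof.
move=> sV iV; elim: j => [|j IH] ij.
  move: ij iV; rewrite leqn0 => /eqP -> iV.
  exists [::]; split=> //.
    apply: dsum_sub => [g|t]; last by rewrite inE; split=> [/eqP|->].
    by rewrite mem_cap; case: (boolP (g \in Gf 0)) => [/iV ->|]; rewrite ?andbF.
  by move=> j' v w _ _; rewrite inE => /eqP ->; rewrite addr0.
have [{}ij|ij'] := leqP i j; last first.
  have {ij ij'} ei : i = j.+1 by apply/eqP; rewrite eqn_leq ij.
  subst i; exists [::]; split=> //.
    apply: dsum_sub => [g|t]; last by rewrite inE; split=> [/eqP|->].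
    by rewrite mem_cap; case: (boolP (g \in Gf j.+1)) => [/iV ->|]; rewrite ?andbF.
  by move=> j' v w _ _; rewrite inE => /eqP ->; rewrite addr0.
have {IH} [E [uE EG E0 [dE Einj] EP]] := IH ij.
(* The old tile already covers [Gf j]; only the quotient of the new layer by [H] remains to be
   tiled. *)
have sVj := cap_fsubgroup j.+1 sV; pose H := setsum (cap V j.+1) (Gf j).
have sH : fsubgroup H by apply: fsubgroup_setsum.
have HG : {subset H <= Gf j.+1}.
  move=> g /setsumP[v [y [Vv Gy ->]]]; apply: fsubgroupD => //.
    by move: Vv; rewrite mem_cap => /andP[].
  exact: (Gmono (leqnSn j)).
have GH : {subset Gf j <= H}.
  by move=> g Gg; rewrite -[g]add0r mem_setsum // fsubgroup0.
have PE : {subset psums E <= Gf j} by apply: psums_fsubgroup.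
(* The old tile also serves for [H]: two representations differ by an element of [V] and [Gf j],
   where uniqueness is known. *)
have dH : dsum H (cap V j.+1) (psums E).
  split.
    move=> g; split=> [/setsumP[v [y [Vv /dE[v' [w [Vv' Ew ->]] ->]]]]|].
      exists (v + v'), w; split=> //; last by rewrite addrA.
      apply: fsubgroupD => //; move: Vv'; rewrite !mem_cap => /andP[-> /=].
      exact: Gmono.
    by case=> v [w [Vv /PE Ew ->]]; apply: mem_setsum.
  move=> v w v' w' Vv Ew Vv' Ew' e.
  have Vd : v' - v \in cap V j.
    rewrite mem_cap; apply/andP; split.
      by move: Vv Vv'; rewrite !mem_cap => /andP[Vv _] /andP[Vv' _]; rewrite fsubgroupB.
    have -> : v' - v = w - w'.
      by apply/eqP; rewrite subr_eq addrAC eq_sym subr_eq addrC e addrC.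
    by rewrite fsubgroupB // PE.
  have V0 : 0 \in cap V j by apply/fsubgroup0/cap_fsubgroup.
  have e' : v' - v + w' = 0 + w by rewrite addrAC -e addrAC subrr.
  by have [/subr0_eq -> ->] := Einj _ _ _ _ Vd Ew' V0 Ew e'.
have [t [ut tG t0 dt]] := tile_exists sH (Gsub j.+1) HG.
exists (t ++ E); split.
- rewrite cat_uniq ut uE andbT /=; apply/hasPn => a Ea; apply: contra t0 => ta.
  have := dsum_cap (fsubgroup0 sH) (psums0 t) dt (mem_psums ta).
  by move=> <- //; rewrite GH ?EG.
- by move=> y; rewrite mem_cat => /orP[/tG //|/EG]; apply: Gmono.
- by rewrite mem_cat negb_or t0.
- exact: dsum_psums_cat dt dH.
move=> j' v _ /andP[ij' j'j] Vv /psums_catP[b [a [tb Ea ->]]] Gv.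
move: j'j; rewrite leq_eqVlt ltnS => /predU1P[->|j'j].
  by move: Vv; rewrite mem_cap => /andP[].
have Ha := GH _ (PE _ Ea).
have Hv : v \in H by rewrite -[v]addr0 mem_setsum ?fsubgroup0.
have b0 : b = 0.
  have Hb : b \in H.
    rewrite -(fsubgroupDl _ sH Hv) -(fsubgroupDr _ sH Ha) -addrA.
    by apply: GH; apply: (Gmono j'j).
  exact: dsum_cap (fsubgroup0 sH) (psums0 t) dt tb Hb.
move: Gv; rewrite b0 add0r => Gva; apply: (EP j' v a) => //; first by rewrite ij'.
rewrite mem_cap; move: Vv; rewrite mem_cap => /andP[-> _] /=.
by rewrite -(fsubgroupDr v (Gsub j) (PE _ Ea)) (Gmono j'j).
Qed.

(** The reduction to [V]: the new elements [D] are designed there, the tile [E] spreads their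
    pattern over [Gf k], and at each layer between [i] and [k] the density is the proportion inside
    the trace of [V]. *)
Lemma dens_block i k s D V : fsubgroup V -> {subset Gf i <= V} ->
  {subset V <= Gf k} -> (i <= k)%N -> uniq (D ++ s) -> {subset s <= Gf i} ->
  {subset D <= V} -> (forall y, y \in psums D -> y \in Gf i -> y = 0) ->
  exists E, [/\ ext i s k (E ++ D), dsum (Gf k) V (psums E) &
    forall j, (i <= j <= k)%N -> dens j ((E ++ D) ++ s) =
      (count [in psums (D ++ s)] (cap V j))%:R / (size (cap V j))%:R].
Proof.
move=> sV iV Vk ik uDs sG DV D0.
have [E [uE EG E0 dE EP]] := block_tile sV iV ik.
rewrite (cap_full sV Vk) in dE EP.
have EV a : a \in psums E -> a \in V -> a = 0.
  exact: dsum_cap (fsubgroup0 sV) (psums0 E) dE.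
have sV' : {subset s <= V} by move=> a /sG /iV.
have PDs : {subset psums (D ++ s) <= V}.
  by apply: psums_fsubgroup => // a; rewrite mem_cat => /orP[/DV|/sV'].
exists E; split=> //.
- split=> //.
  + rewrite -catA cat_uniq uE uDs andbT /=; apply/hasPn => a aDs; apply: contra E0 => Ea.
    by rewrite -(EV a) ?mem_psums //; apply/PDs/mem_psums.
  + move=> y; rewrite -catA mem_cat => /orP[/EG //|].
    by move=> /mem_psums /PDs /Vk.
  + move=> y /psums_catP[w [d [Ew Dd ->]]] Gy.
    have Vd : d \in V by apply: psums_fsubgroup Dd.
    have Gd : d \in Gf i.
      by apply: (EP i d w) => //; rewrite ?leqnn // addrC.
    rewrite (D0 d) // addr0; apply: EV => //; apply: iV.
    by rewrite -(fsubgroupDr w (Gsub i) Gd).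
move=> j /andP[ij jk].
(* The part of the tile visible in layer [j]; by compatibility it tiles that layer over the trace of
   [V]. *)
pose W := cap (psums E) j.
have dW : dsum (Gf j) (cap V j) W.
  case: dE => dE Einj; split.
    move=> g; split=> [Gg|].
      have /dE[v [w [Vv Ew e]]] : g \in Gf k by apply: Gmono Gg.
      have Gv : v \in Gf j by apply: (EP j v w); rewrite ?ij // -e.
      exists v, w; split=> //; first by rewrite mem_cap Vv.
      by rewrite mem_cap Ew -(fsubgroupDl w (Gsub j) Gv) -e.
    case=> v [w []]; rewrite !mem_cap => /andP[_ Gv] /andP[_ Gw] ->.
    exact: fsubgroupD.
  move=> v w v' w'; rewrite !mem_cap => /andP[Vv _] /andP[Ew _].
  by move=> /andP[Vv' _] /andP[Ew' _]; apply: Einj.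
have uj := fsubgroup_uniq (Gsub j); have uc := fsubgroup_uniq (cap_fsubgroup j sV).
rewrite /dens (dsum_size uj uc dW).
rewrite (dsum_count (Y := [in psums (D ++ s)]) uj uc dW); last first.
  move=> v w; rewrite !mem_cap => /andP[Vv _] /andP[Ew _].
  rewrite -catA; apply/psums_catP/idP => [[w' [y [Ew' Dy e]]]|Dv]; last first.
    by exists w, v; rewrite addrC.
  have [|-> _] := (dE.2 v w y w' Vv Ew (PDs _ Dy) Ew'); last by [].
  by rewrite e addrC.
rewrite !natrM -mulf_div divff ?mulr1 // pnatr_eq0 -lt0n -has_predT; apply/hasP.
by exists 0 => //; rewrite mem_undup mem_cap psums0 fsubgroup0.
Qed.

Lemma dens_ge0 j s : 0 <= dens j s.
Proof. by rewrite divr_ge0. Qed.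

Lemma size_fsubgroup_gt0 V : fsubgroup V -> (0 < size V)%N.
Proof. by move=> sV; rewrite -has_predT; apply/hasP; exists 0; rewrite ?fsubgroup0. Qed.

Lemma dens_gt0 j s : 0 < dens j s.
Proof.
rewrite divr_gt0 ?ltr0n ?size_fsubgroup_gt0 // -has_count; apply/hasP.
by exists 0; [exact: fsubgroup0 | exact: psums0].
Qed.

Lemma dens_le1 j s : dens j s <= 1.
Proof.
by rewrite ler_pdivrMr ?ltr0n ?size_fsubgroup_gt0 // mul1r ler_nat count_size.
Qed.

End Blocks.

(** * Blocks from one cyclic extension *)

Lemma itv_cat a m n : itv a (m + n) = itv a m ++ itv (a + m%:Z) n.
Proof.
rewrite /itv iotaD map_cat; congr (_ ++ _).
rewrite add0n -{1}[m]addn0 iotaDl -map_comp; apply: eq_map => k /=.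
by rewrite PoszD addrA.
Qed.

Lemma size_itv a n : size (itv a n) = n.
Proof. by rewrite size_map size_iota. Qed.

Lemma count_dvd_pos (d : nat) m : (0 < d)%N ->
  count (fun c : int => (d %| c)%Z) (itv 1 m) = (m %/ d)%N.
Proof.
move=> d0; elim: m => [|m IH]; first by rewrite div0n.
rewrite -addn1 itv_cat count_cat IH addn1 divnS // addnC /=.
by congr (_ + _)%N; rewrite addr0 -PoszD add1n addn0.
Qed.

Lemma count_dvd_neg (d : nat) T : (0 < d)%N ->
  count (fun c : int => (d %| c)%Z) (itv (- T%:Z) T.+1) = (T %/ d).+1.
Proof.
move=> d0; elim: T => [|T IH]; first by rewrite div0n /= dvdz0.
rewrite -[T.+2]add1n itv_cat count_cat.
have -> : - T.+1%:Z + 1%:Z = - T%:Z by lia.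
by rewrite IH divnS // addnS /= !addr0 addn0 (dvdzE _ (- _)) abszN.
Qed.

(** Among the cosets of index [c], layer [j] sees those with [c] divisible by the order [d] of [x]
    modulo it. The range from 1 to [m] holds at most [m / d] of these, the range from [- T] to 0,
    which contains 0, at least [(T + 1) / d]. So exceptional cosets placed right after 0 are never
    over-represented in an intermediate layer. *)
Lemma count_dvd_ratio (d : nat) m T : (0 < d)%N ->
  (count (fun c : int => (d %| c)%Z) (itv 1 m) * T.+1 <=
   m * count (fun c : int => (d %| c)%Z) (itv (- T%:Z) T.+1))%N.
Proof.
move=> d0; rewrite count_dvd_pos // count_dvd_neg //.
have h1 : (m %/ d * d <= m)%N := leq_trunc_div m d.
have h2 : (T.+1 <= d * (T %/ d).+1)%N by rewrite mulnC ltn_ceil.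
apply: leq_trans (leq_mul h1 (leqnn _)); rewrite -mulnA.
by rewrite leq_mul2l h2 orbT.
Qed.

Lemma dvdz_small (n : nat) (c : int) : (n %| c)%Z -> `|c| < n%:Z -> c = 0.
Proof. by rewrite dvdzE => /dvdn_leq; lia. Qed.

Section Adjoin.
Variables (R : realFieldType) (G : zmodType) (Gf : nat -> seq G).
Hypothesis Gsub : forall i, fsubgroup (Gf i).
Hypothesis Gmono : forall i j, (i <= j)%N -> {subset Gf i <= Gf j}.
Implicit Types (s D E F V : seq G) (x y g v w h : G) (i j k : nat).
Local Notation dens := (dens R Gf).

Lemma adjoin_perm H x n a : fsubgroup H -> (0 < n)%N -> order_mod x H n ->
  perm_eq (adjoin H x n) [seq h + x *~ c | c <- itv a n, h <- H].
Proof.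
move=> sH n0 ox; have [VP _] := dsum_adjoin a sH n0 ox.
apply: uniq_perm; first exact: fsubgroup_uniq (adjoin_fsubgroup sH n0 ox).
  rewrite allpairs_uniq ?itv_uniq ?(fsubgroup_uniq sH) //.
  move=> [c h] [c' h'] /allpairsP[[b u] /= [bI Hu [-> ->]]].
  move=> /allpairsP[[b' u'] /= [bI' Hu' [-> ->]]] e.
  have cd : `|b - b'| < n%:Z by move: bI bI'; rewrite !mem_itv; lia.
  by have [-> ->] := order_mod_inj sH ox Hu Hu' cd e.
move=> g; apply/idP/allpairsP => [/VP[h [_ [Hh /mapP[c cI ->] ->]]]|[[c h] /= [cI Hh ->]]].
  by exists (c, h).
by apply/VP; exists h, (x *~ c); rewrite map_f.
Qed.

Lemma count_adjoin (p : pred G) i j x n a : (0 < n)%N -> order_mod x (Gf i) n ->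
  (i <= j)%N -> count p (cap Gf (adjoin (Gf i) x n) j) =
  (\sum_(c <- itv a n | x *~ c \in Gf j) count (fun h => p (h + x *~ c)%R) (Gf i))%N.
Proof.
move=> n0 ox ij; rewrite count_filter.
have /permP -> := adjoin_perm a (Gsub i) n0 ox.
rewrite count_allpairs [RHS]big_mkcond /=; apply: eq_bigr => c _.
case: ifPn => Gc.
  by apply: eq_in_count => h Hh /=; rewrite fsubgroupDr // (Gmono ij) ?andbT.
apply/eqP; rewrite -leqn0 leqNgt -has_count; apply/hasPn => h Hh /=.
by rewrite negb_and (fsubgroupDl _ (Gsub j) (Gmono ij Hh)) Gc orbT.
Qed.

Lemma order_mod_up i j x n : (i <= j)%N -> (0 < n)%N -> order_mod x (Gf i) n ->
  exists2 d, (0 < d)%N & order_mod x (Gf j) d.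
Proof.
move=> ij n0 ox; apply: (order_mod_exists (Gsub j) n0).
by apply: (Gmono ij); rewrite pmulrn ox dvdzz.
Qed.

Lemma count_shift H h (p : pred G) : fsubgroup H -> h \in H ->
  count (fun y => p (y + h)) H = count p H.
Proof.
move=> sH Hh; rewrite -(count_map (+%R^~ h)) /=; apply/permP/uniq_perm.
- by rewrite map_inj_uniq ?fsubgroup_uniq //; apply: addIr.
- exact: fsubgroup_uniq.
move=> y; apply/mapP/idP => [[z Hz ->]|Hy]; first exact: fsubgroupD.
by exists (y - h); rewrite ?subrK // fsubgroupB.
Qed.

Definition valid i s := uniq s /\ {subset s <= Gf i}.

Lemma sum_count_const (I : Type) (r : seq I) (P : pred I) (F : I -> nat) (c : nat) :
  (forall a, P a -> F a = c) -> (\sum_(a <- r | P a) F a = c * count P r)%N.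
Proof.
by move=> Fc; rewrite (eq_bigr (fun=> c)) // big_const_seq iter_addn_0.
Qed.

Lemma window_notin H x n (cs : seq int) : fsubgroup H -> order_mod x H n ->
  (forall c, c \in cs -> 0 < `|c| < n%:Z) ->
  forall c, c \in cs -> x *~ c \notin H.
Proof.
move=> sH ox csP c /csP; rewrite ox dvdzE => cn; apply/negP => /dvdn_leq; lia.
Qed.

(** The [n] cosets are arranged as [T + 1] ordinary ones ending at 0, [m] exceptional ones, and [l]
    more ordinary ones. In layer [j], [t] ordinary and [u] exceptional cosets are visible. *)
Lemma count_fibres (X : seq G) i j x n T m l a b : (0 < n)%N ->
  order_mod x (Gf i) n -> (i <= j)%N -> n = (T.+1 + (m + l))%N ->
  (forall c, c \in itv (- T%:Z) n -> count (fun h => h + x *~ c \in X) (Gf i) =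
    if 0 < c <= m%:Z then b else a) ->
  exists t u : nat, [/\ (0 < t)%N, (u * T.+1 <= m * t)%N,
    count [in X] (cap Gf (adjoin (Gf i) x n) j) = (a * t + b * u)%N,
    size (cap Gf (adjoin (Gf i) x n) j) = (size (Gf i) * (t + u))%N &
    x \in Gf j -> t = (n - m)%N /\ u = m].
Proof.
move=> n0 ox ij nE fib; have [d d0 od] := order_mod_up ij n0 ox.
pose Q := fun c : int => (d %| c)%Z.
have IE : itv (- T%:Z) n = itv (- T%:Z) T.+1 ++ itv 1 m ++ itv (1 + m%:Z) l.
  by rewrite nE !itv_cat (_ : - T%:Z + T.+1%:Z = 1) //; lia.
pose t0 := count Q (itv (- T%:Z) T.+1); pose u := count Q (itv 1 m).
pose t1 := count Q (itv (1 + m%:Z) l).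
have splitI (F : int -> nat) c0 c1 :
    (forall c, c \in itv (- T%:Z) n -> F c = if 0 < c <= m%:Z then c1 else c0) ->
    (\sum_(c <- itv (- T%:Z) n | x *~ c \in Gf j) F c = c0 * (t0 + t1) + c1 * u)%N.
  move=> FE; rewrite IE !big_cat /=.
  have sumE c2 r : {subset r <= itv (- T%:Z) n} ->
      (forall c, c \in r -> (if 0 < c <= m%:Z then c1 else c0) = c2) ->
      (\sum_(c <- r | x *~ c \in Gf j) F c = c2 * count Q r)%N.
    move=> rI rc; rewrite -(@sum_count_const _ r Q (fun=> c2) c2) //.
    rewrite [LHS]big_mkcond [RHS]big_mkcond; apply: eq_big_seq => c cr.
    by rewrite od -/(Q c); case: ifP => // _; rewrite FE ?rc ?rI.
  rewrite (sumE c0 (itv (- T%:Z) T.+1)) ?(sumE c1 (itv 1 m));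
    rewrite ?(sumE c0 (itv (1 + m%:Z) l)) -/t0 -/t1 -/u;
    try (move=> c; rewrite !mem_itv; first [lia | move=> cI; case: ifP => //; lia]).
  by rewrite mulnDr addnAC addnA.
exists (t0 + t1)%N, u; split.
- by rewrite /t0 count_dvd_neg.
- apply: leq_trans (count_dvd_ratio m T d0) _.
  by rewrite leq_mul2l leq_addr orbT.
- by rewrite (count_adjoin _ (- T%:Z) n0 ox ij) (splitI _ a b).
- rewrite -count_predT (count_adjoin _ (- T%:Z) n0 ox ij).
  rewrite (splitI _ (size (Gf i)) (size (Gf i))) ?mulnDr // => c _.
  by rewrite count_predT; case: ifP.
move=> xj; have allQ r : count Q r = size r.
  apply/eqP; rewrite -all_count; apply/allP => c _.
  by rewrite /= /Q -od fsubgroupMz.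
by rewrite /t0 /t1 /u !allQ !size_itv; lia.
Qed.

Lemma adjoin_block i k s x n D : valid i s -> (i <= k)%N -> x \in Gf k -> (0 < n)%N ->
  order_mod x (Gf i) n -> uniq D -> {subset D <= adjoin (Gf i) x n} ->
  (forall d, d \in D -> d \notin Gf i) ->
  (forall y, y \in psums D -> y \in Gf i -> y = 0) ->
  exists E, [/\ ext Gf i s k (E ++ D), dsum (Gf k) (adjoin (Gf i) x n) (psums E) &
    forall j, (i <= j <= k)%N -> dens j ((E ++ D) ++ s) =
      (count [in psums (D ++ s)] (cap Gf (adjoin (Gf i) x n) j))%:R /
      (size (cap Gf (adjoin (Gf i) x n) j))%:R].
Proof.
move=> [us sG] ik xk n0 ox uD DV nD D0; have sK := Gsub i.
have sV := adjoin_fsubgroup sK n0 ox.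
apply: (dens_block R Gsub Gmono sV) => //.
- exact: adjoin_sub.
- move=> g /(adjoinP _ sK n0 ox)[h [c [Hh ->]]].
  by apply: fsubgroupD => //; [exact: (Gmono ik) | exact: fsubgroupMz].
- rewrite cat_uniq us uD andbT /=; apply/hasPn => a /sG sa.
  by apply/negP => /nD; rewrite sa.
Qed.

(** The bounds on [c] exclude wrapping around modulo [n]: [c] differs by less than [n] from every
    index that the digits reach. *)
Lemma mem_psums_window i s x n (cs : seq int) a b h c : {subset s <= Gf i} ->
  order_mod x (Gf i) n -> (forall d, (d \in psums cs) = (a <= d < b)) ->
  b - n%:Z <= c < a + n%:Z -> h \in Gf i ->
  (h + x *~ c \in psums ([seq x *~ d | d <- cs] ++ s)) =
    (a <= c < b) && (h \in psums s).
Proof.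
move=> sG ox csP cI Hh; apply/psums_catP/andP => [|[cab sh]]; last first.
  by exists (x *~ c), h; rewrite addrC psums_mulrz map_f ?csP.
case=> y [u [+ su]]; rewrite psums_mulrz => /mapP[d dcs ->] e.
have Hu := psums_fsubgroup (Gsub i) sG su; rewrite csP in dcs.
have cd : `|c - d| < n%:Z by lia.
have e' : h + x *~ c = u + x *~ d by rewrite e addrC.
by have [-> ->] := order_mod_inj (Gsub i) ox Hh Hu cd e'.
Qed.

(** Negative digits with sums from [- T] to 0 leave exactly the cosets 1 to [m] empty; [T >= 10] is
    what [complete_exists] asks for. *)
Lemma down_block i k s x n m T : valid i s -> (i <= k)%N -> x \in Gf k ->
  order_mod x (Gf i) n -> n = (T.+1 + m)%N -> (10 <= T)%N ->
  exists F, [/\ ext Gf i s k F,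
    forall j, (i <= j <= k)%N ->
      dens i s * (1 - m%:R / n%:R) <= dens j (F ++ s) <= dens i s &
    dens k (F ++ s) = dens i s * (1 - m%:R / n%:R)].
Proof.
move=> vs ik xk ox nE T10; have n0 : (0 < n)%N by rewrite nE.
have [us sG] := vs.
have sK := Gsub i; have [ds [uds gds dsT]] := complete_exists T10.
have dsP := psums_greedy gds; rewrite dsT in dsP.
pose cs := map (fun a : nat => - a%:Z) ds.
have csP c : (c \in psums cs) = (- T%:Z <= c < - T%:Z + T.+1%:Z).
  have -> : cs = [seq (-%R : int -> int) c | c <- map Posz ds] by rewrite -map_comp.
  rewrite psums_map; have -> : c = - (- c) by rewrite opprK.
  by rewrite mem_map ?dsP; [lia | exact: oppr_inj].
have csn c : c \in cs -> 0 < `|c| < n%:Z.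
  move=> ccs; have := mem_psums ccs; rewrite csP.
  case/mapP: ccs => a /(greedy_gt0 gds) a0 ->; lia.
have csI c : c \in cs -> - T%:Z <= c < - T%:Z + n%:Z.
  by move=> /mem_psums; rewrite csP; lia.
have ucs : uniq cs by rewrite map_inj_uniq // => a b /oppr_inj[].
set D := [seq x *~ c | c <- cs].
have [||||E [Eext _ EP]] := adjoin_block (D := D) vs ik xk n0 ox.
- exact: window_uniq sK ox ucs csI.
- by move=> _ /mapP[c _ ->]; apply: mem_adjoin.
- by move=> _ /mapP[c /(window_notin sK ox csn) + ->].
- move=> y; rewrite psums_mulrz => /mapP[c + ->].
  by rewrite csP ox => cI /dvdz_small ->; [rewrite mulr0z | lia].
pose S := count [in psums s] (Gf i).
have fib c : c \in itv (- T%:Z) n ->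
    count (fun h => h + x *~ c \in psums (D ++ s)) (Gf i) =
    if 0 < c <= m%:Z then 0%N else S.
  rewrite mem_itv => cI.
  have E0 h : h \in Gf i -> (h + x *~ c \in psums (D ++ s)) =
      (- T%:Z <= c < - T%:Z + T.+1%:Z) && (h \in psums s).
    by move=> Hh; apply: (mem_psums_window sG ox csP) => //; lia.
  rewrite (eq_in_count E0); case: ifPn => c0.
    by rewrite (_ : _ && _ = false) ?count_pred0 //; lia.
  by rewrite (_ : _ && _ = true) //; lia.
have nE' : n = (T.+1 + (m + 0))%N by rewrite addn0.
have n0R : 0 < n%:R :> R by rewrite ltr0n.
have key j : (i <= j <= k)%N -> exists t u : nat,
    [/\ (0 < t)%N, (u * T.+1 <= m * t)%N,
     dens j ((E ++ D) ++ s) = dens i s * (t%:R / (t + u)%:R) &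
     j = k -> t = (n - m)%N /\ u = m].
  move=> /[dup] ijk /andP[ij jk].
  have [t [u [t0 ut cX sX jx]]] := count_fibres n0 ox ij nE' fib.
  exists t, u; split=> //; last by move=> jk'; apply: jx; rewrite jk'.
  by rewrite EP // cX sX mul0n addn0 !natrM mulf_div.
exists (E ++ D); split=> // [j /key[t [u [t0 ut -> _]]]|].
  have d0 := dens_gt0 R Gsub i s.
  have tu0 : 0 < (t + u)%:R :> R by rewrite ltr0n addn_gt0 t0.
  rewrite ler_pM2l // ger_pMr // ler_pdivrMr // mul1r ler_nat leq_addr andbT.
  rewrite ler_pdivlMr // mulrBl mul1r lerBlDr natrD lerD2l mulrAC ler_pdivlMr //.
  rewrite -!natrM -natrD -natrM ler_nat nE; nia.
have [|t [u [_ _ -> []//-> ->]]] := key k; first by rewrite ik leqnn.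
have mn : (m <= n)%N by rewrite nE leq_addl.
by rewrite subnK // natrB // mulrBl divff ?gt_eqF.
Qed.

(** Digits with sums from [- (M - 1)] to [m], and one further element [d], congruent to [M] times
    [x] and carrying the shift [h]. The window and its translate by [M] together cover all
    [n = 2 M + m] cosets and overlap exactly on 1 to [m]. There the fibre is the union of the old
    sums and their translate by [h]; elsewhere it is a single translate. *)
Lemma up_block i k s x n m M h : valid i s -> (i <= k)%N -> x \in Gf k ->
  order_mod x (Gf i) n -> n = (M + M + m)%N -> (10 <= m < M)%N -> h \in Gf i ->
  let S := count [in psums s] (Gf i) in
  let U := count [pred y | (y \in psums s) || (y - h \in psums s)] (Gf i) in
  exists F, [/\ ext Gf i s k F,
    forall j, (i <= j <= k)%N ->
      dens i s <= dens j (F ++ s) <= dens i s * (1 + m%:R / (M + m)%:R) &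
    dens k (F ++ s) = dens i s + (U - S)%:R / (size (Gf i))%:R * (m%:R / n%:R)].
Proof.
move=> vs ik xk ox nE mM Hh S U; have n0 : (0 < n)%N by lia.
have [us sG] := vs; have sK := Gsub i.
have [T MT] : exists T, M = T.+1 by exists M.-1; lia.
have nE' : n = (T.+1 + (m + M))%N by lia.
have [|ds [uds gds dsT]] := @complete_exists T; first lia.
have [|es [ues ges esm]] := @complete_exists m; first lia.
have dsP := psums_greedy gds; rewrite dsT in dsP.
have esP := psums_greedy ges; rewrite esm in esP.
pose cs := map Posz es ++ map (fun a : nat => - a%:Z) ds.
have dsP' c : (c \in psums (map (fun a : nat => - a%:Z) ds)) = (- T%:Z <= c <= 0).
  have -> : map (fun a : nat => - a%:Z) ds = [seq (-%R : int -> int) c | c <- map Posz ds].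
    by rewrite -map_comp.
  rewrite psums_map; have -> : c = - (- c) by rewrite opprK.
  by rewrite mem_map ?dsP; [lia | exact: oppr_inj].
have csP c : (c \in psums cs) = (- T%:Z <= c < m%:Z + 1).
  apply/psums_catP/idP => [[a [b []]]|cI]; first by rewrite esP dsP'; lia.
  have [c0|c0] := lerP 0 c.
    by exists c, 0; rewrite esP dsP'; split; lia.
  by exists 0, c; rewrite esP dsP'; split; lia.
have csn c : c \in cs -> 0 < `|c| < n%:Z.
  move=> ccs; have := mem_psums ccs; rewrite csP; move: ccs; rewrite mem_cat.
  by case/orP=> /mapP[a]; [move/(greedy_gt0 ges)|move/(greedy_gt0 gds)] => a0 ->; lia.
have csI c : c \in cs -> - T%:Z <= c < - T%:Z + n%:Z.
  by move=> /mem_psums; rewrite csP; lia.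
have ucs : uniq cs.
  rewrite cat_uniq map_inj_uniq ?ues ?map_inj_uniq ?uds ?andbT /=.
  - apply/hasPn => _ /mapP[a ads ->]; apply/mapP => -[b bes].
    by have := greedy_gt0 gds ads; lia.
  - by move=> a b /oppr_inj[].
  - by move=> a b [].
set D0 := [seq x *~ c | c <- cs]; set d := x *~ M%:Z + h.
have E0 g c : c = c -> g \in Gf i -> m%:Z + 1 - n%:Z <= c < - T%:Z + n%:Z ->
    (g + x *~ c \in psums (D0 ++ s)) = (- T%:Z <= c < m%:Z + 1) && (g \in psums s).
  by move=> _ Hg cI; apply: (mem_psums_window sG ox csP).
have Ed g c : g \in Gf i -> m%:Z + 1 - n%:Z <= c - M%:Z < - T%:Z + n%:Z ->
    (g + x *~ c \in [seq d + y | y <- psums (D0 ++ s)]) =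
    (- T%:Z <= c - M%:Z < m%:Z + 1) && (g - h \in psums s).
  move=> Hg cI; rewrite -E0 ?fsubgroupB //.
  have -> : g + x *~ c = d + (g - h + x *~ (c - M%:Z)).
    by rewrite mulrzBr /d [_ + h]addrC addrACA !subrKC.
  by rewrite mem_map //; apply: addrI.
have [||||E [Eext _ EP]] := adjoin_block (D := d :: D0) vs ik xk n0 ox.
- rewrite /= (window_uniq sK ox ucs csI) andbT.
  apply/mapP => -[c /mem_psums]; rewrite csP => cI e.
  have MC : `|M%:Z - c| < n%:Z by lia.
  have e' : h + x *~ M%:Z = 0 + x *~ c by rewrite add0r -e addrC.
  have [] := order_mod_inj sK ox Hh (fsubgroup0 sK) MC e'; lia.
- move=> y; rewrite inE => /predU1P[->|/mapP[c _ ->]]; last exact: mem_adjoin.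
  by apply/adjoinP => //; exists h, M%:Z; rewrite addrC.
- move=> y; rewrite inE => /predU1P[->|/mapP[c /(window_notin sK ox csn) + ->//]].
  by rewrite /d fsubgroupDr // ox dvdzE; apply/negP => /dvdn_leq; lia.
- move=> y; rewrite /= mem_cat => /orP[|/mapP[z]]; rewrite psums_mulrz => /mapP[c].
    rewrite csP => cI ->; rewrite ox => /dvdz_small -> //.
    by move: cI nE' mM; clear; lia.
  rewrite csP => cI -> ->; rewrite /d addrAC -mulrzDr fsubgroupDr // ox.
  by move=> /dvdz_small; move: cI nE' mM MT; clear; lia.
have Sh : count (fun y => y - h \in psums s) (Gf i) = S.
  by apply: (count_shift [in psums s] sK); rewrite fsubgroupN.
have fib c : c \in itv (- T%:Z) n ->
    count (fun h => h + x *~ c \in psums ((d :: D0) ++ s)) (Gf i) =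
    if 0 < c <= m%:Z then U else S.
  rewrite mem_itv => cI.
  have F0 g : g \in Gf i -> (g + x *~ c \in psums ((d :: D0) ++ s)) =
     (- T%:Z <= c < m%:Z + 1) && (g \in psums s) ||
     (- T%:Z <= c - M%:Z < m%:Z + 1) && (g - h \in psums s).
    by move=> Hg; rewrite /= mem_cat E0 ?Ed //; move: cI mM nE' MT; clear; lia.
  rewrite (eq_in_count F0); case: ifPn => c0.
    have [-> ->] : (- T%:Z <= c < m%:Z + 1) /\ (- T%:Z <= c - M%:Z < m%:Z + 1).
      by move: cI c0 mM nE' MT; clear; lia.
    by [].
  have [c1|c1] := lerP c 0.
    have [-> /negbTE ->] : (- T%:Z <= c < m%:Z + 1) /\ ~~ (- T%:Z <= c - M%:Z < m%:Z + 1).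
      by move: cI c0 c1 mM nE' MT; clear; lia.
    by apply: eq_count => g /=; rewrite orbF.
  have [/negbTE -> ->] : ~~ (- T%:Z <= c < m%:Z + 1) /\ (- T%:Z <= c - M%:Z < m%:Z + 1).
    by move: cI c0 c1 mM nE' MT; clear; lia.
  exact: Sh.
have SU : (S <= U)%N by apply: sub_count => y /= ->.
have US : (U <= S + S)%N.
  by rewrite -{2}Sh -count_predUI leq_addr.
have K0 : (0 < size (Gf i))%N := size_fsubgroup_gt0 sK.
have key j : (i <= j <= k)%N -> exists t u : nat,
    [/\ (0 < t)%N, (u * T.+1 <= m * t)%N,
     dens j ((E ++ (d :: D0)) ++ s) =
       dens i s + (U - S)%:R / (size (Gf i))%:R * (u%:R / (t + u)%:R) &
     j = k -> t = (n - m)%N /\ u = m].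
  move=> /[dup] ijk /andP[ij jk].
  have [t [u [t0 ut cX sX jx]]] := count_fibres n0 ox ij nE' fib.
  exists t, u; split=> //; last by move=> jk'; apply: jx; rewrite jk'.
  rewrite EP // cX sX natrM /dens -/S natrB // !natrD !natrM; field.
  by rewrite -natrD !pnatr_eq0; move: t0 K0; clear; lia.
exists (E ++ (d :: D0)); split=> // [j /key[t [u [t0 ut -> _]]]|].
  have tu0 : 0 < (t + u)%:R :> R by rewrite ltr0n addn_gt0 t0.
  rewrite lerDl mulr_ge0 ?divr_ge0 //= mulrDr mulr1 lerD2l.
  apply: ler_pM; rewrite ?divr_ge0 //.
    by rewrite ler_pM2r ?invr_gt0 ?ltr0n // ler_nat leq_subLR.
  rewrite ler_pdivrMr // mulrAC ler_pdivlMr ?ltr0n; last by move: mM; clear; lia.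
  by rewrite -!natrM ler_nat MT; move: ut; clear; nia.
have [|t [u [_ _ -> []//-> ->]]] := key k; first by rewrite ik leqnn.
by rewrite subnK //; lia.
Qed.

End Adjoin.

(** * Paths of densities *)

Section Paths.
Variables (R : archiRealFieldType) (G : zmodType) (Gf : nat -> seq G).
Hypothesis Gsub : forall i, fsubgroup (Gf i).
Hypothesis Gmono : forall i j, (i <= j)%N -> {subset Gf i <= Gf j}.
Hypothesis Gexh : forall x, exists i, x \in Gf i.
Implicit Types (s D E F V : seq G) (x y g v w h : G) (i j k : nat) (e lo hi : R).
Local Notation dens := (dens R Gf).
Local Notation valid := (valid Gf).
Local Notation ext := (ext Gf).

Lemma Gexh_ge i x : exists2 k, (i <= k)%N & x \in Gf k.
Proof.
have [j xj] := Gexh x; exists (maxn i j); first exact: leq_maxl.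
by apply: Gmono xj; apply: leq_maxr.
Qed.

Definition dpath e lo hi i s k s' := exists F, [/\ s' = F ++ s, ext i s k F,
  forall j, (i <= j <= k)%N -> lo <= dens j s' <= hi &
  forall j, (i <= j < k)%N -> `|dens j.+1 s' - dens j s'| <= e].

Lemma dpath_valid e lo hi i s k s' : dpath e lo hi i s k s' -> valid k s'.
Proof. by case=> F [-> [_ uF FG _] _ _]; split. Qed.

Lemma dpath_refl e lo hi i s : valid i s -> lo <= dens i s <= hi ->
  dpath e lo hi i s i s.
Proof.
move=> [us sG] d; exists [::]; split=> //; first exact: ext_refl.
  by move=> j ij; have -> : j = i by apply/eqP; rewrite eqn_leq andbC.
by move=> j; rewrite ltnNge; case: (i <= j)%N.
Qed.

(** The first path is measured with [s']; its layers are frozen, so the values are the same for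
    [s'']. *)
Lemma dpath_trans e lo hi i s k s' l s'' : valid i s ->
  dpath e lo hi i s k s' -> dpath e lo hi k s' l s'' -> dpath e lo hi i s l s''.
Proof.
move=> vs p1 p2; have vs' := dpath_valid p1.
case: p1 => F [s'E xF dF mF]; case: p2 => F' [s''E xF' dF' mF'].
exists (F' ++ F); split.
- by rewrite s''E s'E catA.
- by apply: (ext_trans Gsub Gmono xF); rewrite -s'E.
- move=> j /andP[ij jl]; have [jk|kj] := leqP j k; last by rewrite dF' // (ltnW kj).
  by rewrite s''E (ext_dens _ Gsub Gmono vs'.2 xF') // dF // ij.
- move=> j /andP[ij jl]; have [kj|jk] := leqP k j; first by rewrite mF' // kj.
  by rewrite s''E !(ext_dens _ Gsub Gmono vs'.2 xF') ?(ltnW jk) // mF // ij.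
Qed.

Lemma dpath_weaken e lo hi e' lo' hi' i s k s' : dpath e lo hi i s k s' ->
  e <= e' -> lo' <= lo -> hi <= hi' -> dpath e' lo' hi' i s k s'.
Proof.
case=> F [s'E xF dF mF] ee ll hh; exists F; split=> //.
  by move=> j /dF /andP[a b]; rewrite (le_trans ll) ?(le_trans b).
by move=> j /mF m; apply: le_trans ee.
Qed.

(** Nothing is known about how the density moves inside a block, so the width of its range bounds
    each jump. *)
Lemma dpath_block e lo hi i s k F : ext i s k F ->
  (forall j, (i <= j <= k)%N -> lo <= dens j (F ++ s) <= hi) -> hi - lo <= e ->
  dpath e lo hi i s k (F ++ s).
Proof.
move=> xF dF he; exists F; split=> // j /andP[ij jk]; apply: le_trans he.
have /andP[a b] : lo <= dens j (F ++ s) <= hi by rewrite dF // ij ltnW.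
have /andP[c d] : lo <= dens j.+1 (F ++ s) <= hi by rewrite dF // (leq_trans ij) /=.
by rewrite ler_norml; apply/andP; split; lra.
Qed.

Lemma dpath_bounds e lo hi i s k s' : valid i s -> dpath e lo hi i s k s' ->
  lo <= dens i s <= hi /\ lo <= dens k s' <= hi.
Proof.
move=> vs [F [-> xF dF _]]; have [ik _ _ _] := xF; split; last by rewrite dF ?ik /=.
by rewrite -(ext_dens _ Gsub Gmono vs.2 xF (leqnn i)) dF // leqnn.
Qed.

(** The descent stops as soon as the density is at most [tau]. The last step starts above [tau] and
    loses at most the factor [1 - e], whence the lower bound. The predicate [I] is whatever
    structure the steps must preserve. *)
Lemma dpath_down (I : nat -> seq G -> Prop) e c tau : 0 <= e <= 1 -> 0 < c -> 0 < tau ->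
  (forall i s, I i s -> valid i s) ->
  (forall i s, I i s -> exists k s', [/\ dpath e (dens i s * (1 - e)) (dens i s) i s k s',
     dens k s' <= dens i s * (1 - c) & I k s']) ->
  forall i s, I i s -> exists k s',
    [/\ dpath e (Num.min (dens i s) (tau * (1 - e))) (dens i s) i s k s',
      dens k s' <= tau & I k s'].
Proof.
move=> e01 c0 tau0 Iv step i s.
have tc : 0 < tau * c by rewrite mulr_gt0.
(* The number of steps: above [tau], each of them costs at least [tau * c]. *)
have [r] : exists r : nat, dens i s <= tau + r%:R * (tau * c).
  exists (Num.truncn ((dens i s - tau) / (tau * c))).+1.
  by rewrite -lerBlDl -ler_pdivrMr // ltW ?truncnS_gt.
elim: r i s => [|r IH] i s dr Iis.
  exists i, s; split=> //; last by move: dr; rewrite mul0r addr0.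
  by apply: dpath_refl; [exact: Iv | rewrite ge_min lexx /=].
have [dt|td] := leP (dens i s) tau.
  exists i, s; split=> //.
  by apply: dpath_refl; [exact: Iv | rewrite ge_min lexx /=].
have [k [s' [p1 d1 Iks]]] := step i s Iis.
have [|l [s'' [p2 d2 Ils]]] := IH k s' _ Iks.
  have : tau * c <= dens i s * c by rewrite ler_pM2r // ltW.
  by move: dr d1; rewrite mulrBr mulr1 -natr1 mulrDl mul1r; lra.
have td1 : tau * (1 - e) <= dens i s * (1 - e).
  by apply: ler_wpM2r (ltW td); lra.
have [_ /andP[d3 d4]] := dpath_bounds (Iv _ _ Iis) p1.
exists l, s''; split=> //; apply: dpath_trans (Iv _ _ Iis) _ _.
- by apply: (dpath_weaken p1) => //; rewrite ge_min td1 orbT.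
- apply: (dpath_weaken p2) => //.
  by rewrite le_min !ge_min lexx orbT andbT (le_trans td1 d3) orbT.
Qed.

(* The inequality holds on average over [h]. *)
Lemma shift_exists s i : valid i s ->
  let S := count [in psums s] (Gf i) in
  exists2 h, h \in Gf i & (S * (size (Gf i) - S) <=
    size (Gf i) * (count [pred y | (y \in psums s) || ((y - h)%R \in psums s)] (Gf i) - S))%N.
Proof.
move=> vs S; set K := Gf i; have sK := Gsub i.
pose f h := count [pred y | (y \notin psums s) && ((y - h)%R \in psums s)] K.
have fE h : (count [pred y | (y \in psums s) || ((y - h)%R \in psums s)] K - S = f h)%N.
  apply/eqP; rewrite -(eqn_add2l S) subnKC; last by apply: sub_count => y /= ->.
  apply/eqP; rewrite /f -(count_predUI [in psums s]) [X in (_ + X)%N](_ : _ = 0%N).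
    by rewrite addn0; apply: eq_count => y /=; case: (y \in psums s).
  by apply/eqP; rewrite -leqn0 leqNgt -has_count; apply/hasPn => y _ /=; case: (y \in psums s).
(* Double count the pairs [(y, h)] with [y] not a sum and [y - h] a sum: for fixed [y] outside,
   [y - h] runs once through the whole layer. *)
have sumf : (\sum_(h <- K) f h = S * (size K - S))%N.
  have -> : (\sum_(h <- K) f h =
      \sum_(y <- K) \sum_(h <- K) ((y \notin psums s) && ((y - h)%R \in psums s)))%N.
    by rewrite exchange_big /=; apply: eq_bigr => h _; rewrite /f -sum1_count big_mkcond.
  have -> : (size K - S = \sum_(y <- K) (y \notin psums s))%N.
    rewrite -(count_predC [in psums s] K) -/S addKn -sum1_count big_mkcond /=.
    by apply: eq_bigr => y _; case: (y \in _).
  rewrite mulnC big_distrl /=; apply: eq_big_seq => y Ky.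
  case: (y \in psums s) => /=; first by rewrite mul0n big1_seq.
  rewrite mul1n; have -> : S = count (fun z => (z + y)%R \in psums s) K.
    by apply/esym/(count_shift [in psums s] sK Ky).
  rewrite -sum1_count [RHS]big_mkcond /=.
  suff KK : perm_eq [seq - h | h <- K] K.
    rewrite -[RHS](perm_big _ KK) big_map.
    by apply: eq_bigr => h _; rewrite addrC; case: (_ \in _).
  apply: uniq_perm; first by rewrite map_inj_uniq ?fsubgroup_uniq //; apply: oppr_inj.
    exact: fsubgroup_uniq.
  move=> z; apply/mapP/idP => [[h Kh ->]|Kz]; first by rewrite fsubgroupN.
  by exists (- z); rewrite ?opprK // fsubgroupN.
have [/hasP[h Kh fh]|/hasPn nf] := boolP (has (fun h => (S * (size K - S) <= size K * f h)%N) K).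
  by exists h => //; rewrite fE.
have K0 := size_fsubgroup_gt0 sK.
have : (\sum_(h <- K) (size K * f h) < \sum_(h <- K) (S * (size K - S)))%N.
  have [h0 Kh0] : exists h, h \in K by exists 0; apply: fsubgroup0.
  rewrite (big_rem h0) // [X in (_ < X)%N](big_rem h0) //= -addSn leq_add //.
    by rewrite ltnNge nf.
  rewrite !big_seq; apply: leq_sum => h /mem_rem /nf; rewrite -ltnNge; exact: ltnW.
rewrite -big_distrr /= sumf (@sum_count_const _ K xpredT _ (S * (size K - S))%N) //.
by rewrite count_predT mulnC ltnn.
Qed.

(** * Single moves with elements of large order *)

Section LargeOrders.
Hypothesis large : forall i N, exists x n, (N <= n)%N /\ order_mod x (Gf i) n.

Lemma large_order e i (N : nat) : 0 < e -> exists x n,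
  [/\ order_mod x (Gf i) n, (N <= n)%N & N%:R <= e * n%:R].
Proof.
move=> e0; pose N' := maxn N (Num.truncn (N%:R / e)).+1.
have [x [n [Nn ox]]] := large i N'; exists x, n; split=> //.
  exact: leq_trans (leq_maxl _ _) Nn.
rewrite -ler_pdivrMl // mulrC; apply: (le_trans (ltW (truncnS_gt _))).
by rewrite ler_nat (leq_trans (leq_maxr _ _) Nn).
Qed.

Lemma large_down_step e i s : 0 < e <= 1/2 -> valid i s -> exists k s',
  [/\ dpath e (dens i s * (1 - e)) (dens i s) i s k s' &
    dens k s' <= dens i s * (1 - e / 2)].
Proof.
move=> /andP[e0 e1] vs; have [x [n [ox Nn en]]] := large_order i 24 e0.
have n0 : 0 < n%:R :> R by rewrite ltr0n; lia.
(* The value 24 is enough room: [m], the integer part of [e n], is at least [e n / 2], and since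
   [e <= 1/2] at least 11 cosets stay covered. *)
have en0 : 0 <= e * n%:R by rewrite mulr_ge0 // ltW.
pose m := Num.truncn (e * n%:R).
have /andP[m1 m2] : m%:R <= e * n%:R < m.+1%:R by apply: truncn_itv.
rewrite -natr1 in m2.
have mn : (m + 11 <= n)%N by rewrite -(ler_nat R) natrD; nra.
have [k ik xk] := Gexh_ge i x.
have [||F [xF dF dk]] := down_block R Gsub Gmono vs ik xk ox (m := m) (T := (n - m).-1).
- lia.
- lia.
have d0 := dens_gt0 R Gsub i s; have d1 := dens_le1 R Gsub i s.
have r1 : m%:R / n%:R <= e by rewrite ler_pdivrMr.
have r2 : e / 2 <= m%:R / n%:R by rewrite ler_pdivlMr //; lra.
exists k, (F ++ s); split; last by rewrite dk ler_pM2l //; lra.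
apply: (dpath_block xF) => [j /dF/andP[a b]|]; last by nra.
by rewrite b andbT; apply: le_trans a; rewrite ler_pM2l //; lra.
Qed.

(** The two windows need [n - m] even, so the parity of [n] is put into [m]. *)
Lemma parity_split n m' (m := (m' * 2 + odd n)%N) (M := (n - m)./2) :
  (10 <= m)%N -> (m * 4 <= n)%N ->
  [/\ n = (M + M + m)%N, (10 <= m < M)%N, (n <= (M + m) * 2)%N & (0 < M + m)%N].
Proof.
move=> m10 mn; have mn' : (m <= n)%N by move: m10 mn; clear; lia.
have nE : n = (M + M + m)%N.
  have : odd (n - m) = false by rewrite oddB // oddD oddM andbF oddb addbb.
  have := odd_double_half (n - m); rewrite -/M -addnn => + o; rewrite o.
  by move: mn'; clear; lia.
by move: m10 mn nE; clearbody m M; clear; split; lia.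
Qed.

Lemma large_up_step e i s : 0 < e <= 1/2 -> valid i s -> exists k s',
  [/\ dpath e (dens i s) (dens i s * (1 + e)) i s k s' &
    dens i s + dens i s * (1 - dens i s) * (e / 8) <= dens k s'].
Proof.
move=> /andP[e0 e1] vs; have [x [n [ox Nn en]]] := large_order i 96 e0.
have n0 : 0 < n%:R :> R by rewrite ltr0n; lia.
have en0 : 0 <= e * n%:R / 8 by rewrite divr_ge0 // mulr_ge0 // ltW.
(* Thus [m] is about [e n / 4]: small enough for [m / (M + m) <= e], as [M + m >= n / 2], and still
   at least [e n / 8]. *)
pose m' := Num.truncn (e * n%:R / 8).
have /andP[m1 m2] : m'%:R <= e * n%:R / 8 < m'.+1%:R by apply: truncn_itv.
rewrite -[m'.+1%:R]natr1 in m2.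
pose m := (m' * 2 + odd n)%N; pose M := (n - m)./2.
have odd1 : (odd n)%:R <= 1 :> R by case: (odd n).
have odd0 : 0 <= (odd n)%:R :> R by [].
have mR : m%:R = m'%:R * 2 + (odd n)%:R :> R by rewrite natrD natrM.
have m10 : (10 <= m)%N by rewrite -(ler_nat R) mR; lra.
have mn : (m * 4 <= n)%N by rewrite -(ler_nat R) natrM mR; nra.
have [nE mM nM Mm0] := parity_split m10 mn; rewrite -/m -/M in nE mM nM Mm0.
have [h Hh hS] := shift_exists vs.
have [k ik xk] := Gexh_ge i x.
have [F [xF dF dk]] := up_block R Gsub Gmono vs ik xk ox nE mM Hh.
have d0 := dens_gt0 R Gsub i s; have d1 := dens_le1 R Gsub i s.
have r1 : m%:R / (M + m)%:R <= e.
  rewrite ler_pdivrMr ?ltr0n //.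
  have : n%:R <= (M + m)%:R * 2 :> R by rewrite -natrM ler_nat.
  by rewrite -(ler_pM2l e0); lra.
have r2 : e / 8 <= m%:R / n%:R by rewrite ler_pdivlMr //; lra.
exists k, (F ++ s); split.
  apply: (dpath_block xF) => [j /dF/andP[a b]|]; last by nra.
  by rewrite a /=; apply: (le_trans b); rewrite ler_pM2l //; lra.
rewrite dk lerD2l; apply: ler_pM => //; try nra.
have K0 : 0 < (size (Gf i))%:R :> R by rewrite ltr0n size_fsubgroup_gt0.
rewrite ler_pdivlMr // /dens; move: hS; set S := count _ _; set U := (_ - S)%N.
rewrite -(ler_nat R) !natrM natrB ?count_size // => hS.
have -> : S%:R / (size (Gf i))%:R * (1 - S%:R / (size (Gf i))%:R) * (size (Gf i))%:R =
  (S%:R * ((size (Gf i))%:R - S%:R)) / (size (Gf i))%:R :> R.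
  by field; rewrite gt_eqF.
by rewrite ler_pdivrMr // [leRHS]mulrC.
Qed.

End LargeOrders.

End Paths.

(** * One oscillation of the density, in axiomatic form *)

Section Strategy.
Variables (R : archiRealFieldType) (G : zmodType) (Gf : nat -> seq G).
Hypothesis Gsub : forall i, fsubgroup (Gf i).
Hypothesis Gmono : forall i j, (i <= j)%N -> {subset Gf i <= Gf j}.
Implicit Types (s F : seq G) (x y : G) (i j k : nat) (e b eta tau beta : R).
Local Notation dens := (dens R Gf).
Local Notation valid := (valid Gf).
Local Notation ext := (ext Gf).
Local Notation dpath := (dpath Gf).

(* [Good b eta i s]: from [(i, s)] the density can be raised up to almost [b]
   in steps of size at most [eta] (for the first lift). *)
Record strategy (Good : R -> R -> nat -> seq G -> Prop) : Prop := Strategy {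
  good_valid : forall b eta i s, Good b eta i s ->
    [/\ valid i s, dens i s <= b & b <= 1];
  good_init : exists i s, Good 1 1 i s;
  good_flat : forall b eta i s, Good b eta i s -> exists k F y,
    [/\ Good b eta k (F ++ s), ext i s k F,
        forall j, (i <= j <= k)%N -> dens j (F ++ s) = dens i s &
        [/\ y \in psums F, y + y \in psums F & y != 0]];
  good_base : forall b eta i s beta e0 e, Good b eta i s -> 0 < beta <= b ->
    0 < e <= 1/2 -> 0 <= e0 <= 1 -> b * (1 - e0) <= dens i s ->
    exists b' k s', [/\ Good b' (Num.max eta e) k s', (beta <= b' <= beta * (1 + e)) && (b' <= b) &
      dpath e (beta * (1 - e0) * (1 - e)) b i s k s'];
  good_down : forall b eta i s tau e, Good b eta i s -> 0 < tau -> 0 < e <= 1/2 ->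
    exists k s', [/\ Good b (Num.max eta e) k s',
      dpath e (Num.min (dens i s) (tau * (1 - e))) (dens i s) i s k s' &
      dens k s' <= tau];
  good_lift : forall b eta i s e, Good b eta i s -> 0 < e <= 1/2 ->
    exists k s', [/\ Good b e k s', dpath (Num.max eta e) (dens i s) b i s k s' &
      b * (1 - e) <= dens k s'] }.

Lemma dpath_psums e lo hi i s k s' : dpath e lo hi i s k s' -> (i <= k)%N /\
  exists2 F, s' = F ++ s & ext i s k F.
Proof. by case=> F [-> xF _ _]; have [ik _ _ _] := xF; split=> //; exists F. Qed.

(** A cycle consists of a flat move supplying [y], the adjustment of the ceiling to about beta, the
    descent to about alpha, and the lift back to the new ceiling. The tolerance [e0] is inherited
    from the previous cycle, which ended only within [e0] of its ceiling; the new cycle ends within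
    [e]. *)
Lemma strategy_cycle Good : strategy Good -> forall b eta i s alpha beta e0 e,
  Good b eta i s -> 0 <= alpha <= beta -> 0 < beta <= b -> 0 < e <= 1/2 ->
  e <= e0 <= 1 -> eta <= e0 -> b * (1 - e0) <= dens i s ->
  exists b' k F y j0, 
    [/\ Good b' e k (F ++ s), beta <= b' <= beta * (1 + e), b' * (1 - e) <= dens k (F ++ s) &
    [/\ ext i s k F, (i < k)%N,
       forall j, (i <= j <= k)%N -> alpha * (1 - e0) * (1 - e) <= dens j (F ++ s) <= b,
       forall j, (i <= j < k)%N -> `|dens j.+1 (F ++ s) - dens j (F ++ s)| <= e0 &
    [/\ (i <= j0 <= k)%N, dens j0 (F ++ s) <= alpha + e,
       y \in psums F, y + y \in psums F & y != 0]]].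
Proof.
move=> SG b eta i s alpha beta e0 e Gs /andP[a0 ab] /andP[be0 beb].
move=> /andP[ep e2] /andP[ee0 e01] etae0 bd.
have [vs ds b1] := good_valid SG Gs.
have [k1 [F1 [y [G1 x1 d1 [y1 y2 y0]]]]] := good_flat SG Gs.
have [ik1 uF1 FG1 F10] := x1.
(* A nonzero sum of new elements cannot lie in [Gf i], so the flat move really advances. *)
have {}ik1 : (i < k1)%N.
  rewrite ltn_neqAle ik1 andbT; apply/eqP => ek; move/eqP: y0; apply.
  apply: F10 => //; rewrite ek; apply: psums_fsubgroup y1 => // z Fz.
  by rewrite FG1 // mem_cat Fz.
have [v1 _ _] := good_valid SG G1.
have bd1 : b * (1 - e0) <= dens k1 (F1 ++ s) by rewrite d1 // leqnn ltnW.
have H1 : 0 < beta <= b by rewrite be0.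
have H2 : 0 < e <= 1/2 by rewrite ep.
have H3 : 0 <= e0 <= 1 by rewrite e01 andbT; lra.
have [b' [k2 [s2 [G2 /andP[b'b b'b2] p2]]]] := good_base SG G1 H1 H2 H3 bd1.
have [v2 ds2 b'1] := good_valid SG G2.
(* The target is not alpha itself, which may be 0 while every density is positive. *)
have ae : 0 < alpha + e by lra.
have [k3 [s3 [G3 p3 d3]]] := good_down SG G2 ae H2.
have [v3 ds3 _] := good_valid SG G3.
have [k [s4 [G4 p4 d4]]] := good_lift SG G3 H2.
set lo := alpha * (1 - e0) * (1 - e).
have lo1 : lo <= beta * (1 - e0) * (1 - e).
  by do 2![apply: ler_wpM2r; first lra].
have lo2 : lo <= (alpha + e) * (1 - e).
  apply: ler_wpM2r; first lra.
  have : 0 <= alpha * e0 by rewrite mulr_ge0 //; lra.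
  by rewrite mulrBr mulr1; lra.
have lo0 : lo <= dens i s.
  apply: le_trans lo1 (le_trans _ bd).
  have : 0 <= beta * (1 - e0) * e by rewrite !mulr_ge0 //; lra.
  have : beta * (1 - e0) <= b * (1 - e0) by apply: ler_wpM2r => //; lra.
  by rewrite [_ * (1 - e)]mulrBr mulr1; lra.
have ee : Num.max (Num.max (Num.max eta e) e) e <= e0 by rewrite !ge_max etae0 ee0.
have p1 : dpath e0 lo b i s k1 (F1 ++ s).
  apply: dpath_weaken (_ : dpath 0 (dens i s) (dens i s) _ _ _ _) _ _ _ => //; last 1 first.
  - by lra.
  apply: (dpath_block x1); last by rewrite subrr.
  by move=> j /d1 ->; rewrite lexx.
have {}p2 : dpath e0 lo b k1 (F1 ++ s) k2 s2 by apply: dpath_weaken p2 _ _ _.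
have [_ /andP[d2 _]] := dpath_bounds Gsub Gmono v1 p2.
have {}p3 : dpath e0 lo b k2 s2 k3 s3.
  by apply: dpath_weaken p3 _ _ _; rewrite ?le_min ?d2 //; lra.
have [_ /andP[d3' _]] := dpath_bounds Gsub Gmono v2 p3.
have {}p4 : dpath e0 lo b k3 s3 k s4 by apply: dpath_weaken p4 _ _ _ => //; lra.
have p13 := dpath_trans Gsub Gmono vs p1 (dpath_trans Gsub Gmono v1 p2 p3).
have [k13 [F' s3E x13]] := dpath_psums p13.
have [k34 [F'' s4E x34]] := dpath_psums p4.
have [k13' [F23 s3E' x23]] := dpath_psums (dpath_trans Gsub Gmono v1 p2 p3).
have [F [s4E' xF dF mF]] := dpath_trans Gsub Gmono vs p13 p4.
have FE : F = F'' ++ F23 ++ F1.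
  have e' : F ++ s = (F'' ++ F23 ++ F1) ++ s by rewrite -s4E' s4E s3E' !catA.
  have sz : size F = size (F'' ++ F23 ++ F1).
    by move/(congr1 size): e'; rewrite size_cat [RHS]size_cat => /addIn.
  by move/eqP: e'; rewrite eqseq_cat // => /andP[/eqP].
have F1F : {subset psums F1 <= psums F}.
  move=> z z1; rewrite FE catA; apply/psums_catP; exists 0, z.
  by rewrite psums0 add0r.
exists b', k, F, y, k3; split=> //; rewrite -?s4E' //; split=> //.
  exact: leq_trans (leq_trans ik1 k13') k34.
split; rewrite ?F1F //; first by rewrite k34 k13.
by rewrite s4E (ext_dens _ Gsub Gmono v3.2 x34 (leqnn k3)).
Qed.

End Strategy.

Section FlatBlock.
Variables (R : archiRealFieldType) (G : zmodType) (Gf : nat -> seq G).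
Hypothesis Gsub : forall i, fsubgroup (Gf i).
Hypothesis Gmono : forall i j, (i <= j)%N -> {subset Gf i <= Gf j}.
Local Notation dens := (dens R Gf).
Local Notation valid := (valid Gf).
Local Notation ext := (ext Gf).

(** A full digit system gives every visible coset the same number of sums: the fibre count with an
    empty exceptional range. *)
Lemma flat_block i k s x n (cs : seq int) (r : nat) : valid i s -> (i <= k)%N ->
  x \in Gf k -> order_mod x (Gf i) n -> (r < n)%N -> uniq cs -> 0 \notin cs ->
  (forall c, (c \in psums cs) = (- r%:Z <= c < n%:Z - r%:Z)) ->
  let D := [seq x *~ c | c <- cs] in
  exists E, [/\ ext i s k (E ++ D), dsum (Gf k) (adjoin (Gf i) x n) (psums E) &
    forall j, (i <= j <= k)%N -> dens j ((E ++ D) ++ s) = dens i s].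
Proof.
move=> vs ik xk ox rn ucs cs0 csP D.
have n0 : (0 < n)%N by lia.
have [us sG] := vs; have sK := Gsub i.
have csI c : c \in cs -> - r%:Z <= c < - r%:Z + n%:Z.
  by move=> /mem_psums; rewrite csP; lia.
have csn c : c \in cs -> 0 < `|c| < n%:Z.
  move=> ccs; have := csI _ ccs; have : c != 0 by apply: contraNneq cs0 => <-.
  lia.
have [||||E [Eext dE EP]] := adjoin_block R Gsub Gmono (D := D) vs ik xk n0 ox.
- exact: window_uniq sK ox ucs csI.
- by move=> _ /mapP[c _ ->]; apply: mem_adjoin.
- by move=> _ /mapP[c /(window_notin sK ox csn) + ->].
- move=> y; rewrite psums_mulrz => /mapP[c + ->].
  by rewrite csP ox => cI /dvdz_small ->; [rewrite mulr0z | lia].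
pose S := count [in psums s] (Gf i).
have fib c : c \in itv (- r%:Z) n ->
    count (fun h => h + x *~ c \in psums (D ++ s)) (Gf i) =
    if 0 < c <= 0%N%:Z then 0%N else S.
  rewrite mem_itv => cI.
  have E0 h : h \in Gf i -> (h + x *~ c \in psums (D ++ s)) =
      (- r%:Z <= c < n%:Z - r%:Z) && (h \in psums s).
    by move=> Hh; apply: (mem_psums_window Gsub sG ox csP) => //; lia.
  rewrite (eq_in_count E0) (_ : (_ < _ <= _) = false); last lia.
  by rewrite (_ : _ && _ = true) //; lia.
have nE : n = (r.+1 + (0 + (n - r.+1)))%N by lia.
exists E; split=> // j /[dup] ijk /andP[ij jk].
have [t [u [t0 ut cX sX _]]] := count_fibres Gsub Gmono n0 ox ij nE fib.
have u0 : u = 0%N by lia.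
rewrite EP // cX sX u0 muln0 !addn0 !natrM -mulf_div divff ?mulr1 //.
by rewrite pnatr_eq0 -lt0n.
Qed.

End FlatBlock.

(** * The strategy for large orders *)

Section LargeStrategy.
Variables (R : archiRealFieldType) (G : zmodType) (Gf : nat -> seq G).
Hypothesis Gsub : forall i, fsubgroup (Gf i).
Hypothesis Gmono : forall i j, (i <= j)%N -> {subset Gf i <= Gf j}.
Hypothesis Gexh : forall x, exists i, x \in Gf i.
Hypothesis large : forall i N, exists x n, (N <= n)%N /\ order_mod x (Gf i) n.
Local Notation dens := (dens R Gf).
Local Notation valid := (valid Gf).
Local Notation dpath := (dpath Gf).

Definition large_good (b eta : R) i s := [/\ valid i s, dens i s <= b & b <= 1].

Lemma large_down e tau i s : 0 < e <= 1/2 -> 0 < tau -> valid i s -> exists k s',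
    [/\ dpath e (Num.min (dens i s) (tau * (1 - e))) (dens i s) i s k s',
      dens k s' <= tau & valid k s'].
Proof.
move=> e2 tau0; apply: (dpath_down Gsub Gmono (c := e / 2)) => // [| |j t vt].
- by case/andP: e2 => e0 e2; rewrite ltW //=; lra.
- by case/andP: e2 => e0 _; lra.
have [k [t' [p d]]] := large_down_step Gsub Gmono Gexh large e2 vt.
by exists k, t'; split=> //; apply: dpath_valid p.
Qed.

(** Below [b * (1 - e)] one has [1 - dens >= b * e], so each step gains at least the fixed amount
    [c]. It does not overshoot, because [(1 - e) * (1 + e) <= 1]. *)
Lemma large_lift e b i s : 0 < e <= 1/2 -> valid i s -> dens i s <= b <= 1 ->
  exists k s', [/\ dpath e (dens i s) b i s k s', b * (1 - e) <= dens k s',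
    dens k s' <= b & valid k s'].
Proof.
move=> /[dup] e2 /andP[ep eh] vs /andP[db b1].
have d0 := dens_gt0 R Gsub i s; have b0 : 0 < b by apply: lt_le_trans db.
pose c := dens i s * (b * e) * (e / 8).
have e8 : 0 < e / 8 by rewrite divr_gt0.
have be' : 0 < b * e by rewrite mulr_gt0.
have c0 : 0 < c by rewrite mulr_gt0 // mulr_gt0.
have [r] : exists r : nat, b * (1 - e) <= dens i s + r%:R * c.
  exists (Num.truncn ((b * (1 - e) - dens i s) / c)).+1.
  by rewrite -lerBlDl -ler_pdivrMr // ltW ?truncnS_gt.
have cd t j : dens i s <= dens j t -> c <= dens j t * (b * e) * (e / 8).
  by move=> dd; rewrite /c; apply: (ler_wpM2r (ltW e8)); apply: (ler_wpM2r (ltW be')).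
clearbody c; have := lexx (dens i s).
(* The initial density is frozen as [d1], so that the gain [c] stays the same along the
   induction. *)
move: cd; move: {1 2}(dens i s) => d1 cd.
elim: r i s vs db {d0} => [|r IH] i s vs db d1d br.
  exists i, s; split=> //; last by move: br; rewrite mul0r addr0.
  by apply: dpath_refl => //; rewrite lexx.
have [bd|db'] := leP (b * (1 - e)) (dens i s).
  by exists i, s; split=> //; apply: dpath_refl => //; rewrite lexx.
have [k [s' [p d']]] := large_up_step Gsub Gmono Gexh large e2 vs.
have vs' := dpath_valid p.
have [/andP[_ _] /andP[d'1 d'2]] := dpath_bounds Gsub Gmono vs p.
have d0 := dens_gt0 R Gsub i s.
have hb : dens i s * (1 + e) <= b.
  have : dens i s * (1 + e) <= b * (1 - e) * (1 + e) by rewrite ler_wpM2r ?ltW //; lra.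
  have : 0 <= b * e * e by rewrite !mulr_ge0 // ltW.
  by rewrite !(mulrBr, mulrDr, mulrBl, mulrDl, mulr1, mul1r); lra.
have c1 : c <= dens i s * (1 - dens i s) * (e / 8).
  apply: (le_trans (cd _ _ d1d)); apply: (ler_wpM2r (ltW e8)).
  apply: (ler_wpM2l (ltW d0)); move: db' b1; rewrite mulrBr mulr1; lra.
have [|||l [s'' [p2 d2 d3 v2]]] := IH k s' vs'.
- exact: le_trans d'2 hb.
- exact: le_trans d1d d'1.
- by move: br; rewrite -natr1 mulrDl mul1r; lra.
exists l, s''; split=> //; apply: (dpath_trans Gsub Gmono vs).
  exact: dpath_weaken p _ _ _.
exact: dpath_weaken p2 _ _ _.
Qed.

Lemma large_strategy : strategy Gf large_good.
Proof.
have vd i s : valid i s -> dens i s <= 1 by move=> _; apply: dens_le1.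
split.
- by move=> b eta i s [].
- by exists 0%N, [::]; split=> //; apply: dens_le1.
- move=> b eta i s [vs db b1].
  have [x [n [n11 ox]]] := large i 11.
  have [k ik xk] := Gexh_ge Gmono Gexh i x.
  (* The sums are 0 to [n - 1], without wrapping, so both [x] and 2x are among them. *)
  have [|ds [uds gds dsT]] := @complete_exists n.-1; first lia.
  have dsP := psums_greedy gds; rewrite dsT in dsP.
  have csP c : (c \in psums (map Posz ds)) = (- 0%N%:Z <= c < n%:Z - 0%N%:Z).
    by rewrite dsP; lia.
  have [|||E [xE dE EP]] := flat_block R Gsub Gmono vs ik xk ox _ _ _ csP; first lia.
  + by rewrite map_inj_uniq // => a c [].
  + by apply/mapP => -[a /(greedy_gt0 gds)]; case: a.
  have xD c : 0 <= c < n%:Z -> x *~ c \in psums (E ++ [seq x *~ c | c <- map Posz ds]).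
    move=> cn; apply/psums_catP; exists 0, (x *~ c).
    by rewrite psums0 add0r psums_mulrz map_f // csP; lia.
  exists k, (E ++ [seq x *~ c | c <- map Posz ds]), (x *~ 1); split=> //.
    have [_ uF FG _] := xE; split=> //.
    by rewrite EP // ik leqnn.
  split.
  + by apply: xD; lia.
  + by rewrite -mulrzDr; apply: xD; lia.
  + apply: contraTneq (fsubgroup0 (Gsub i)) => x0.
    by rewrite -x0 ox dvdzE; apply/negP => /dvdn_leq; lia.
- move=> b eta i s beta e0 e [vs db b1] /andP[be0 beb] e2 /andP[e00 e01] bd.
  have [k [s' [p d vs']]] := large_down e2 be0 vs.
  have ep : 0 < e by case/andP: e2.
  exists beta, k, s'; split; first by split=> //; apply: le_trans b1.
    by rewrite lexx beb andbT /=; apply: ler_peMr; [exact: ltW | lra].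
  apply: (dpath_weaken p) => //.
  have eh : e <= 1/2 by case/andP: e2.
  rewrite le_min; apply/andP; split; last first.
    apply: ler_wpM2r; first lra.
    by apply: ler_piMr; [exact: ltW | lra].
  apply: le_trans bd; rewrite -mulrA; apply: ler_pM => //; first exact: ltW.
    by apply: mulr_ge0; lra.
  by apply: ler_piMr; lra.
- move=> b eta i s tau e [vs db b1] tau0 e2.
  have [k [s' [p d vs']]] := large_down e2 tau0 vs.
  exists k, s'; split=> //; split=> //.
  by have [_ /andP[_ h]] := dpath_bounds Gsub Gmono vs p; apply: le_trans db.
- move=> b eta i s e [vs db b1] e2.
  have [|k [s' [p d d' vs']]] := large_lift e2 vs (b := b); first by rewrite db.
  exists k, s'; split=> //.
  by apply: (dpath_weaken p) => //; rewrite le_max lexx orbT.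
Qed.

End LargeStrategy.

(** * Gadgets *)

Section Bumps.
Variable G : zmodType.
Implicit Types (D L U : seq G) (x y z : G) (q : nat).

Definition has_order z q := forall c : int, (z *~ c == 0) = (q %| c)%Z.

(* Adding the elements of [D] to a set [U \ {p}] with [U <= L] fills the cosets
   [x *~ c + U] for [0 < c < q] completely, and leaves [U \ {p}] unchanged. *)
Definition is_bump L x z q D :=
  [/\ uniq D, x \in D, - x \notin D, 0 \notin D &
  [/\ forall y, y \in psums D -> y \in L -> y = 0,
      forall d, d \in D -> exists c m : int, d = x *~ c + z *~ m &
      forall c : nat, (0 < c < q)%N -> exists a b : int,
        [/\ z *~ a != z *~ b, x *~ c%:Z + z *~ a \in psums D &
            x *~ c%:Z + z *~ b \in psums D]]].

(** Take all [x + m z] with [0 <= m < p]. A subset sum lies in [L] only if 0 or all [p] elements are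
    used, and the full sum is [p x + 'C(p, 2) z = 0] because [p] is odd. For [0 < c < p], exchanging
    one element of a [c]-subset changes the sum by [z]. *)
Lemma bump_prime p L x z : prime p -> odd p -> fsubgroup L -> z \in L ->
  x *+ p = 0 -> z *+ p = 0 -> order_mod x L p -> has_order z p ->
  exists D, is_bump L x z p D.
Proof.
move=> pp op sL Lz xp zp ox oz; have p1 := prime_gt1 pp.
have p2 : (2 < p)%N by move: op p1; case: (p) => [|[|[]]].
pose f (m : nat) := x + z *+ m; pose D := map f (iota 0 p).
have sumf t : \sum_(m <- t) f m = x *+ size t + z *+ (\sum_(m <- t) m)%N.
  elim: t => [|a t IH]; first by rewrite !big_nil !mulr0n addr0.
  by rewrite !big_cons IH /f mulrS mulrnDr addrACA.
have memD t : subseq t (iota 0 p) ->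
    x *+ size t + z *+ (\sum_(m <- t) m)%N \in psums D.
  by move=> st; apply/psumsP; exists (map f t); rewrite ?map_subseq // big_map sumf.
have notL c : ~~ (p %| c)%N -> x *+ c \notin L.
  by move=> pc; rewrite pmulrn ox dvdzE.
have Lm m : z *+ m \in L by apply: fsubgroupMn.
exists D; split.
- rewrite map_inj_in_uniq ?iota_uniq // => a b; rewrite !mem_iota /= => ap bp.
  move/addrI => e; have : z *~ (a%:Z - b%:Z) == 0.
    by rewrite mulrzBr -!pmulrn e subrr.
  by rewrite oz => /dvdz_small; lia.
- by apply/mapP; exists 0%N; rewrite ?mem_iota /f ?addr0 //; lia.
- apply/mapP => -[m _ e]; have : x *+ 2 \notin L by apply: notL; rewrite gtnNdvd.
  by rewrite -(fsubgroupDr _ sL (Lm m)) mulr2n -addrA -/(f m) -e subrr fsubgroup0.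
- apply/mapP => -[m _ e]; have : x *+ 1 \notin L by apply: notL; rewrite gtnNdvd // (ltn_trans _ p2).
  by rewrite -(fsubgroupDr _ sL (Lm m)) mulr1n -/(f m) -e fsubgroup0.
split.
- move=> y /psumsP[t /subseqP[m sm ->] ->]; rewrite -map_mask big_map sumf.
  set t' := mask m _; rewrite fsubgroupDr // => Lt.
  have st : subseq t' (iota 0 p) by apply: mask_subseq.
  have [szt szE] := size_subseq_leqif st; rewrite size_iota in szt szE.
  have pt : (p %| size t')%N by apply: contraTT Lt; apply: notL.
  have [t0|t0] := posnP (size t').
    by move/size0nil: t0 => ->; rewrite big_nil mulr0n addr0.
  have /eqP tp : size t' == p by rewrite eqn_leq szt dvdn_leq.
  have /eqP -> : t' == iota 0 p by rewrite -szE tp.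
  rewrite size_iota xp add0r.
  have -> : (\sum_(m <- iota 0 p) m)%N = 'C(p, 2).
    by rewrite -bin2_sum /index_iota subn0.
  have /dvdnP[k ->] : (p %| 'C(p, 2))%N by rewrite prime_dvd_bin.
  by rewrite mulnC mulrnA zp mul0rn.
- move=> _ /mapP[m _ ->]; exists 1, m%:Z.
  by rewrite mulr1z -pmulrn.
- case=> // c /andP[_ cp].
  have iE : iota 0 p = iota 0 c ++ [:: c; c.+1] ++ iota c.+2 (p - c.+2).
    have pE : p = (c + (2 + (p - c.+2)))%N by lia.
    by rewrite {1}pE !iotaD add0n addn2.
  have sub1 a : a \in [:: c; c.+1] -> subseq (iota 0 c ++ [:: a]) (iota 0 p).
    move=> ac; rewrite iE; apply: cat_subseq => //.
    by apply: subseq_trans (prefix_subseq _ _); rewrite sub1seq.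
  pose u := (\sum_(m <- iota 0 c) m)%N.
  have mem1 a : a \in [:: c; c.+1] -> x *~ c.+1%:Z + z *~ (u + a)%N%:Z \in psums D.
    move=> /sub1/memD; rewrite size_cat size_iota addn1 big_cat big_seq1 /= -/u.
    by rewrite -!pmulrn.
  exists (u + c)%N%:Z, (u + c.+1)%N%:Z; split; rewrite ?mem1 ?inE ?eqxx ?orbT //.
  rewrite -!pmulrn addnS mulrSr eq_sym -subr_eq0 addrAC subrr add0r.
  by rewrite -[z]mulr1z oz dvdzE; apply/negP => /dvdn_leq; lia.
Qed.

(** The sums of [x], [x + z], [2x - z] are 0; [x], [x + z]; [2x - z], [2x + z]; [3x - z], [3x]; and
    [4x = 0]: two in each nontrivial coset and only 0 in [L]. *)
Lemma bump_four L x z : fsubgroup L -> z \in L ->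
  x *+ 4 = 0 -> z *+ 4 = 0 -> order_mod x L 4 -> has_order z 4 ->
  exists D, is_bump L x z 4 D.
Proof.
move=> sL Lz x4 z4 ox oz; pose D := [:: x; x + z; x *+ 2 - z].
have Lm m : z *~ m \in L by apply: fsubgroupMz.
pose g (cm : int * int) := x *~ cm.1 + z *~ cm.2.
have DE : D = map g [:: (1, 0); (1, 1); (2, -1)].
  by rewrite /D /g /= !mulr1z mulr0z addr0 mulrN1z -pmulrn.
have PE : psums D = map g (psums [:: (1, 0); (1, 1); (2, -1) : int * int]).
  have gD : {morph g : u v / u + v}.
    by move=> [a b] [c d]; rewrite /g /= !mulrzDr addrACA.
  have g0 : g 0 = 0 by rewrite /g /= !mulr0z addr0.
  rewrite DE; elim: [:: _; _; _] => [|a l IH] /=; first by rewrite g0.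
  by rewrite IH map_cat -!map_comp; congr (_ ++ _); apply: eq_map => v /=; rewrite gD.
have gL cm : (g cm \in L) = (4 %| cm.1)%Z by rewrite /g fsubgroupDr // ox.
have zz a b : (z *~ a == z *~ b) = (4 %| a - b)%Z by rewrite -oz mulrzBr subr_eq0.
have g_inj a b a' b' : g (a, b) = g (a', b') -> (4 %| a - a')%Z /\ (a = a' -> (4 %| b - b')%Z).
  move=> e; split.
    rewrite -ox -(fsubgroupDr _ sL (Lm (b - b'))) !mulrzBr addrACA -opprD -/(g (a, b)).
    by rewrite e subrr fsubgroup0.
  by move=> aa; move: e; rewrite /g /= aa => /addrI/eqP; rewrite zz.
exists D; split.
- rewrite DE map_inj_in_uniq // => -[a b] [a' b']; rewrite !inE => h h' /g_inj[].
  by move: h h' => /or3P[]/eqP[-> ->] /or3P[]/eqP[-> ->] // h1 h2; move: h1 (h2 erefl).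
- by rewrite mem_head.
- have -> : - x = g (-1, 0) by rewrite /g /= mulr0z addr0 mulrN1z.
  rewrite DE; apply/mapP => -[[a b] ab /g_inj[]].
  by move: ab; rewrite !inE => /or3P[]/eqP[-> ->].
- have -> : 0 = g (0, 0) by rewrite /g /= !mulr0z addr0.
  rewrite DE; apply/mapP => -[[a b] ab /g_inj[]].
  by move: ab; rewrite !inE => /or3P[]/eqP[-> ->].
split.
- move=> y; rewrite PE => /mapP[cm cmP ->]; rewrite gL.
  have g4 : g (4, 0) = 0 by rewrite /g /= mulr0z addr0 -pmulrn.
  have g0 : g (0, 0) = 0 by rewrite /g /= !mulr0z addr0.
  by move: cmP; rewrite /= !inE => /or4P[|||/or4P[|||/orP[]]] /eqP ->.
- by move=> d; rewrite DE => /mapP[[c m] _ ->]; exists c, m.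
- have P a b : (a, b) \in psums [:: (1, 0); (1, 1); (2, -1) : int * int] ->
      x *~ a + z *~ b \in psums D by move=> ab; rewrite PE -/(g (a, b)) map_f.
  case=> [|[|[|[|c]]]] // _.
  + by exists 0, 1; split; rewrite ?P // zz.
  + by exists 1, (-1); split; rewrite ?P // zz.
  + by exists (-1), 0; split; rewrite ?P // zz.
Qed.

End Bumps.

Section Gadgets.
Variables (G : zmodType) (Gf : nat -> seq G).
Hypothesis Gsub : forall i, fsubgroup (Gf i).
Hypothesis Gmono : forall i j, (i <= j)%N -> {subset Gf i <= Gf j}.
Hypothesis Gexh : forall x, exists i, x \in Gf i.
Implicit Types (D L U : seq G) (x y z : G).

Definition bump_system q := forall L x z, fsubgroup L -> z \in L ->
  x *+ q = 0 -> z *+ q = 0 -> order_mod x L q -> has_order z q ->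
  exists D, is_bump L x z q D.

Lemma order_mod_sub L U x q : fsubgroup U -> {subset U <= L} -> x *+ q = 0 ->
  order_mod x L q -> order_mod x U q.
Proof.
move=> sU UL xq ox c; apply/idP/idP => [/UL|]; first by rewrite ox.
by case/dvdzP => k ->; rewrite mulrC mulrzA -pmulrn xq mul0rz fsubgroup0.
Qed.

Lemma bump_sub L x z q D U : fsubgroup U -> z \in U -> (0 < q)%N ->
  order_mod x U q -> is_bump L x z q D -> {subset D <= adjoin U x q}.
Proof.
move=> sU Uz q0 ox [_ _ _ _ [_ DP _]] d /DP[c [m ->]].
by apply/(adjoinP _ sU q0 ox); exists (z *~ m), c; rewrite fsubgroupMz // addrC.
Qed.

(** In a nontrivial coset two different translates of [U] minus a point are available, and their
    union is everything. In [U] itself only the sum 0 acts, so [p] stays missing. *)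
Lemma bump_fill L x z q D U p : fsubgroup U -> {subset U <= L} ->
  p \in U -> z \in U -> (0 < q)%N -> order_mod x U q -> is_bump L x z q D ->
  forall v, (exists y u, [/\ y \in psums D, u \in U, u != p & v = y + u]) <->
    v \in adjoin U x q /\ v != p.
Proof.
move=> sU UL Up Uz q0 ox bD v.
have sV := adjoin_fsubgroup sU q0 ox; have UV := adjoin_sub sU q0 ox.
have DV := bump_sub sU Uz q0 ox bD; have [_ _ _ _ [D0 _ DP]] := bD; split.
  case=> y [u [Dy Uu up ->]]; split.
    by apply: fsubgroupD (UV _ Uu) => //; apply: psums_fsubgroup Dy.
  apply: contraNneq up => e; have Ly : y \in L.
    by apply: UL; rewrite -(fsubgroupDr _ sU Uu) e.
  by rewrite -e (D0 y) // add0r.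
case=> [/(dsum_adjoin 0 sU q0 ox).1[h [_ [Uh /mapP[c + ->] ->]]] vp].
rewrite mem_itv add0r; case: c vp => // -[|c] vp cq.
  exists 0, h; rewrite psums0 Uh mulr0z addr0 add0r; split=> //.
  by move: vp; rewrite mulr0z addr0.
have [|a [b [ab Da Db]]] := DP c.+1; first by lia.
have Um m : h - z *~ m \in U by rewrite fsubgroupB // fsubgroupMz.
have vE m : h + x *~ c.+1%:Z = x *~ c.+1%:Z + z *~ m + (h - z *~ m).
  by rewrite -addrA subrKC addrC.
have [ap|ap] := eqVneq (h - z *~ a) p.
  exists (x *~ c.+1%:Z + z *~ b), (h - z *~ b); split=> //.
  by apply: contraNneq ab => bp; rewrite -(inj_eq oppr_inj) -(inj_eq (addrI h)) ap bp.
by exists (x *~ c.+1%:Z + z *~ a), (h - z *~ a).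
Qed.

Lemma size_adjoin U x q : fsubgroup U -> (0 < q)%N -> order_mod x U q ->
  size (adjoin U x q) = (q * size U)%N.
Proof.
move=> sU q0 ox; rewrite (perm_size (adjoin_perm 0 sU q0 ox)) size_allpairs.
by rewrite size_itv.
Qed.

Lemma layer_bound (l : seq G) i : exists2 k, (i <= k)%N & {subset l <= Gf k}.
Proof.
elim: l => [|a l [k ik lk]]; first by exists i.
have [m am] := Gexh a; exists (maxn m k); first by rewrite leq_max ik orbT.
move=> c; rewrite inE => /predU1P[->|/lk ck]; first exact: Gmono (leq_maxl _ _) _ am.
exact: Gmono (leq_maxr _ _) _ ck.
Qed.

Variable q : nat.
Hypothesis q2 : (2 < q)%N.
Hypothesis bumps : bump_system q.
Hypothesis indep : forall i, exists x, x *+ q = 0 /\ order_mod x (Gf i) q.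

(** The pair is a finite subgroup with its missing point; the element [z] of order [q] is kept
    because every later bump needs one. *)
Definition gadget (g : seq G * G) := [/\ fsubgroup g.1, g.2 \in g.1 &
  exists z, [/\ z \in g.1, z *+ q = 0 & has_order z q]].

(** Start from a cyclic group of order [q] with one point missing and enlarge it by bumps, each
    multiplying the order by [q] and keeping the single hole. *)
Lemma gadget_core i k : exists g D, [/\ gadget g, size g.1 = (q ^ k.+1)%N,
  g.2 != 0, forall u, u \in g.1 -> u \in Gf i -> u = 0 &
  [/\ uniq D, {subset D <= g.1}, 0 \notin D & psums D =i [predD1 g.1 & g.2]]].
Proof.
have q0 : (0 < q)%N by lia.
elim: k => [|k [[U p] [D [gU sU p0 Ui [uD DU D0 DP]]]]].
  have [x [xq ox]] := indep i.
  have s0 : fsubgroup [:: 0 : G].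
    by split; rewrite ?mem_head // => a b; rewrite !inE => /eqP -> /eqP ->; rewrite subr0.
  have ox0 : order_mod x [:: 0] q.
    by apply: order_mod_sub xq ox => // a; rewrite inE => /eqP ->; apply: fsubgroup0.
  (* Digits for [q - 1] instead of [q]: exactly one multiple of [x], of index [q - 1 - r], is not
     reached. *)
  have [|cs [r [ucs csn csP]]] := @digits_exist q.-1; first lia.
  have r0 : (r < q.-1)%N by have := psums0 cs; rewrite csP; lia.
  have sV := adjoin_fsubgroup s0 q0 ox0; set V := adjoin _ _ _ in sV.
  have VP := dsum_adjoin (- r%:Z) s0 q0 ox0.
  have Vx c : x *~ c \in V by apply: mem_adjoin.
  exists (V, x *~ (q%:Z - 1 - r%:Z)), [seq x *~ c | c <- cs]; split=> /=.
  - split=> //=; exists x; rewrite -[x]mulr1z Vx mulr1z; split=> // c.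
    by rewrite -ox0 inE.
  - by rewrite size_adjoin //= muln1 expn1.
  - have := ox0 (q%:Z - 1 - r%:Z); rewrite inE => ->.
    by apply/negP => /dvdz_small; lia.
  - move=> u /(adjoinP _ s0 q0 ox0)[h [c []]]; rewrite inE => /eqP -> ->.
    by rewrite add0r ox -ox0 inE => /eqP.
  split.
  - apply: (window_uniq (a := - r%:Z) s0 ox0 ucs) => c /mem_psums; rewrite csP; lia.
  - by move=> _ /mapP[c _ ->].
  - apply/mapP => -[c /csn cn e]; have := ox0 c; rewrite -e mem_head => /esym/dvdz_small.
    lia.
  - have key c d : - r%:Z <= c < q%:Z - r%:Z -> - r%:Z <= d < q%:Z - r%:Z ->
        x *~ c = x *~ d -> c = d.
      move=> cI dI e; have cd : `|c - d| < q%:Z by lia.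
      have e' : 0 + x *~ c = 0 + x *~ d by rewrite e.
      by have [] := order_mod_inj s0 ox0 (mem_head _ _) (mem_head _ _) cd e'.
    move=> u; rewrite !inE psums_mulrz; apply/mapP/andP.
      case=> c; rewrite csP => cI ->; split=> //.
      by apply/eqP => /key; lia.
    case=> up /VP.1[h [t [+ + e]]]; rewrite inE => /eqP h0 /mapP[c + tc].
    rewrite h0 tc in e *; rewrite mem_itv => cI; exists c; last by rewrite e add0r.
    rewrite csP; have : c != q%:Z - 1 - r%:Z.
      by apply: contraNneq up => <-; rewrite e add0r.
    by lia.
rewrite /= in sU p0 Ui DU DP *.
have [sU' Up [z [Uz zq oz]]] := gU; rewrite /= in sU' Up Uz.
have [k' ik' Uk'] := layer_bound U i.
have [x [xq ox]] := indep k'.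
have oxU := order_mod_sub sU' Uk' xq ox.
have [B bB] := bumps (Gsub k') (Uk' _ Uz) xq zq ox oz.
have sV := adjoin_fsubgroup sU' q0 oxU; have UV := adjoin_sub sU' q0 oxU.
have BV := bump_sub sU' Uz q0 oxU bB.
have [uB xB xB' B0 [BL _ _]] := bB.
exists (adjoin U x q, p), (B ++ D); split=> /=.
- by split=> /=; [|exact: UV|exists z; rewrite UV].
- by rewrite size_adjoin // sU -expnS.
- by [].
- move=> _ /(adjoinP _ sU' q0 oxU)[h [c [Uh ->]]] Ghc.
  have : x *~ c \in Gf k' by rewrite -(fsubgroupDl _ (Gsub k') (Uk' _ Uh)) (Gmono ik').
  rewrite ox -oxU => Uxc; apply: Ui => //; exact: fsubgroupD.
split.
- rewrite cat_uniq uB uD andbT /=; apply/hasPn => d Dd; apply: contra B0 => Bd.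
  by rewrite -(BL d) ?mem_psums //; apply/Uk'/DU.
- by move=> d; rewrite mem_cat => /orP[/BV //|/DU/UV].
- by rewrite mem_cat negb_or B0.
- move=> v; rewrite !inE; have := bump_fill sU' Uk' Up Uz q0 oxU bB v => vP.
  apply/psums_catP/andP => [[y [u [By + ->]]]|[vp Vv]].
    rewrite DP !inE => /andP[up Uu]; have [h _] := bump_fill sU' Uk' Up Uz q0 oxU bB (y + u).
    by have [] := h _; [exists y, u | split].
  have [_ h] := vP; have [//|y [u [By Uu up ->]]] := h.
  by exists y, u; rewrite DP !inE up.
Qed.

(* Replacing [x] by [-x] in the last bump moves the missing point to a coset of
   [x], so that it is invisible in the layers not containing [x]. *)
Lemma gadget_exists i k : exists g D, [/\ gadget g, size g.1 = (q ^ k.+2)%N,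
  forall u, u \in g.1 -> u \in Gf i -> u = 0,
  [/\ uniq D, {subset D <= g.1}, 0 \notin D & psums D =i [predD1 g.1 & g.2]] &
  forall j, g.2 \in Gf j -> (q ^ k.+1 <= size (cap Gf g.1 j))%N].
Proof.
have q0 : (0 < q)%N by lia.
have [[U p] [D [gU sU p0 Ui [uD DU D0 DP]]]] := gadget_core i k; rewrite /= in sU p0 Ui DU DP *.
have [sU' Up [z [Uz zq oz]]] := gU; rewrite /= in sU' Up Uz.
have [k' ik' Uk'] := layer_bound U i.
have [x [xq ox]] := indep k'.
have oxU := order_mod_sub sU' Uk' xq ox.
have [B bB] := bumps (Gsub k') (Uk' _ Uz) xq zq ox oz.
have sV := adjoin_fsubgroup sU' q0 oxU; have UV := adjoin_sub sU' q0 oxU.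
set V := adjoin U x q in sV UV.
have BV : {subset B <= V} := bump_sub sU' Uz q0 oxU bB.
have [uB xB xB' B0 [BL _ _]] := bB.
have Vx : x \in V by rewrite -[x]mulr1z mem_adjoin.
have xk' : x \notin Gf k'.
  by rewrite -[x]mulr1z ox; apply/negP => /dvdz_small; lia.
have [B' B'E] : exists B', B' = - x :: rem x B by exists (- x :: rem x B).
have uB' : uniq B'.
  by rewrite B'E /= rem_uniq // andbT; apply: contra xB' => /mem_rem.
(* Changing the sign of one element translates the whole set of subset sums, here by [- x]. *)
have B'P y : (y \in psums B') = (y + x \in psums B).
  have -> : (y + x \in psums B) = (y + x \in psums (x :: rem x B)).
    apply: eq_mem_psums => //; first by rewrite (perm_uniq (perm_to_rem xB)) in uB.
    by move=> b; rewrite (perm_mem (perm_to_rem xB)).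
  rewrite B'E /= !mem_cat orbC; congr (_ || _).
    apply/mapP/idP => [[t Bt ->]|Bt]; first by rewrite addrAC addNr add0r.
    by exists (y + x); rewrite // addrC addrK.
  apply/idP/mapP => [By|[t Bt]]; first by exists y; rewrite // addrC.
  by rewrite addrC => /addrI ->.
exists (V, p - x), (B' ++ D); split=> /=.
- split=> /=; [by []| |by exists z; rewrite UV].
  by rewrite fsubgroupB // UV.
- by rewrite size_adjoin // sU -expnS.
- move=> _ /(adjoinP _ sU' q0 oxU)[h [c [Uh ->]]] Ghc.
  have : x *~ c \in Gf k' by rewrite -(fsubgroupDl _ (Gsub k') (Uk' _ Uh)) (Gmono ik').
  rewrite ox -oxU => Uxc; apply: Ui => //; exact: fsubgroupD.
- split.
  + rewrite cat_uniq uB' uD andbT /=; apply/hasPn => d Dd; rewrite B'E inE negb_or.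
    have Gd : d \in Gf k' by apply/Uk'/DU.
    apply/andP; split.
      by apply: contraNneq xk' => dx; rewrite -(fsubgroupN _ (Gsub k')) -dx.
    apply: contra B0 => /mem_rem Bd.
    by rewrite -(BL d) ?mem_psums.
  + move=> d; rewrite mem_cat B'E inE => /orP[/orP[/eqP ->|/mem_rem/BV //]|/DU/UV //].
    by rewrite fsubgroupN.
  + rewrite mem_cat B'E inE !negb_or D0 andbT; apply/andP; split.
      by apply: contraNneq xk' => x0; rewrite -(fsubgroupN _ (Gsub k')) -x0 fsubgroup0.
    by apply: contra B0 => /mem_rem.
  + move=> v; rewrite !inE.
    have vP w := bump_fill sU' Uk' Up Uz q0 oxU bB w.
    apply/psums_catP/andP => [[y [u [+ + ->]]]|[vp Vv]].
      rewrite B'P DP !inE => By /andP[up Uu]; have [h _] := vP (y + x + u).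
      have [|Vy yp] := h _; first by exists (y + x), u.
      rewrite addrAC in Vy yp; split; first by apply: contraNneq yp => ->; rewrite subrK.
      by rewrite -(fsubgroupDr _ sV Vx).
    have [_ h] := vP (v + x).
    have [|y [u [By Uu up e]]] := h.
      by split; [exact: fsubgroupD | apply: contraNneq vp => <-; rewrite addrK].
    exists (y - x), u; rewrite B'P subrK DP !inE up; split=> //.
    by rewrite addrAC -e addrK.
(* As [x] is not in [Gf k'], which contains [U], a layer containing [p - x] comes after [k'] and so
   contains all of [U]. *)
- move=> j pj; rewrite -sU; apply: uniq_leq_size; first exact: fsubgroup_uniq.
  move=> u Uu; rewrite mem_cap UV //=; apply: (Gmono _ (Uk' _ Uu)).
  rewrite leqNgt; apply/negP => jk; move/negP: xk'; apply.
  have : p - x \in Gf k' by apply: Gmono pj; apply: ltnW.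
  by rewrite (fsubgroupDl _ (Gsub k') (Uk' _ Up)) fsubgroupN.
Qed.

End Gadgets.

(** * Homocyclic case *)

Lemma subseq_allpairs (A B : eqType) (C : eqType) (f : A -> B -> C) s s' t t' :
  subseq s' s -> subseq t' t ->
  subseq [seq f x y | x <- s', y <- t'] [seq f x y | x <- s, y <- t].
Proof.
move=> + tt; elim: s s' => [|a s IH] [|b s'] //=; first by rewrite sub0seq.
case: eqVneq => [->|_] ss; first by apply: cat_subseq; [exact: map_subseq | exact: IH].
by apply: subseq_trans (IH _ ss) _; apply: suffix_subseq.
Qed.

Lemma count_subseq_mem (T : eqType) (s t : seq T) : uniq t -> subseq s t ->
  count [in s] t = size s.
Proof. by move=> ut /(subseq_uniqP ut)/(congr1 size); rewrite size_filter => <-. Qed.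

Section Towers.
Variable G : zmodType.
Implicit Types (g : seq G * G) (l : seq (seq G * G)) (Q S W : seq G).

Definition addseq Q W := [seq x + y | x <- Q, y <- W].

Lemma addseqP Q W x :
  reflect (exists u v, [/\ u \in Q, v \in W & x = u + v]) (x \in addseq Q W).
Proof.
apply: (iffP allpairsP) => [[[u v] /= [Qu Wv ->]]|[u [v [Qu Wv ->]]]].
  by exists u, v.
by exists (u, v).
Qed.

Lemma size_addseq Q W : size (addseq Q W) = (size Q * size W)%N.
Proof. exact: size_allpairs. Qed.

(* [Q + U_1 + ... + U_N], and the same with a point [p_t] removed from each
   [U_t], where [l] lists the pairs [(U_t, p_t)]. *)
Fixpoint tower Q l := if l is g :: l' then addseq g.1 (tower Q l') else Q.
Fixpoint punctured S l :=
  if l is g :: l' then addseq (rem g.2 g.1) (punctured S l') else S.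

Lemma punctured_subseq S Q l : subseq S Q -> subseq (punctured S l) (tower Q l).
Proof.
by move=> SQ; elim: l => //= g l IH; apply: subseq_allpairs => //; apply: rem_subseq.
Qed.

Lemma size_tower Q l : size (tower Q l) = (\prod_(g <- l) size g.1 * size Q)%N.
Proof.
elim: l => [|g l IH] /=; first by rewrite big_nil mul1n.
by rewrite size_addseq IH big_cons mulnA.
Qed.

Lemma tower_rcons Q l g : tower Q (rcons l g) = tower (addseq g.1 Q) l.
Proof. by elim: l => //= h l ->. Qed.

Lemma punctured_rcons S l g :
  punctured S (rcons l g) = punctured (addseq (rem g.2 g.1) S) l.
Proof. by elim: l => //= h l ->. Qed.

Lemma addseqCA Q W T : addseq Q (addseq W T) =i addseq W (addseq Q T).
Proof.
suff h A B : {subset addseq A (addseq B T) <= addseq B (addseq A T)}.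
  by move=> x; apply/idP/idP; apply: h.
move=> x /addseqP[a [_ [Aa /addseqP[b [t [Bb Tt ->]]] ->]]].
by apply/addseqP; exists b, (a + t); rewrite addrCA; split=> //; apply/addseqP; exists a, t.
Qed.

Lemma eq_addseq Q Q' W W' : Q =i Q' -> W =i W' -> addseq Q W =i addseq Q' W'.
Proof.
move=> QQ WW x; apply/addseqP/addseqP => -[u [v [uQ vW ->]]]; exists u, v;
  by rewrite ?QQ ?WW // -?QQ -?WW.
Qed.

Lemma tower_base Q l W : addseq W (tower Q l) =i tower (addseq W Q) l.
Proof.
elim: l => //= g l IH x; rewrite addseqCA; exact: eq_addseq.
Qed.

Lemma punctured_base S l W : addseq W (punctured S l) =i punctured (addseq W S) l.
Proof.
elim: l => //= g l IH x; rewrite addseqCA; exact: eq_addseq.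
Qed.

End Towers.

Section Homocyclic.
Variables (R : archiRealFieldType) (G : zmodType) (Gf : nat -> seq G).
Hypothesis Gsub : forall i, fsubgroup (Gf i).
Hypothesis Gmono : forall i j, (i <= j)%N -> {subset Gf i <= Gf j}.
Hypothesis Gexh : forall x, exists i, x \in Gf i.
Variable q : nat.
Hypothesis q2 : (2 < q)%N.
Hypothesis bumps : bump_system G q.
Hypothesis indep : forall i, exists x, x *+ q = 0 /\ order_mod x (Gf i) q.
Implicit Types (g : seq G * G) (l : seq (seq G * G)) (Q S W V D E U H : seq G).
Local Notation dens := (dens R Gf).
Local Notation valid := (valid Gf).
Local Notation dpath := (dpath Gf).
Local Notation gadget := (gadget q).
Local Notation lam g := ((size g.1)%:R^-1 : R).

(** Directness of the sum is encoded by equality of sizes, [Gf i] being duplicate-free. The number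
    [b], the density of [S] in [Q], is what the density would be with all gadget holes filled. *)
Definition decomp i s (b : R) Q S l :=
  [/\ valid i s, Gf i =i tower Q l, size (Gf i) = size (tower Q l),
      psums s =i punctured S l & subseq S Q /\ b = (size S)%:R / (size Q)%:R].

Lemma gadget_size g : gadget g -> (0 < size g.1)%N.
Proof. by case=> sg _ _; apply: size_fsubgroup_gt0. Qed.

Lemma gadget_lam g : gadget g -> 0 < lam g <= 1.
Proof.
move=> gg; have g0 := gadget_size gg.
by rewrite invr_gt0 ltr0n g0 invf_le1 ?ltr0n // ler1n.
Qed.

Lemma size_punctured S l : (forall g, g \in l -> gadget g) ->
  (size (punctured S l))%:R =
  (\prod_(g <- l) size g.1 * size S)%:R * \prod_(g <- l) (1 - lam g) :> R.
Proof.
elim: l => [|g l IH] gl /=; first by rewrite !big_nil mul1n mulr1.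
have gg := gl g (mem_head _ _); have [sg pg _] := gg.
rewrite size_addseq natrM IH => [|h hl]; last by apply: gl; rewrite inE hl orbT.
rewrite !big_cons size_rem // -subn1 natrB ?gadget_size // !natrM; field.
by rewrite pnatr_eq0 -lt0n gadget_size.
Qed.

Lemma decomp_uniq i s b Q S l : decomp i s b Q S l -> uniq (tower Q l).
Proof.
move=> [_ GT sT _ _]; apply: (leq_size_uniq (fsubgroup_uniq (Gsub i))).
  by move=> x; rewrite GT.
by rewrite sT.
Qed.

Lemma decomp_base_gt0 i s b Q S l : decomp i s b Q S l -> (0 < size Q)%N.
Proof.
move=> [_ _ sT _ _]; have := size_fsubgroup_gt0 (Gsub i).
by rewrite sT size_tower; case: (size Q); rewrite ?muln0.
Qed.

Lemma decomp_dens i s b Q S l : decomp i s b Q S l -> (forall g, g \in l -> gadget g) ->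
  dens i s = b * \prod_(g <- l) (1 - lam g).
Proof.
move=> dc gl; have uT := decomp_uniq dc; have Q0 := decomp_base_gt0 dc.
have [_ GT sT PS [SQ ->]] := dc.
have GTp : perm_eq (Gf i) (tower Q l).
  by apply: uniq_perm => //; apply: fsubgroup_uniq.
rewrite /dens (eq_count PS) (permP GTp) sT.
rewrite count_subseq_mem ?punctured_subseq // size_punctured // size_tower.
rewrite !natrM; field; rewrite !pnatr_eq0 -!lt0n Q0 /=.
rewrite big_seq; apply: prodn_cond_gt0 => g /gl; apply: gadget_size.
Qed.

Lemma prod_lam l : (forall g, g \in l -> gadget g) ->
  0 <= \prod_(g <- l) (1 - lam g) <= 1.
Proof.
elim: l => [|g l IH] gl; first by rewrite big_nil ler01 lexx.
have /andP[p0 p1] : 0 <= \prod_(g <- l) (1 - lam g) <= 1.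
  by apply: IH => h hl; apply: gl; rewrite inE hl orbT.
have /andP[l0 l1] := gadget_lam (gl g (mem_head _ _)).
rewrite big_cons mulr_ge0 ?subr_ge0 //= mulr_ile1 ?subr_ge0 //; lra.
Qed.

Lemma decomp_b i s b Q S l : decomp i s b Q S l -> 0 <= b <= 1.
Proof.
move=> dc; have Q0 := decomp_base_gt0 dc; have [_ _ _ _ [SQ ->]] := dc.
by rewrite divr_ge0 //= ler_pdivrMr ?ltr0n // mul1r ler_nat size_subseq.
Qed.

Lemma decomp_dens_le i s b Q S l : decomp i s b Q S l -> (forall g, g \in l -> gadget g) ->
  dens i s <= b.
Proof.
move=> dc gl; rewrite (decomp_dens dc gl).
have /andP[b0 b1] := decomp_b dc; have /andP[p0 p1] := prod_lam gl.
by rewrite ler_piMr.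
Qed.

(** A tile goes into both [Q] and [S], so neither the ceiling nor the gadgets change. *)
Lemma decomp_flat k V E X b Q S l : uniq V -> V =i tower Q l ->
  size V = size (tower Q l) -> dsum (Gf k) V (psums E) -> valid k (E ++ X) ->
  psums X =i punctured S l -> subseq S Q -> b = (size S)%:R / (size Q)%:R ->
  exists Q' S', decomp k (E ++ X) b Q' S' l.
Proof.
move=> uV VT sV dG vk XP SQ bE; pose W := undup (psums E).
exists (addseq W Q), (addseq W S); split=> //.
- move=> x; rewrite -tower_base; apply/idP/addseqP.
    case/dG.1=> v [w [Vv Ew ->]]; exists w, v; rewrite mem_undup Ew -VT Vv.
    by rewrite addrC.
  case=> w [v []]; rewrite mem_undup -VT => Ew Vv ->; apply/dG.1.
  by exists v, w; rewrite addrC.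
- rewrite (dsum_size (fsubgroup_uniq (Gsub k)) uV dG) sV !size_tower size_addseq.
  by rewrite -/W -mulnA [(size Q * _)%N]mulnC.
- move=> x; rewrite -punctured_base; apply/psums_catP/addseqP.
    by case=> w [y [Ew Xy ->]]; exists w, y; rewrite mem_undup Ew -XP Xy.
  by case=> w [y []]; rewrite mem_undup -XP => Ew Xy ->; exists w, y.
split; first exact: subseq_allpairs.
have W0 : (size W)%:R != 0 :> R.
  rewrite pnatr_eq0 -lt0n -has_predT; apply/hasP; exists 0 => //.
  by rewrite mem_undup psums0.
by rewrite bE !size_addseq !natrM -mulf_div divff // mul1r.
Qed.

Lemma decomp_rotate i s b Q S g l : decomp i s b Q S (g :: l) ->
  decomp i s b Q S (rcons l g).
Proof.
case=> vs GT sT PS [SQ bE]; split=> //.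
- by move=> x; rewrite GT tower_rcons -tower_base.
- by rewrite sT !size_tower -cats1 big_cat big_seq1 big_cons /= [(size g.1 * _)%N]mulnC.
- by move=> x; rewrite PS punctured_rcons -punctured_base.
Qed.

(** A gadget is moved into the base and its hole becomes permanent: the density stays, the ceiling
    drops by the factor [1 - lam g]. *)
Lemma decomp_absorb i s b Q S g l : gadget g -> decomp i s b Q S (g :: l) ->
  decomp i s (b * (1 - lam g)) (addseq g.1 Q) (addseq (rem g.2 g.1) S) l.
Proof.
move=> gg dc; have Q0 := decomp_base_gt0 dc; case: dc => vs GT sT PS [SQ bE].
split=> //.
- by move=> x; rewrite GT -tower_base.
- by rewrite sT !size_tower big_cons size_addseq -mulnA mulnCA.
- by move=> x; rewrite PS -punctured_base.
split; first by apply: subseq_allpairs => //; apply: rem_subseq.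
have [_ pg _] := gg; rewrite bE !size_addseq size_rem // -subn1 !natrM natrB ?gadget_size //.
by field; rewrite !pnatr_eq0 -!lt0n Q0 gadget_size.
Qed.

Lemma decomp_perm i s b Q S l : decomp i s b Q S l -> perm_eq (Gf i) (tower Q l).
Proof.
move=> dc; have uT := decomp_uniq dc; have [_ GT _ _ _] := dc.
by apply: uniq_perm => //; apply: fsubgroup_uniq.
Qed.

Lemma dsum_setsum (H U : seq G) : fsubgroup H -> fsubgroup U ->
  (forall u, u \in U -> u \in H -> u = 0) -> dsum (setsum H U) U H.
Proof.
move=> sH sU UH; split.
  move=> g; split=> [/setsumP[h [u [Hh Uu ->]]]|[u [h [Uu Hh ->]]]].
    by exists u, h; rewrite addrC.
  by rewrite addrC mem_setsum.
move=> u h u' h' Uu Hh Uu' Hh' e; have d0 : u - u' = 0.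
  apply: UH; first exact: fsubgroupB.
  have -> : u - u' = h' - h by apply/eqP; rewrite subr_eq addrAC eq_sym subr_eq addrC e.
  exact: fsubgroupB.
by move/subr0_eq: d0 e => -> /addrI ->.
Qed.

(** The sums become the direct sum of the old ones and [U] without [p]. A layer seeing [p] also sees
    at least [q ^ n.+1] points of [U], so the intermediate loss is at most the factor [1 - c],
    although the trace of [U] may be smaller than [U]. *)
Lemma add_gadget i s b Q S l n : decomp i s b Q S l -> (forall g, g \in l -> gadget g) ->
  let c := (q ^ n.+1)%:R^-1 : R in
  exists g k s' Q' S', [/\ decomp k s' b Q' S' (g :: l), gadget g,
    size g.1 = (q ^ n.+2)%N, dpath c (dens i s * (1 - c)) (dens i s) i s k s' &
    dens k s' = dens i s * (1 - lam g)].
Proof.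
move=> dc gl c.
have [[U p] [D [gg sg Ui [uD DU D0 DP] vis]]] := gadget_exists Gsub Gmono Gexh q2 bumps indep i n.
rewrite /= in sg Ui DU DP vis; have [sU Up _] := gg; rewrite /= in sU Up.
have [vs GT sT PS [SQ bE]] := dc; have [us sG] := vs; have sK := Gsub i.
have dVU := dsum_setsum sK sU Ui; set V := setsum (Gf i) U in dVU.
have sV : fsubgroup V by apply: fsubgroup_setsum.
have KV : {subset Gf i <= V} by move=> h Hh; rewrite -[h]addr0 mem_setsum ?fsubgroup0.
have UV : {subset U <= V} by move=> u Uu; rewrite -[u]add0r mem_setsum ?fsubgroup0.
have [k ik Vk] := layer_bound Gmono Gexh V i.
have PDU : {subset psums D <= U} by apply: psums_fsubgroup.
have [|||E [xE dE EP]] := dens_block R Gsub Gmono (D := D) sV KV Vk ik _ sG.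
- rewrite cat_uniq uD us andbT /=; apply/hasPn => a /sG Ga; apply: contra D0 => Da.
  by rewrite -(Ui a) // DU.
- by move=> d /DU/UV.
- by move=> y /PDU; apply: Ui.
have uV := fsubgroup_uniq sV.
have XP : psums (D ++ s) =i punctured S ((U, p) :: l).
  move=> x /=; apply/psums_catP/addseqP => -[u [v [+ + ->]]].
    rewrite DP PS !inE => /andP[up Uu] vP; exists u, v.
    by rewrite mem_rem_uniq ?fsubgroup_uniq // !inE up.
  rewrite mem_rem_uniq ?fsubgroup_uniq // !inE -PS => /andP[up Uu] vP.
  by exists u, v; rewrite DP !inE up.
have VT : V =i tower Q ((U, p) :: l).
  move=> x /=; apply/idP/addseqP => [/dVU.1|] [u [h [Uu Hh ->]]].
    by exists u, h; rewrite -GT.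
  by apply/dVU.1; exists u, h; rewrite GT.
have sVT : size V = size (tower Q ((U, p) :: l)).
  by rewrite (dsum_size uV (fsubgroup_uniq sU) dVU) undup_id ?fsubgroup_uniq // sT size_addseq.
have vk : valid k (E ++ (D ++ s)) by case: xE => _; rewrite -catA; split.
have [Q' [S' dc']] := decomp_flat uV VT sVT dE vk XP SQ bE.
have key j : (i <= j <= k)%N -> dens j ((E ++ D) ++ s) =
    dens i s * (1 - (p \in Gf j)%:R / (size (cap Gf U j))%:R).
  move=> /[dup] ijk /andP[ij jk]; rewrite EP //.
  have uj := fsubgroup_uniq (cap_fsubgroup Gsub j sV).
  have uUj := fsubgroup_uniq (cap_fsubgroup Gsub j sU).
  have dj : dsum (cap Gf V j) (cap Gf U j) (Gf i).
    split; last by move=> u h u' h'; rewrite !mem_cap => /andP[Uu _] Hh /andP[Uu' _];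
      apply: dVU.2.
    move=> g; rewrite mem_cap; split=> [/andP[/dVU.1[u [h [Uu Hh ->]]]]|].
      rewrite (fsubgroupDr _ (Gsub j) (Gmono ij Hh)) => Gu.
      by exists u, h; rewrite mem_cap Uu.
    case=> u [h []]; rewrite mem_cap => /andP[Uu Gu] Hh ->.
    apply/andP; split; first by apply/dVU.1; exists u, h.
    by rewrite fsubgroupD // (Gmono ij).
  have K0 : (size (Gf i))%:R != 0 :> R by rewrite pnatr_eq0 -lt0n size_fsubgroup_gt0.
  have U0 : (size (cap Gf U j))%:R != 0 :> R.
    by rewrite pnatr_eq0 -lt0n (size_fsubgroup_gt0 (cap_fsubgroup Gsub j sU)).
  rewrite (dsum_size uj uUj dj) (permP (dsum_perm uj uUj dj)) count_allpairs.
  rewrite undup_id ?(fsubgroup_uniq sK) //.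
  set C := count [in psums s] (Gf i).
  have -> : (\sum_(u <- cap Gf U j) count (fun h => (u + h)%R \in psums (D ++ s)) (Gf i) =
      C * count (predC1 p) (cap Gf U j))%N.
    rewrite -(@sum_count_const _ _ (predC1 p) (fun=> C) C) // [RHS]big_mkcond /=.
    apply: eq_big_seq => u; rewrite mem_cap => /andP[Uu Gu]; case: ifPn => up.
      apply: eq_in_count => h Hh /=; apply/psums_catP/idP => [[u' [h' [Du' sh' e]]]|sh].
        have Hh' : h' \in Gf i by apply: psums_fsubgroup sh'.
        have := Du'; rewrite DP !inE => /andP[_ Uu'].
        by have [_ ->] := dVU.2 _ _ _ _ Uu Hh Uu' Hh' e.
      by exists u, h; rewrite DP !inE up.
    apply/eqP; rewrite -leqn0 leqNgt -has_count; apply/hasPn => h Hh /=.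
    move: up; rewrite negbK => /eqP up.
    apply/psums_catP => -[u' [h' [Du' sh' e]]].
    have Hh' : h' \in Gf i by apply: psums_fsubgroup sh'.
    have := Du'; rewrite DP !inE => /andP[up' Uu'].
    by have [uu' _] := dVU.2 _ _ _ _ Uu Hh Uu' Hh' e; rewrite -uu' up eqxx in up'.
  rewrite !natrM; have -> : (count (predC1 p) (cap Gf U j))%:R =
      (size (cap Gf U j))%:R - (p \in Gf j)%:R :> R.
    rewrite -(count_predC (pred1 p) (cap Gf U j)) natrD count_uniq_mem // mem_cap Up /=.
    by rewrite addrAC subrr add0r.
  by rewrite /dens -/C; field; rewrite K0 U0.
exists (U, p), k, ((E ++ D) ++ s), Q', S'.
have d0 := dens_gt0 R Gsub i s; have d1 := dens_le1 R Gsub i s.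
have qn0 m : 0 < (q ^ m)%:R :> R by rewrite ltr0n expn_gt0; lia.
split=> //; first by rewrite -catA.
  apply: (dpath_block xE) => [j ijk|]; last first.
    by rewrite mulrBr mulr1 opprB addrC subrK ler_piMl // invr_ge0 ltW.
  rewrite key //.
  have U0 : 0 < (size (cap Gf U j))%:R :> R.
    by rewrite ltr0n (size_fsubgroup_gt0 (cap_fsubgroup Gsub j sU)).
  apply/andP; split; last by rewrite ler_piMr ?(ltW d0) // lerBlDr lerDl divr_ge0 // ltW.
  rewrite ler_pM2l // lerD2l lerN2; case: (boolP (p \in Gf j)) => [/vis pj|_].
    by rewrite div1r lef_pV2 ?posrE // ler_nat.
  by rewrite mul0r invr_ge0 ltW.
rewrite key ?ik ?leqnn // /= (_ : p \in Gf k); last exact/Vk/UV.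
by rewrite cap_full ?div1r // => u /UV/Vk.
Qed.

(** Adding a bump fills the hole of [U] in all cosets but the trivial one. A visible coset carries
    at least as many sums as before and at most as many as with the hole of [U] filled, and these
    two densities differ by at most [lam g]. *)
Lemma bump_head i s b Q S g l : decomp i s b Q S (g :: l) ->
  (forall h, h \in g :: l -> gadget h) ->
  exists g' k s' Q' S', [/\ decomp k s' b Q' S' (g' :: l), gadget g',
    size g'.1 = (q * size g.1)%N & dpath (lam g) (dens i s) b i s k s'].
Proof.
move=> dc gl; have gg := gl g (mem_head _ _).
have gl' h : h \in l -> gadget h by move=> hl; apply: gl; rewrite inE hl orbT.
have [sU Up [z [Uz zq oz]]] := gg; have [vs GT sT PS [SQ bE]] := dc.
have [us sG] := vs; have sK := Gsub i; have q0 : (0 < q)%N by lia.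
case: g => U p /= in dc gl gg sU Up Uz GT sT PS *.
have UK : {subset U <= Gf i}.
  have /addseqP[u0 [t [Uu0 Tt e0]]] : 0 \in addseq U (tower Q l).
    by rewrite -GT fsubgroup0.
  move=> u Uu; have -> : u = u + t - (0 + t) by rewrite add0r addrK.
  by apply: fsubgroupB => //; rewrite GT; apply/addseqP; [exists u, t | exists 0, t];
    rewrite ?fsubgroup0.
have [x [xq ox]] := indep i; have oxU := order_mod_sub sU UK xq ox.
have [D bD] := bumps sK (UK _ Uz) xq zq ox oz.
have DU' := bump_sub sU Uz q0 oxU bD; have UU' := adjoin_sub sU q0 oxU.
have sU' := adjoin_fsubgroup sU q0 oxU; set U' := adjoin U x q in DU' UU' sU'.
have fill v : _ <-> v \in U' /\ v != p := bump_fill sU UK Up Uz q0 oxU bD v.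
have sV := adjoin_fsubgroup sK q0 ox; set V := adjoin (Gf i) x q in sV.
have U'V : {subset U' <= V}.
  move=> _ /(adjoinP _ sU q0 oxU)[h [c [/UK Hh ->]]].
  by apply/adjoinP => //; exists h, c.
have [uD xD xD' D0 [DK _ DP]] := bD.
have [k ik xk] := Gexh_ge Gmono Gexh i x.
have [|d Dd|E [xE dE EP]] := adjoin_block R Gsub Gmono vs ik xk q0 ox uD _ _ DK.
- by move=> d /DU'/U'V.
- by apply: contra D0 => Kd; rewrite -(DK d) ?mem_psums.
have xd c : x *~ c \in Gf i -> x *~ c = 0.
  by rewrite ox => /dvdzP[m ->]; rewrite mulrC mulrzA -pmulrn xq mul0rz.
have VT : V =i tower Q ((U', p) :: l).
  move=> v /=; apply/idP/addseqP.
    case/(adjoinP _ sK q0 ox) => h [c []]; rewrite GT => /addseqP[u [t [Uu Tt ->]]] ->.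
    exists (u + x *~ c), t; split=> //; last by rewrite addrAC.
    by apply: (fsubgroupD sU' (UU' _ Uu)); apply: mem_adjoin.
  case=> _ [t [/(adjoinP _ sU q0 oxU)[u [c [Uu ->]]] Tt ->]].
  apply/(adjoinP _ sK q0 ox); exists (u + t), c; rewrite GT addrAC; split=> //.
  by apply/addseqP; exists u, t.
have sVT : size V = size (tower Q ((U', p) :: l)).
  by rewrite size_adjoin // sT /= !size_addseq size_adjoin // mulnA.
have XP : psums (D ++ s) =i punctured S ((U', p) :: l).
  move=> v /=; apply/psums_catP/addseqP.
    case=> y [a [Dy]]; rewrite PS => /addseqP[u [t []]].
    rewrite mem_rem_uniq ?fsubgroup_uniq // !inE => /andP[up Uu] St -> ->.
    exists (y + u), t; rewrite addrA mem_rem_uniq ?fsubgroup_uniq // !inE.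
    have [h _] := fill (y + u); have [|-> ->] := h; first by exists y, u.
    by [].
  case=> u' [t []]; rewrite mem_rem_uniq ?fsubgroup_uniq // !inE => /andP[up Uu'] St ->.
  have [_ h] := fill u'; have [//|y [u [Dy Uu up' ->]]] := h.
  exists y, (u + t); rewrite addrA PS; split=> //; apply/addseqP; exists u, t.
  by rewrite mem_rem_uniq ?fsubgroup_uniq // !inE up'.
have vk : valid k (E ++ (D ++ s)) by case: xE => _; rewrite -catA; split.
have [Q' [S' dc']] := decomp_flat (fsubgroup_uniq sV) VT sVT dE vk XP SQ bE.
exists (U', p), k, ((E ++ D) ++ s), Q', S'; split.
- by rewrite -catA.
- by split=> //=; [exact: UU' | exists z; rewrite UU'].
- by rewrite /= size_adjoin.
pose C := count [in psums s] (Gf i).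
pose T := size (addseq U (punctured S l)).
have K0 : 0 < (size (Gf i))%:R :> R by rewrite ltr0n size_fsubgroup_gt0.
have CE : dens i s = C%:R / (size (Gf i))%:R by [].
have U0 : (0 < size U)%N := size_fsubgroup_gt0 sU.
have TE : T%:R / (size (Gf i))%:R = b * \prod_(h <- l) (1 - lam h) :> R.
  have Q0 := decomp_base_gt0 dc.
  rewrite /T size_addseq natrM size_punctured // sT size_addseq size_tower bE.
  have P0 : (0 < \prod_(h <- l) size h.1)%N.
    by rewrite big_seq; apply: prodn_cond_gt0 => h /gl'; apply: gadget_size.
  by rewrite !natrM; field; rewrite !pnatr_eq0 -!lt0n Q0 U0 P0.
have CT : dens i s = T%:R / (size (Gf i))%:R * (1 - lam (U, p)).
  by rewrite (decomp_dens dc gl) big_cons TE; ring.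
have /andP[b0 b1] := decomp_b dc; have /andP[p0 p1] := prod_lam gl'.
have Tb : T%:R / (size (Gf i))%:R <= b by rewrite TE ler_piMr.
have /andP[l0 l1] := gadget_lam gg.
(* Any sum of [D] in the coset of index [c] contributes a full translate of the old sums. *)
have lower c : c \in itv 0 q -> (C <= count (fun h => (h + x *~ c)%R \in psums (D ++ s)) (Gf i))%N.
  rewrite mem_itv add0r => cI.
  have [y0 [e0 [Dy0 Ke0 y0E]]] : exists y0 e0, [/\ y0 \in psums D, e0 \in Gf i & y0 = x *~ c + e0].
    case: c cI => // -[|c] cI; first by exists 0, 0; rewrite psums0 fsubgroup0 // mulr0z addr0.
    have [|a [_ [_ Da _]]] := DP c.+1; first by move: cI; clear; lia.
    by exists (x *~ c.+1%:Z + z *~ a), (z *~ a); rewrite Da fsubgroupMz // UK.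
  have <- : count (fun h => (h - e0)%R \in psums s) (Gf i) = C.
    by apply: (count_shift [in psums s] sK); rewrite fsubgroupN.
  apply: sub_count => h /= sh; apply/psums_catP; exists y0, (h - e0); split=> //.
  by rewrite y0E -addrA subrKC addrC.
(* After translation into [Gf i], every sum lies in [U] plus the other punctured factors, whatever
   [D] contributes. *)
have upper c : (count (fun h => (h + x *~ c)%R \in psums (D ++ s)) (Gf i) <= T)%N.
  have -> : T = count [in addseq U (punctured S l)] (Gf i).
    rewrite (permP (decomp_perm dc)) count_subseq_mem //; first exact: decomp_uniq dc.
    by apply: subseq_allpairs => //; apply: punctured_subseq.
  rewrite -!size_filter; apply: uniq_leq_size; first by rewrite filter_uniq ?fsubgroup_uniq.
  move=> h; rewrite !mem_filter => /andP[+ Hh]; rewrite Hh andbT => /psums_catP[y [a [Dy sa e]]].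
  have /(adjoinP _ sU q0 oxU)[u [d [Uu yE]]] : y \in U' by apply: psums_fsubgroup Dy.
  have Ka : a \in Gf i by apply: psums_fsubgroup sa.
  move: sa; rewrite PS => /addseqP[w [t [Uw St aE]]].
  have hE : h + x *~ (c - d) = u + a.
    by rewrite mulrzBr addrA e yE [u + _ + a]addrAC addrK.
  have /xd x0 : x *~ (c - d) \in Gf i.
    by rewrite -(fsubgroupDl _ sK Hh) hE fsubgroupD // UK.
  rewrite x0 addr0 in hE; rewrite hE aE addrA; apply/addseqP; exists (u + w), t.
  by rewrite fsubgroupD //; apply: mem_rem Uw.
apply: (@dpath_weaken _ _ _ (lam (U, p)) (dens i s) (T%:R / (size (Gf i))%:R)) => //.
apply: (dpath_block xE) => [j /andP[ij jk]|]; last first.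
  by rewrite CT mulrBr mulr1 opprB addrC subrK ler_piMl ?(ltW l0) // (le_trans Tb).
pose m := count (fun c : int => x *~ c \in Gf j) (itv 0 q).
have szE : size (cap Gf V j) = (size (Gf i) * m)%N.
  rewrite -count_predT (count_adjoin Gsub Gmono _ 0 q0 ox ij).
  by apply: sum_count_const => c _; rewrite count_predT.
have m0 : 0 < m%:R :> R.
  rewrite ltr0n -has_count; apply/hasP.
  by exists 0; [rewrite mem_itv add0r lexx ltz_nat | rewrite mulr0z fsubgroup0].
rewrite EP ?ij // szE (count_adjoin Gsub Gmono _ 0 q0 ox ij).
have mK : 0 < (size (Gf i) * m)%:R :> R by rewrite natrM mulr_gt0.
rewrite CE ler_pdivlMr // ler_pdivrMr // !natrM !mulrA !divfK ?gt_eqF //.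
rewrite -!natrM !ler_nat /m -(@sum_count_const _ _ _ (fun=> C) C) //.
rewrite -(@sum_count_const _ _ _ (fun=> T) T) //.
apply/andP; split; rewrite big_seq_cond [leqRHS]big_seq_cond; apply: leq_sum => c /andP[cI _].
  exact: lower.
exact: upper.
Qed.

End Homocyclic.

(** * The strategy for bounded orders *)

Section HomocyclicStrategy.
Variables (R : archiRealFieldType) (G : zmodType) (Gf : nat -> seq G).
Hypothesis Gsub : forall i, fsubgroup (Gf i).
Hypothesis Gmono : forall i j, (i <= j)%N -> {subset Gf i <= Gf j}.
Hypothesis Gexh : forall x, exists i, x \in Gf i.
Variable q : nat.
Hypothesis q2 : (2 < q)%N.
Hypothesis bumps : bump_system G q.
Hypothesis indep : forall i, exists x, x *+ q = 0 /\ order_mod x (Gf i) q.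
Implicit Types (g : seq G * G) (l : seq (seq G * G)) (Q S W V D E U H : seq G).
Local Notation dens := (dens R Gf).
Local Notation valid := (valid Gf).
Local Notation dpath := (dpath Gf).
Local Notation gadget := (gadget q).
Local Notation decomp := (@decomp R _ Gf).
Local Notation lam g := ((size g.1)%:R^-1 : R).

(** Each bump multiplies the size by [q], so finitely many bring the missing proportion below [e'];
    the first jump is the largest. *)
Lemma lift_head e' i s b Q S g l : 0 < e' -> decomp i s b Q S (g :: l) ->
  (forall h, h \in g :: l -> gadget h) ->
  exists g' k s' Q' S', [/\ decomp k s' b Q' S' (g' :: l), gadget g', lam g' <= e' &
    dpath (lam g) (dens i s) b i s k s'].
Proof.
move=> e0 dc gl; have [r] : exists r, ((Num.truncn e'^-1).+1 <= size g.1 + r)%N.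
  by exists (Num.truncn e'^-1).+1; rewrite leq_addl.
elim: r i s Q S g dc gl => [|r IH] i s Q S g dc gl gr;
    have gg := gl g (mem_head _ _); have g0 := gadget_size gg.
  exists g, i, s, Q, S; split=> //; last first.
    by apply: dpath_refl; [case: dc | rewrite lexx (decomp_dens_le Gsub dc gl)].
  rewrite -[e']invrK lef_pV2 ?posrE ?ltr0n ?invr_gt0 // (le_trans (ltW (truncnS_gt _))) //.
  by rewrite ler_nat -(addn0 (size _)).
have [g1 [k [s' [Q1 [S1 [dc1 gg1 sg1 p1]]]]]] :=
  bump_head Gsub Gmono Gexh q2 bumps indep dc gl.
have gl1 h : h \in g1 :: l -> gadget h.
  by rewrite inE => /predU1P[->|hl] //; apply: gl; rewrite inE hl orbT.
have [|g2 [k2 [s2 [Q2 [S2 [dc2 gg2 lg2 p2]]]]]] := IH k s' Q1 S1 g1 dc1 gl1.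
  by apply: leq_trans gr _; rewrite addnS -addSn leq_add2r sg1; nia.
exists g2, k2, s2, Q2, S2; split=> //; have [vs _ _ _ _] := dc.
apply: (dpath_trans Gsub Gmono vs p1); apply: (dpath_weaken p2) => //.
  rewrite lef_pV2 ?posrE ?ltr0n ?(gadget_size gg1) // ler_nat sg1.
  by rewrite leq_pmull //; lia.
by have [_ /andP[]] := dpath_bounds Gsub Gmono vs p1.
Qed.

(** The treated gadget is rotated to the end: [l1] holds those still to be enlarged, [l2] those
    already done. *)
Lemma lift_list e' eta b l1 l2 i s Q S : 0 < e' -> decomp i s b Q S (l1 ++ l2) ->
  (forall h, h \in l1 -> gadget h /\ lam h <= eta) ->
  (forall h, h \in l2 -> gadget h /\ lam h <= e') ->
  exists k s' Q' S' l', [/\ decomp k s' b Q' S' l', size l' = size (l1 ++ l2),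
    forall h, h \in l' -> gadget h /\ lam h <= e' &
    dpath eta (dens i s) b i s k s'].
Proof.
move=> e0; elim: l1 l2 i s Q S => [|g l1 IH] l2 i s Q S dc h1 h2.
  exists i, s, Q, S, l2; split=> //; apply: dpath_refl; first by case: dc.
  by rewrite lexx (decomp_dens_le (q := q) Gsub dc) // => h /h2[].
have gl h : h \in g :: l1 ++ l2 -> gadget h.
  by rewrite -cat_cons mem_cat => /orP[/h1[]|/h2[]].
have [g' [k [s' [Q1 [S1 [dc1 gg1 lg1 p1]]]]]] := lift_head e0 dc gl.
have := decomp_rotate dc1; rewrite rcons_cat => dc1'.
have [|h|k2 [s2 [Q2 [S2 [l' [dc2 sl' hl' p2]]]]]] := IH _ _ _ _ _ dc1'.
- by move=> h hl; apply: h1; rewrite inE hl orbT.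
- by rewrite mem_rcons inE => /predU1P[->|/h2 //].
exists k2, s2, Q2, S2, l'; split=> //.
  by rewrite sl' !size_cat size_rcons /= addnS.
have [vs _ _ _ _] := dc; have [_ lg] := h1 g (mem_head _ _).
have [_ /andP[d1 d2]] := dpath_bounds Gsub Gmono vs p1.
apply: (dpath_trans Gsub Gmono vs (k := k) (s' := s')).
  exact: dpath_weaken p1 _ _ _.
exact: dpath_weaken p2 _ _ _.
Qed.

Lemma prod_lam_ge e' l : 0 <= e' -> (forall h, h \in l -> gadget h /\ lam h <= e') ->
  1 - (size l)%:R * e' <= \prod_(h <- l) (1 - lam h).
Proof.
move=> e0; elim: l => [|g l IH] hl; first by rewrite big_nil mul0r subr0.
have {}IH : 1 - (size l)%:R * e' <= \prod_(h <- l) (1 - lam h).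
  by apply: IH => h hh; apply: hl; rewrite inE hh orbT.
have [gg lg] := hl g (mem_head _ _); have /andP[l0 l1] := gadget_lam R gg.
have /andP[p0 p1] := @prod_lam R G q l (fun h hh => (hl h (mem_behead (s := g :: l) hh)).1).
rewrite big_cons /= -natr1 mulrDl mul1r mulrBl mul1r.
have : lam g * \prod_(h <- l) (1 - lam h) <= e'.
  by apply: le_trans lg; rewrite ler_piMr // ltW.
by lra.
Qed.

(** The bound [eta] on the missing proportions also bounds the jumps when the gadgets are
    enlarged. *)
Definition homo_good (b eta : R) i s := exists Q S l, decomp i s b Q S l /\
  forall g, g \in l -> gadget g /\ lam g <= eta.

Lemma homo_good_le b eta eta' i s : eta <= eta' -> homo_good b eta i s ->
  homo_good b eta' i s.
Proof.
move=> ee [Q [S [l [dc lP]]]]; exists Q, S, l; split=> // g /lP[gg lg].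
by split=> //; apply: le_trans ee.
Qed.

Lemma homo_good_valid b eta i s : homo_good b eta i s ->
  [/\ valid i s, dens i s <= b & b <= 1].
Proof.
case=> [Q [S [l [dc lP]]]]; have [vs _ _ _ _] := dc.
have /andP[_ b1] := decomp_b Gsub dc; split=> //.
by apply: (decomp_dens_le (q := q) Gsub dc) => g /lP[].
Qed.

Lemma small_power e : 0 < e -> exists n, (q ^ n.+1)%:R^-1 <= e :> R.
Proof.
move=> e0; exists (Num.truncn e^-1).
have q1 : (1 < q)%N by lia.
rewrite -[leRHS]invrK lef_pV2 ?posrE ?ltr0n ?invr_gt0 ?expn_gt0 ?(ltnW q1) //.
by apply: (le_trans (ltW (truncnS_gt _))); rewrite ler_nat; apply/ltnW/ltn_expl.
Qed.

Lemma homo_add b eta i s n : homo_good b eta i s ->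
  exists c k s' g, [/\ c <= (q ^ n.+1)%:R^-1, c = (q ^ n.+2)%:R^-1,
    [/\ gadget g, lam g = c & exists Q S l, decomp k s' b Q S (g :: l) /\
        forall g, g \in l -> gadget g /\ lam g <= eta],
    dpath (q ^ n.+1)%:R^-1 (dens i s * (1 - (q ^ n.+1)%:R^-1)) (dens i s) i s k s' &
    dens k s' = dens i s * (1 - c)].
Proof.
case=> [Q [S [l [dc lP]]]]; have gl g : g \in l -> gadget g by move=> /lP[].
have [g [k [s' [Q' [S' [dc' gg sg p d]]]]]] :=
  add_gadget Gsub Gmono Gexh q2 bumps indep n dc gl.
exists (lam g), k, s', g; have q0 : (0 < q)%N by lia.
split=> //.
- by rewrite sg lef_pV2 ?posrE ?ltr0n ?expn_gt0 ?q0 // ler_nat leq_exp2l //; lia.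
- by rewrite sg.
by split=> //; exists Q', S', l.
Qed.

(** Gadgets are added and absorbed at once, so ceiling and final density shrink by the same factor
    and their ratio is kept. In general beta is not reached exactly by such factors, so the ceiling
    stops just above it. *)
Lemma homo_base b eta i s beta e0 e : homo_good b eta i s -> 0 < beta <= b ->
  0 < e <= 1/2 -> 0 <= e0 <= 1 -> b * (1 - e0) <= dens i s ->
  exists b' k s', [/\ homo_good b' eta k s',
    (beta <= b' <= beta * (1 + e)) && (b' <= b) &
    dpath e (beta * (1 - e0) * (1 - e)) b i s k s'].
Proof.
move=> Gb /andP[be0 beb] /andP[ep e2] /andP[e00 e01].
have [|n nE] := @small_power (e / 2); first by rewrite divr_gt0.
pose c : R := (q ^ n.+2)%:R^-1.
have c0 : 0 < c by rewrite invr_gt0 ltr0n expn_gt0; lia.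
have bc0 : 0 < beta * c by rewrite mulr_gt0.
have [r] : exists r : nat, b <= beta * (1 + e) + r%:R * (beta * c).
  exists (Num.truncn ((b - beta * (1 + e)) / (beta * c))).+1.
  by rewrite -lerBlDl -ler_pdivrMr // ltW ?truncnS_gt.
elim: r b i s Gb beb => [|r IH] b i s Gb beb br bd;
    have [vs db b1] := homo_good_valid Gb.
  exists b, i, s; split=> //; first by rewrite beb lexx andbT; move: br; rewrite mul0r addr0.
  apply: dpath_refl => //; rewrite db andbT; apply: le_trans bd.
  rewrite mulrAC; apply: ler_wpM2r; first lra.
  by apply: le_trans beb; rewrite ler_piMr ?(ltW be0) //; lra.
have [bb|bb] := leP b (beta * (1 + e)).
  exists b, i, s; split=> //; first by rewrite beb lexx bb.
  apply: dpath_refl => //; rewrite db andbT; apply: le_trans bd.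
  rewrite mulrAC; apply: ler_wpM2r; first lra.
  by apply: le_trans beb; rewrite ler_piMr ?(ltW be0) //; lra.
have [c' [k [s' [g [c'n c'E [gg lg [Q [S [l [dc lP]]]]] p d]]]]] := homo_add n Gb.
have cc : c' = c by rewrite c'E.
have := decomp_absorb Gsub gg dc; rewrite lg cc => dc'.
have Gb' : homo_good (b * (1 - c)) eta k s' by exists (addseq g.1 Q), (addseq (rem g.2 g.1) S), l.
rewrite cc in c'n d.
have bc : beta * c <= b * c by rewrite ler_pM2r.
have [|||b' [k2 [s2 [Gb2 /andP[b'1 b'2] p2]]]] := IH _ _ _ Gb'.
(* The ceiling does not drop below beta, as [(1 + e) * (1 - c) >= 1] for [c <= e / 2] and
   [e <= 1/2]. *)
- have : beta * (1 + e) * (1 - c) <= b * (1 - c) by apply: ler_wpM2r; lra.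
  apply: le_trans; rewrite -mulrA ler_peMr ?(ltW be0) //.
  have : 0 <= (e / 2 - c) * (1 + e) by rewrite mulr_ge0; lra.
  have : 0 <= e * (1/2 - e) by rewrite mulr_ge0 ?(ltW ep) //; lra.
  by rewrite !(mulrDr, mulrDl, mulrBr, mulrBl, mul1r, mulr1); lra.
- by move: br; rewrite -natr1 mulrDl mul1r mulrBr mulr1; lra.
- by rewrite d mulrAC; apply: ler_wpM2r => //; lra.
exists b', k2, s2; split=> //.
  by rewrite b'1 /= (le_trans b'2) // mulrBr mulr1; lra.
apply: (dpath_trans Gsub Gmono vs (k := k) (s' := s')).
  apply: (dpath_weaken p) => //; first lra.
  apply: ler_pM; try lra.
    by rewrite mulr_ge0 ?(ltW be0) //; lra.
  by apply: le_trans bd; apply: ler_wpM2r => //; lra.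
by apply: (dpath_weaken p2) => //; rewrite mulrBr mulr1; lra.
Qed.

Lemma homo_strategy : strategy Gf homo_good.
Proof.
split.
- by move=> b eta i s; apply: homo_good_valid.
- have s0 : fsubgroup [:: 0 : G].
    by split; rewrite ?mem_head // => a b; rewrite !inE => /eqP -> /eqP ->; rewrite subr0.
  (* The start is a list whose sums fill the first layer, so that the ceiling is 1 and there are no
     gadgets. *)
  have [|s [us sG _ [sP _]]] := tile_exists s0 (Gsub 0).
    by move=> x; rewrite inE => /eqP ->; apply: fsubgroup0.
  exists 0%N, s, (Gf 0), (Gf 0), [::]; split=> //; split=> //.
    move=> x /=; apply/idP/idP => [xs|/sP[h [t [+ ts ->]]]].
      by apply/sP; exists 0, x; rewrite mem_head add0r.
    by rewrite inE => /eqP ->; rewrite add0r.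
  by split=> //; rewrite divff // pnatr_eq0 -lt0n size_fsubgroup_gt0.
- move=> b eta i s [Q [S [l [dc lP]]]]; have [vs GT sT PS [SQ bE]] := dc.
  have q0 : (0 < q)%N by lia.
  have [x [xq ox]] := indep i; have [k ik xk] := Gexh_ge Gmono Gexh i x.
  have [cs [r [ucs csn csP]]] := digits_exist q0.
  have rq : (r < q)%N by have := psums0 cs; rewrite csP; lia.
  have cs0 : 0 \notin cs by apply/negP => /csn; rewrite normr0 ltxx.
  have [E [xE dE EP]] := flat_block R Gsub Gmono vs ik xk ox rq ucs cs0 csP.
  set D := [seq x *~ c | c <- cs] in xE EP.
  have xD c : x *~ c \in psums (E ++ D).
    apply/psums_catP; exists 0, (x *~ c); rewrite psums0 add0r; split=> //.
    pose c' := ((c + r%:Z) %% q)%Z - r%:Z.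
    have -> : x *~ c = x *~ c'.
      apply/eqP; rewrite -subr_eq0 -mulrzBr.
      have -> : c - c' = q%:Z * ((c + r%:Z) %/ q)%Z by have := divz_eq (c + r%:Z) q; rewrite /c'; lia.
      by rewrite mulrzA -pmulrn xq mul0rz.
    rewrite psums_mulrz map_f // csP /c'.
    have := modz_ge0 (c + r%:Z) (d := q%:Z); have := ltz_pmod (c + r%:Z) (d := q%:Z); lia.
  have csP' c : (c \in psums cs) = (- r%:Z <= c < - r%:Z + q%:Z) by rewrite csP; lia.
  have dD := dsum_digits (Gsub i) q0 ox csP'.
  have vk : valid k ((E ++ D) ++ s) by case: xE => _; split.
  have [Q' [S' dc']] := decomp_flat Gsub (fsubgroup_uniq (Gsub i)) GT sT
    (dsum_psums_cat dE dD) vk PS SQ bE.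
  exists k, (E ++ D), (x *~ 1); split=> //; first by exists Q', S', l.
  split; rewrite -?mulrzDr ?xD //.
  apply: contraTneq (fsubgroup0 (Gsub i)) => x0; rewrite -x0 ox.
  by apply/negP => /dvdz_small; lia.
- move=> b eta i s beta e0 e Gb bb e2 e01 bd.
  have [b' [k [s' [Gb' b'b p]]]] := homo_base Gb bb e2 e01 bd.
  exists b', k, s'; split=> //; apply: homo_good_le Gb'.
  by rewrite le_max lexx.
- move=> b eta i s tau e Gb tau0 /andP[ep e2].
  have [n nE] := small_power ep.
  pose I := homo_good b (Num.max eta e).
  have Gb' : I i s by apply: homo_good_le Gb; rewrite le_max lexx.
  have e01 : 0 <= e <= 1 by rewrite ltW //=; lra.
  have c0 : 0 < (q ^ n.+2)%:R^-1 :> R by rewrite invr_gt0 ltr0n expn_gt0; lia.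
  have [||k [s' [p d Gk]]] := dpath_down Gsub Gmono (I := I) e01 c0 tau0 _ _ Gb'.
  + by move=> j t /homo_good_valid[].
  + move=> j t Gt; have [vt _ _] := homo_good_valid Gt.
    have [c' [k [s' [g [c'n c'E [gg lg [Q [S [l [dc lP]]]]] p d]]]]] := homo_add n Gt.
    have d0 := dens_gt0 R Gsub j t.
    exists k, s'; split; last first.
    * exists Q, S, (g :: l); split=> // h; rewrite inE => /predU1P[->|/lP //].
      by split=> //; rewrite lg le_max (le_trans c'n nE) orbT.
    * by rewrite d c'E.
    * apply: (dpath_weaken p) => //; apply: ler_wpM2l (ltW d0) _ _ _; lra.
  by exists k, s'.
- move=> b eta i s e [Q [S [l [dc lP]]]] /andP[ep e2].
  (* Enlarging keeps the number of gadgets, so the holes together cost at most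
     [size l * e' <= e]. *)
  pose e' := e / (size l).+1%:R.
  have e'0 : 0 < e' by rewrite divr_gt0.
  rewrite -(cats0 l) in dc; have [//|k [s' [Q' [S' [l' [dc' sl' hl' p]]]]]] := lift_list e'0 dc lP.
  rewrite cats0 in sl'.
  have gl' h : h \in l' -> gadget h by move=> /hl'[].
  have e'e : e' <= e by rewrite ler_pdivrMr // ler_peMr ?(ltW ep) // ler1n.
  exists k, s'; split.
  + by exists Q', S', l'; split=> // h /hl'[gh lh]; split=> //; apply: le_trans e'e.
  + by apply: (dpath_weaken p) => //; rewrite le_max lexx.
  rewrite (decomp_dens Gsub dc' gl'); have /andP[b0 _] := decomp_b Gsub dc'.
  apply: ler_wpM2l => //; apply: le_trans (prod_lam_ge (ltW e'0) hl').
  rewrite lerD2l lerN2 sl' /e' mulrA ler_pdivrMr // mulrC ler_pM2l // ler_nat.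
  exact: leqnSn.
Qed.

End HomocyclicStrategy.

(** * Limit points *)

(* An oscillating sequence with small steps comes close to every value it
   passes. *)
Lemma slow_sequence_limits (R : realType) (d : nat -> R) (alpha beta : R) :
  (forall e, 0 < e -> exists N, forall j, (N <= j)%N -> alpha - e <= d j <= beta + e) ->
  (forall e, 0 < e -> exists N, forall j, (N <= j)%N -> `|d j.+1 - d j| <= e) ->
  (forall e N, 0 < e -> exists2 j, (N <= j)%N & d j <= alpha + e) ->
  (forall e N, 0 < e -> exists2 j, (N <= j)%N & beta - e <= d j) ->
  forall gamma, (exists i : nat -> nat, {homo i : m n / (m < n)%N} /\
    (fun l => d (i l)) @ \oo --> gamma) <-> alpha <= gamma <= beta.
Proof.
move=> dI dS dL dH gamma; split.
  case=> i [imono /cvgrPdist_lt ig].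
  have ige l : (l <= i l)%N.
    by elim: l => // l IH; apply: leq_ltn_trans IH _; apply: imono.
  have bound e : 0 < e -> alpha - e - e <= gamma <= beta + e + e.
    move=> e0; have [N HN] := dI e e0; have [M _ HM] := ig e e0.
    have := HM (maxn M N) (leq_maxl _ _); rewrite ltr_distl => /andP[h1 h2].
    have /HN/andP[h3 h4] : (N <= i (maxn M N))%N by apply: leq_trans (leq_maxr M N) (ige _).
    by apply/andP; split; lra.
  apply/andP; split; apply/ler_addgt0Pr => e e0.
    have /bound/andP[h _] : 0 < e / 2 by rewrite divr_gt0.
    by lra.
  have /bound/andP[_ h] : 0 < e / 2 by rewrite divr_gt0.
  by lra.
case/andP=> ag gb.
have close e N : 0 < e -> exists2 j, (N <= j)%N & `|gamma - d j| <= e.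
  move=> e0; have [N1 HN1] := dS e e0.
  have [j1 j1N dj1] := dL e (maxn N N1) e0.
  have [j2 j12 dj2] := dH e j1 e0.
  (* At the first index after a low point with value at least [gamma - e], the predecessor is below
     [gamma - e], so one small step cannot lead above [gamma]. *)
  pose P j := (j1 <= j)%N && (gamma - e <= d j).
  have exP : exists j, P j by exists j2; rewrite /P j12 /=; lra.
  case: (ex_minnP exP) => j /andP[j1j dj] jmin.
  have Nj : (N <= j)%N by apply: leq_trans j1j; apply: leq_trans j1N; apply: leq_maxl.
  exists j => //; rewrite ler_distl; apply/andP; split; last by lra.
  move: j1j; rewrite leq_eqVlt => /predU1P[<-|j1j]; first by lra.
  case: j j1j dj jmin Nj => // j j1j dj jmin Nj.
  have dj' : d j < gamma - e.
    rewrite ltNge; apply/negP => h; have := jmin j; rewrite /P h andbT -ltnS j1j => /(_ isT).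
    by rewrite ltnn.
  have /HN1 : (N1 <= j)%N.
    by apply: leq_trans (leq_trans (leq_maxr N N1) j1N) _; rewrite -ltnS.
  by rewrite ler_norml => /andP[_ h]; lra.
have step l n : exists m, (n < m)%N /\ `|gamma - d m| <= l.+1%:R^-1.
  by have [|m nm h] := close l.+1%:R^-1 n.+1; [rewrite invr_gt0 | exists m].
have [f fP] := choice (fun p : nat * nat => step p.1 p.2).
pose i := fix i l := if l is l'.+1 then f (l'.+1, i l') else f (0%N, 0%N).
have iP l : `|gamma - d (i l)| <= l.+1%:R^-1.
  by case: l => [|l]; exact: (fP (_, _)).2.
exists i; split.
  apply: homo_ltn; first exact: ltn_trans.
  by move=> l; exact: (fP (l.+1, i l)).1.
apply/cvgrPdist_le => e e0; exists (Num.truncn e^-1) => // l /= le.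
apply: le_trans (iP l) _; rewrite -[e]invrK lef_pV2 ?posrE ?invr_gt0 //.
by rewrite ltW // (lt_le_trans (truncnS_gt _)) // ler_nat.
Qed.

Definition layer (G : zmodType) (Gs : nat -> set G) (j : nat) : seq G := fset_set (Gs j).

(** * From a strategy to the sets A and B *)

Section Assembly.
Variables (R : realType) (G : zmodType) (Gs : nat -> set G).
Hypothesis hGs : finite_filtration Gs.
Let Gf := layer Gs.

Lemma mem_layer j x : x \in Gf j <-> Gs j x.
Proof.
case: hGs => _ fin _ _; rewrite /Gf /layer in_fset_set //.
by rewrite inE.
Qed.

Lemma layer_fsubgroup j : fsubgroup (Gf j).
Proof.
case: hGs => sub fin _ _; have [h0 hB] := sub j; split; first exact: fset_uniq.
  by apply/mem_layer; move: h0; rewrite inE.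
move=> x y /mem_layer xj /mem_layer yj; apply/mem_layer.
by have := hB x y; rewrite !inE; apply.
Qed.

Lemma layer_mono i j : (i <= j)%N -> {subset Gf i <= Gf j}.
Proof.
case: hGs => _ _ mono _ ij x /mem_layer xi; apply/mem_layer.
elim: j ij => [|j IH]; first by rewrite leqn0 => /eqP <-.
by rewrite leq_eqVlt ltnS => /predU1P[<- //|/IH]; apply: mono.
Qed.

Lemma layer_exhaust x : exists i, x \in Gf i.
Proof.
case: hGs => _ _ _ cov; have : (\bigcup_i Gs i) x by rewrite cov.
by case=> i _ /mem_layer xi; exists i.
Qed.

Lemma density_layer (S : set G) (p : pred G) j : {in Gf j, forall x, p x <-> S x} ->
  density R Gs j S = (count p (Gf j))%:R / (size (Gf j))%:R.
Proof.
move=> pS; rewrite /density; congr (_%:R / _); rewrite -size_filter.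
have [_ fin _ _] := hGs.
apply/perm_size/uniq_perm; [exact: fset_uniq | exact: filter_uniq (fset_uniq _) |].
move=> x; rewrite mem_filter in_fset_set; last exact: finite_setIr.
apply/idP/andP; rewrite inE /=.
  by case=> Sx /mem_layer xj; split=> //; apply/(pS _ xj).
by case=> px xj; split; [apply/(pS _ xj) | apply/mem_layer].
Qed.

(** Cycles are iterated with tolerances tending to 0. The set A is the union of the stages, B
    collects one element [y n] from each cycle, and finality turns the density of the infinite set
    into that of a finite stage. *)
Lemma strategy_limits (Good : R -> R -> nat -> seq G -> Prop) (alpha beta : R) :
  strategy Gf Good -> 0 <= alpha -> alpha <= beta -> beta <= 1 -> 0 < beta ->
  exists A B : set G,
    [/\ infinite_set B, B `<=` subset_sums A,
        density_limits Gs A = `[alpha, beta]%classic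
      & sumset B B `<=` subset_sums A].
Proof.
move=> SG a0 ab b1 b0.
(* With [er 0 = 1] the condition [b * (1 - er 0) <= dens] is void, so the start may have any
   density; the initial ceiling is 1, hence the upper bound on [b] only for [n > 0]. *)
pose er (n : nat) : R := n.+1%:R^-1.
have er0 n : 0 < er n by rewrite invr_gt0.
have er1 n : er n <= 1 by rewrite invf_le1 // ler1n.
have erS n : er n.+1 <= er n by rewrite lef_pV2 ?posrE // ler_nat.
have er2 n : er n.+1 <= 1/2 by rewrite div1r lef_pV2 ?posrE // ler_nat.
pose state := (nat * nat * seq G * R)%type.
pose Inv (p : state) := let: (n, i, s, b) := p in
  [/\ Good b (er n) i s, beta <= b, b * (1 - er n) <= dens R Gf i s &
      (0 < n)%N -> b <= beta * (1 + er n)].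
pose Step (p p' : state) (F : seq G) (y : G) (j0 : nat) :=
  let: (n, i, s, b) := p in let: (n', k, s', b') := p' in
  [/\ n' = n.+1, s' = F ++ s,
      [/\ ext Gf i s k F, (i < k)%N,
       forall j, (i <= j <= k)%N -> alpha * (1 - er n) * (1 - er n.+1) <= dens R Gf j s' <= b &
       forall j, (i <= j < k)%N -> `|dens R Gf j.+1 s' - dens R Gf j s'| <= er n] &
    [/\ (i <= j0 <= k)%N, dens R Gf j0 s' <= alpha + er n.+1,
       beta * (1 - er n.+1) <= dens R Gf k s' &
       [/\ y \in psums F, y + y \in psums F & y != 0]]].
have nextP (p : {p | Inv p}) : exists q : {p | Inv p} * (seq G * G * nat),
    Step (sval p) (sval q.1) q.2.1.1 q.2.1.2 q.2.2.
  case: p => -[[[n i] s] b] /= [Gd bb bd bn].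
  have [||||||b' [k [F [y [j0 [Gd' b'b d' [xF ik dF mF [j0k dj0 y1 y2 y3]]]]]]]] :=
    strategy_cycle layer_fsubgroup layer_mono SG (alpha := alpha) (beta := beta)
      (e0 := er n) (e := er n.+1) Gd; rewrite ?a0 ?b0 ?er0 ?er2 ?erS ?er1 //.
  have I' : Inv (n.+1, k, F ++ s, b').
    by case/andP: b'b => b'1 b'2; split.
  exists (exist Inv _ I', (F, y, j0)) => /=; split=> //; split=> //.
  apply: le_trans d'; rewrite ler_wpM2r //; first by rewrite subr_ge0.
  by case/andP: b'b.
have [next nextE] := choice nextP.
have [i0 [s0 G0]] := good_init SG.
have I0 : Inv (0%N, i0, s0, 1).
  split=> //; first by rewrite /er invr1.
  by rewrite /er invr1 subrr mulr0 dens_ge0.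
pose st n := iter n (fun p => (next p).1) (exist Inv _ I0).
pose F n := (next (st n)).2.1.1; pose y n := (next (st n)).2.1.2.
pose j0 n := (next (st n)).2.2.
pose i n := (sval (st n)).1.1.2; pose s n := (sval (st n)).1.2.
pose b n := (sval (st n)).2.
have stn n : (sval (st n)).1.1.1 = n.
  elim: n => //= n IH; have := nextE (st n); move: IH; rewrite /=.
  case: (next (st n)) => -[[[[n' i'] s'] b'] I'] q /=.
  by case: (st n) => -[[[n'' i''] s''] b''] I'' /= -> [->].
have Invn n : [/\ Good (b n) (er n) (i n) (s n), beta <= b n,
    b n * (1 - er n) <= dens R Gf (i n) (s n) & (0 < n)%N -> b n <= beta * (1 + er n)].
  have := stn n; rewrite /b /i /s; case: (st n) => -[[[n' i'] s'] b'] I' /= e.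
  by move: I'; rewrite /= e.
have Stepn n : Step (n, i n, s n, b n) (n.+1, i n.+1, s n.+1, b n.+1) (F n) (y n) (j0 n).
  have := nextE (st n); have := stn n; have := stn n.+1.
  rewrite /F /y /j0 /i /s /b /=.
  case: (next (st n)) => -[[[[n' i'] s'] b'] I'] q /=.
  by case: (st n) => -[[[n'' i''] s''] b''] I'' /= -> ->.
clearbody F y j0 i s b; clear stn nextE nextP.
have vs n : valid Gf (i n) (s n).
  by have [Gn _ _ _] := Invn n; have [] := good_valid SG Gn.
have iS n : (i n < i n.+1)%N by have [_ _ []] := Stepn n.
have imono m n : (m <= n)%N -> (i m <= i n)%N.
  elim: n => [|n IH]; first by rewrite leqn0 => /eqP ->.
  rewrite leq_eqVlt ltnS => /predU1P[-> //|/IH mn].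
  exact: leq_trans mn (ltnW (iS n)).
have ige n : (n <= i n)%N by elim: n => // n IH; apply: leq_ltn_trans IH (iS n).
have sF n : s n.+1 = F n ++ s n by have [] := Stepn n.
have xF n : ext Gf (i n) (s n) (i n.+1) (F n) by have [_ _ []] := Stepn n.
have smono m n : (m <= n)%N -> {subset s m <= s n}.
  elim: n => [|n IH]; first by rewrite leqn0 => /eqP ->.
  rewrite leq_eqVlt ltnS => /predU1P[-> //|/IH mn] x /mn xn.
  by rewrite sF mem_cat xn orbT.
have Pn m n j : (n <= m)%N -> (j <= i n)%N -> {in Gf j, psums (s m) =i psums (s n)}.
  elim: m => [|m IH]; first by rewrite leqn0 => /eqP ->.
  rewrite leq_eqVlt ltnS => /predU1P[-> //|nm] jn x xj; rewrite -(IH nm jn) //.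
  rewrite sF (ext_psums layer_fsubgroup layer_mono (vs m).2 (xF m)  _ xj) //.
  exact: leq_trans jn (imono _ _ nm).
pose A : set G := \bigcup_n [set` s n].
have subA n x : x \in psums (s n) -> subset_sums A x.
  case/psumsP => t ts ->; have ut := subseq_uniq ts (vs n).1.
  exists [fset a in t]%fset.
    by move=> a /=; rewrite in_fset => at'; exists n => //=; apply: mem_subseq at'.
  by apply/perm_big/uniq_perm => [|//|a]; [exact: fset_uniq | rewrite in_fset].
have Asub x : subset_sums A x -> exists N, forall m, (N <= m)%N -> x \in psums (s m).
  case=> X XA <-.
  have [N XN] : exists N, {subset enum_fset X <= s N}.
    have : forall a, a \in enum_fset X -> A a by move=> a aX; apply: XA.
    elim: (enum_fset X) => [|a l IH] lA; first by exists 0%N.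
    have [|N lN] := IH; first by move=> c cl; apply: lA; rewrite inE cl orbT.
    have [M _ /= aM] := lA a (mem_head _ _).
    exists (maxn M N) => c; rewrite inE => /predU1P[->|/lN cN].
      exact: smono (leq_maxl _ _) _ aM.
    exact: smono (leq_maxr _ _) _ cN.
  exists N => m Nm; apply: (psums_subset (fset_uniq X)).
    by move=> a /XN; apply: smono.
  by apply/psumsP; exists (enum_fset X).
(* Membership of an element of layer [j] is decided at any stage [n] with [j <= i n]. *)
have memA n j : (j <= i n)%N -> {in Gf j, forall x, [in psums (s n)] x <-> subset_sums A x}.
  move=> jn x xj; split=> [/subA //|/Asub[N HN]] /=.
  by rewrite -(Pn (maxn N n) n j (leq_maxr _ _) jn x xj) HN // leq_maxl.
pose d j := density R Gs j (subset_sums A).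
have dE n j : (j <= i n)%N -> d j = dens R Gf j (s n).
  by move=> jn; rewrite /d (density_layer (memA n j jn)).
have locate N j : (i N <= j)%N -> exists n, [/\ (N <= n)%N, (i n <= j)%N & (j < i n.+1)%N].
  move=> Nj; have exP : exists n, (j < i n)%N by exists j.+1; apply: ige.
  case: (ex_minnP exP) => -[|n] jn nmin.
    by have := leq_trans jn (leq_trans (imono 0%N N (leq0n _)) Nj); rewrite ltnn.
  exists n; split=> //.
    rewrite leqNgt; apply/negP => nN.
    by have := leq_trans jn (leq_trans (imono _ _ nN) Nj); rewrite ltnn.
  by rewrite leqNgt; apply/negP => /nmin; rewrite ltnn.
have small e : 0 < e -> exists N, forall n, (N <= n)%N -> er n <= e.
  move=> e0; exists (Num.truncn e^-1) => n Nn.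
  rewrite /er -[e]invrK lef_pV2 ?posrE ?invr_gt0 //.
  by rewrite ltW // (lt_le_trans (truncnS_gt _)) // ler_nat.
have a1 : alpha <= 1 by apply: le_trans ab b1.
have lims gamma : (exists i' : nat -> nat, {homo i' : m n / (m < n)%N} /\
    (fun l => d (i' l)) @ \oo --> gamma) <-> alpha <= gamma <= beta.
  apply: slow_sequence_limits.
  - move=> e e0; have [|N HN] := small (e / 2); first by rewrite divr_gt0.
    exists (i N.+1) => j /locate[n [Nn nj jn]].
    have [_ _ [_ _ dF _] _] := Stepn n; have [_ _ _ bn] := Invn n.
    have /andP[h1 h2] := dF j (introT andP (conj nj (ltnW jn))).
    have e1 := HN n (ltnW Nn); have e2 := erS n; have e3 := er0 n.+1; have e4 := er0 n.
    have {}bn := bn (leq_ltn_trans (leq0n _) Nn).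
    rewrite (dE n.+1) ?(ltnW jn) //; apply/andP; split.
      apply: le_trans h1; rewrite mulrBr mulr1 mulrBr mulr1.
      have : alpha * er n <= er n by rewrite ler_piMl // ltW.
      have : alpha * er n.+1 <= er n.+1 by rewrite ler_piMl // ltW.
      have : 0 <= alpha * er n * er n.+1 by rewrite !mulr_ge0 // ltW.
      by rewrite mulrBl; lra.
    apply: (le_trans h2); apply: (le_trans bn); rewrite mulrDr mulr1.
    have : beta * er n <= er n by rewrite ler_piMl // ltW.
    by lra.
  - move=> e e0; have [N HN] := small e e0; exists (i N) => j /locate[n [Nn nj jn]].
    have [_ _ [_ _ _ mF] _] := Stepn n.
    rewrite !(dE n.+1) ?(ltnW jn) //; apply: le_trans (HN n Nn).
    by apply: mF; rewrite nj.
  - move=> e N e0; have [M HM] := small e e0; pose n := maxn N M.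
    have [_ _ _ [/andP[nj jn] dj _ _]] := Stepn n.
    exists (j0 n); first exact: leq_trans (leq_trans (leq_maxl N M) (ige n)) nj.
    rewrite (dE n.+1) //; apply: (le_trans dj); rewrite lerD2l.
    by apply: HM; apply: leq_trans (leqnSn n); apply: leq_maxr.
  - move=> e N e0; have [M HM] := small e e0; pose n := maxn N M.
    have [_ _ _ [_ _ dk _]] := Stepn n.
    exists (i n.+1).
      by apply: leq_trans (ige _); apply: leq_trans (leqnSn n); apply: leq_maxl.
    rewrite (dE n.+1) //; apply: le_trans dk; rewrite mulrBr mulr1 lerB //.
    have : er n.+1 <= e by apply: HM; apply: leq_trans (leqnSn n); apply: leq_maxr.
    by apply: le_trans; rewrite ler_piMl // ltW.
have yP n : [/\ y n \in psums (F n), y n + y n \in psums (F n) & y n != 0].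
  by have [_ _ _ []] := Stepn n.
have FsS n : {subset psums (F n) <= psums (s n.+1)}.
  move=> x xn; rewrite sF; apply/psums_catP; exists x, 0.
  by rewrite psums0 addr0.
exists A, (range y); split.
(* A finite set lies in some layer [N], but [y N] is a nonzero sum of elements new over [Gf (i N)],
   which contains that layer. *)
- move=> /finite_fsetP[X yX].
  have [N XN] : exists N, {subset enum_fset X <= Gf N}.
    elim: (enum_fset X) => [|a l [N lN]]; first by exists 0%N.
    have [M aM] := layer_exhaust a; exists (maxn M N) => c.
    rewrite inE => /predU1P[->|/lN cN]; first exact: layer_mono (leq_maxl _ _) _ aM.
    exact: layer_mono (leq_maxr _ _) _ cN.
  have yN : y N \in Gf N by apply: XN; have : [set` X] (y N) by rewrite -yX; exists N.
  have [_ _ _ F0] := xF N; have [y1 _ /eqP] := yP N; apply; apply: F0 => //.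
  exact: layer_mono (ige N) _ yN.
- by move=> _ [n _ <-]; have [/FsS/subA] := yP n.
- apply/seteqP; split=> gamma /=; rewrite in_itv /=.
    by case=> _ lg; apply/lims.
  move=> ag; split; last by apply/lims.
  by case/andP: ag => ag gb; rewrite (le_trans a0 ag) (le_trans gb b1).
(* For [n < m] the summand [y n] uses elements of [s m] and [y m] uses elements of [F m], which are
   disjoint; for [n = m] the double was provided by the cycle. *)
- have sumy n m : (n <= m)%N -> subset_sums A (y n + y m).
    rewrite leq_eqVlt => /predU1P[->|nm].
      by have [_ /FsS/subA] := yP m.
    apply: (subA m.+1); rewrite sF addrC; apply/psums_catP; exists (y m), (y n); split=> //.
      by have [] := yP m.
    have [yn _ _] := yP n; apply: psums_subset (vs n.+1).1 _ _ (FsS _ _ yn).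
    exact: smono.
  move=> _ [_ [n _ <-] [_ [m _ <-] <-]].
  by have [nm|mn] := leqP n m; [apply: sumy | rewrite addrC; apply/sumy/ltnW].
Qed.

End Assembly.

(** * The two cases for G *)

Section Dichotomy.
Variables (G : zmodType) (Gf : nat -> seq G).
Hypothesis Gsub : forall i, fsubgroup (Gf i).
Hypothesis Gmono : forall i j, (i <= j)%N -> {subset Gf i <= Gf j}.
Hypothesis Gexh : forall x, exists i, x \in Gf i.

(** If the order of [x] modulo the layer is not [q], it is a proper divisor of [q]. Here [n] is a
    common multiple of these: 1 for a prime, 2 for [q = 4]. *)
Lemma kernel_order n x i q : (0 < q)%N -> x *+ q = 0 ->
  (forall m, (m %| q)%N -> m != q -> (m %| n)%N) -> ~ order_mod x (Gf i) q ->
  x *+ n \in Gf i.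
Proof.
move=> q0 xq qn nox.
have [|m m0 om] := order_mod_exists (Gsub i) q0 (x := x).
  by rewrite xq fsubgroup0.
rewrite pmulrn om dvdzE; apply: qn; last by apply: contra_not_neq nox => <-.
by have := om q%:Z; rewrite -pmulrn xq fsubgroup0 // dvdzE.
Qed.

(** Multiplication by [p] on 2G has its kernel in one layer; each nonempty fibre is a translate of
    the kernel, so finitely many fibres also fit into one layer. *)
Lemma double_preimage p j0 : (forall y, y *+ 2 *+ p = 0 -> y *+ 2 \in Gf j0) ->
  forall l : seq G, exists j, forall y, y *+ 2 *+ p \in l -> y *+ 2 \in Gf j.
Proof.
move=> ker; elim=> [|a l [j lj]]; first by exists 0%N.
have [[w wa]|na] := pselect (exists w : G, w *+ 2 *+ p = a); last first.
  exists j => y; rewrite inE => /predU1P[ya|]; last exact: lj.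
  by case: na; exists y.
have [m wm] := Gexh (w *+ 2); exists (maxn j (maxn j0 m)) => y.
rewrite inE => /predU1P[ya|/lj]; last by apply: Gmono; apply: leq_maxl.
have -> : y *+ 2 = (y - w) *+ 2 + w *+ 2 by rewrite mulrnBl subrK.
apply: fsubgroupD => //.
  apply: Gmono (ker (y - w) _); first by rewrite leq_max leq_maxl orbT.
  by rewrite !mulrnBl ya wa subrr.
by apply: Gmono wm; rewrite leq_max leq_maxr orbT.
Qed.

(** If both cases fail, multiplication by any prime, hence by any positive integer, has a finite
    kernel on 2G, and orders modulo some layer [Gf i0] are below some [N0]. Then the factorial of
    [N0] sends 2G into [Gf i0], so 2G lies in a single layer. *)
Lemma dichotomy : (forall i, exists x, x *+ 2 \notin Gf i) ->
  (forall i N, exists x n, (N <= n)%N /\ order_mod x (Gf i) n) \/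
  exists q, [/\ (2 < q)%N, bump_system G q &
    forall i, exists x, x *+ q = 0 /\ order_mod x (Gf i) q].
Proof.
move=> h2; have [large|nlarge] := pselect (forall i N, exists x n,
  (N <= n)%N /\ order_mod x (Gf i) n); first by left.
right; apply: contrapT => nB.
have nind q : (2 < q)%N -> bump_system G q ->
    exists i, forall x, x *+ q = 0 -> ~ order_mod x (Gf i) q.
  move=> q2 bq; apply: contrapT => nq; apply: nB; exists q; split=> // i.
  apply: contrapT => ni; apply: nq; exists i => x xq ox.
  by apply: ni; exists x.
have prime_ker p : prime p -> exists j, forall y, y *+ 2 *+ p = 0 -> y *+ 2 \in Gf j.
  move=> pp; have [op|] := boolP (odd p); last first.
    (* For the prime 2, [2 (2y) = 0] means [4 y = 0], and the failure of the case [q = 4] gives that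
       2y lies in the layer. *)
    move=> /(prime_oddPn pp) ->.
    have [//|L x z sL Lz x4 z4 ox oz|i iP] := nind 4; first exact: bump_four ox oz.
    exists i => y; rewrite -mulrnA => y4; apply: kernel_order (iP _ y4) => //.
    by move=> m m4; have := dvdn_leq (isT : (0 < 4)%N) m4; case: m m4 => [|[|[|[|[|m]]]]].
  have p2 : (2 < p)%N by move: op (prime_gt1 pp); case: (p) => [|[|[]]].
  have [//|L x z sL Lz xp zp ox oz|i iP] := nind p; first exact: bump_prime ox oz.
  exists i => y yp; rewrite -[y *+ 2]mulr1n.
  apply: kernel_order (iP _ yp) => //; first exact: ltnW (prime_gt1 pp).
  move=> m mp mne; case/primeP: pp => _ /(_ m mp).
  by rewrite (negbTE mne) orbF dvdn1.
have all_ker m : (0 < m)%N -> forall i, exists j, forall y, y *+ 2 *+ m \in Gf i -> y *+ 2 \in Gf j.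
  elim/ltn_ind: m => m IH m0 i.
  have [m1|m1] := leqP m 1.
    by exists i => y; have -> : m = 1%N by lia.
  have pp := pdiv_prime m1; have [k mE] := dvdnP (pdiv_dvd m).
  have [j0 /double_preimage/(_ (Gf i))[j1 j1P]] := prime_ker _ pp.
  have p1 := prime_gt1 pp.
  have k0 : (0 < k)%N by move: m0; rewrite {1}mE muln_gt0 => /andP[].
  have km : (k < m)%N by rewrite mE ltn_Pmulr.
  have [j jP] := IH k km k0 j1.
  exists j => y; rewrite {1}mE mulrnA => ym; apply: jP.
  by rewrite mulrnAC; apply: j1P; rewrite (mulrnAC y).
have [i0 [N0 bnd]] : exists i0 N0, forall x n, order_mod x (Gf i0) n -> (n < N0)%N.
  apply: contrapT => nb; apply: nlarge => i N; apply: contrapT => nx; apply: nb.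
  exists i, N => x n ox; rewrite ltnNge; apply/negP => Nn; apply: nx.
  by exists x, n.
have [j jP] := all_ker N0`! (fact_gt0 _) i0.
have [x /negP] := h2 j; apply; apply: jP.
have [k xk] := Gexh (x *+ 2); have [M M0 xM] := fsubgroup_torsion (Gsub k) xk.
have [|n n0 ox] := order_mod_exists (Gsub i0) M0 (x := x *+ 2).
  by rewrite xM fsubgroup0.
rewrite pmulrn ox dvdzE dvdn_fact // n0 ltnW //.
exact: bnd ox.
Qed.

End Dichotomy.

Theorem theorem1p6 (R : realType) (G : zmodType)
  (hcount : countable [set: G]) (hlf : locally_finite G)
  (h2G : infinite_set [set g *+ 2 | g in [set: G]])
  (Gs : nat -> set G) (hGs : finite_filtration Gs)
  (alpha beta : R) (h0a : 0 <= alpha) (hab : alpha <= beta)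
  (hb1 : beta <= 1) (hb0 : 0 < beta) :
  exists A B : set G,
    [/\ infinite_set B, B `<=` subset_sums A,
        density_limits Gs A = `[alpha, beta]%classic
      & sumset B B `<=` subset_sums A].
Proof.
have Gsub := layer_fsubgroup hGs; have Gmono := layer_mono hGs.
have Gexh := layer_exhaust hGs.
have h2 i : exists x, x *+ 2 \notin layer Gs i.
  apply: contrapT => nx; apply: h2G; have [_ fin _ _] := hGs.
  apply: sub_finite_set (fin i) => _ [g _ <-]; apply/(mem_layer hGs).
  by apply: contrapT => /negP ng; apply: nx; exists g.
have [large|[q [q2 bq ind]]] := dichotomy Gsub Gmono Gexh h2.
  have S := large_strategy R Gsub Gmono Gexh large.
  exact: (strategy_limits hGs S).
have S := homo_strategy R Gsub Gmono Gexh q2 bq ind.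
exact: (strategy_limits hGs S).
Qed.
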